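(* Let $\mu\subset\lambda$ be partitions such that the skew diagram $\lambda/\mu$ has boxes in at most two rows, and let $(u,d,m,y)$ be the associated $4$-tuple (defined in the context). Then $$L^\lambda_\mu=L(u,d;m,y):=\sum_{\ell=0}^{d'}\binom{d'}{\ell}\prod_{i=0}^{\ell-1}(m+i+1-r)(i+r)\prod_{j=\ell+1}^{d'}(y+d'+r-j)(y+u+r+j),\qquad d'=d-m.$$
   Context: Fix a positive integer $M$, let $\alpha$ be an indeterminate, $r=1/\alpha$, $\mathbb{F}=\mathbb{Q}(\alpha)$. A partition $\lambda=(\lambda_1\ge\cdots\ge\lambda_M\ge0)$ is identified with its Young diagram $\{(i,j):1\le j\le\lambda_i\}$ (row $i$ from the top, column $j$); $\lambda'_j=\#\{i:\lambda_i\ge j\}$. For $s=(i,j)\in\lambda$: $\mathrm{arm}_\lambda(s)=\lambda_i-j$, $\mathrm{leg}_\lambda(s)=\lambda'_j-i$, $c_\lambda(s)=\mathrm{arm}_\lambda(s)+r\,\mathrm{leg}_\lambda(s)+r$, $c'_\lambda(s)=\mathrm{arm}_\lambda(s)+r\,\mathrm{leg}_\lambda(s)+1$. $\mu\subset\lambda$ means $\mu_i\le\lambda_i$ for all $i$. The Jack polynomial $P_\lambda$ is the unique eigenfunction of $D(\alpha)=\frac{\alpha}{2}\sum_i x_i^2\partial^2/\partial x_i^2+\sum_{i\ne j}\frac{x_i^2}{x_i-x_j}\partial/\partial x_i$ of the form $m_\lambda+\sum_{\mu<\lambda}v_{\lambda\mu}m_\mu$ (dominance order, $m_\mu$ monomial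 symmetric polynomials in $x_1,\dots,x_M$). The binomial coefficients $b^\lambda_\mu$ are defined by $\frac{P_\lambda(1+x_1,\dots,1+x_M)}{P_\lambda(1,\dots,1)}=\sum_\mu b^\lambda_\mu\frac{P_\mu(x)}{P_\mu(1,\dots,1)}$. For $\mu\subset\lambda$: $S=\lambda/\mu$; $R=\{(i,j)\in\mu:\mu_i<\lambda_i,\ \mu'_j=\lambda'_j\}$; $C=\{(i,j)\in\mu:\mu_i=\lambda_i,\ \mu'_j<\lambda'_j\}$; $J=\{(i,j)\in\mu:\mu_i<\lambda_i,\ \mu'_j<\lambda'_j\}$. Stem: $K^\lambda_\mu=\prod_{b\in C}\frac{c_\lambda(b)}{c_\mu(b)}\prod_{b\in R}\frac{c'_\lambda(b)}{c'_\mu(b)}\prod_{b\in J}\frac{1}{c_\mu(b)c'_\mu(b)}$; leaf $L^\lambda_\mu=b^\lambda_\mu/K^\lambda_\mu$. The $4$-tuple: if $\lambda/\mu$ has boxes in two rows, $u$ is the number of boxes in the upper row and $d$ the number in the lower row; if it has boxes in only one row (or none), $u=|\lambda|-|\mu|$ and $d=0$. $m$ is the number of columns containing boxes of both rows. If $m=0$ (gap case) and $d\ge1$, let $x^*$ be the rightmost box of $J$ and $y=\mathrm{arm}_\mu(x^* )+r\,\mathrm{leg}_\mu(x^* )$; if $m\ge1$ (overlap case), $y=0$. (When $d=0$ the formula does not depend on $y$.) *)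

(* Defs.v *)
From HB Require Import structures.
From mathcomp Require Import all_boot all_order all_algebra fraction.
From mathcomp Require Import mpoly.
From Stdlib Require Import ClassicalEpsilon.

Set Implicit Arguments.
Unset Strict Implicit.
Unset Printing Implicit Defensive.

Import GRing.Theory.

Local Open Scope ring_scope.

Definition Falpha : fieldType := {fraction {poly rat}}.

Definition alpha : Falpha := tofrac 'X.

Definition r : Falpha := alpha^-1.

(* A partition with at most [M] parts is a weakly decreasing exponent vector
   [lam : 'X_{1..M}], so that [mdeg lam] is its size; its containment order is
   the pointwise order [(mu <= lam)%MM]. Rows and columns are numbered from 0:
   the box [(i, j)] lies in [lam] when [j < lam i]. *)
Definition is_part (M : nat) (lam : 'X_{1..M}) : bool :=
  [forall i : 'I_M, forall j : 'I_M, (i <= j)%N ==> (lam j <= lam i)%N].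

Definition dominated (M : nat) (mu lam : 'X_{1..M}) : bool :=
  [&& mdeg mu == mdeg lam, mu != lam &
      [forall k : 'I_M,
         (\sum_(i < M | (i <= k)%N) mu i <= \sum_(i < M | (i <= k)%N) lam i)%N]].

Definition msymm (M : nat) (lam : 'X_{1..M}) : {mpoly Falpha[M]} :=
  \sum_(m : 'X_{1..M < (mdeg lam).+1} | perm_eq (val m) lam) 'X_[val m].

(* The operator [D(alpha)] takes its values in rational functions; it preserves
   polynomials only on symmetric arguments. *)
Definition Dalpha (M : nat) (p : {mpoly Falpha[M]}) :
    {fraction {mpoly Falpha[M]}} :=
  tofrac ((alpha / 2%:R) *: \sum_(i < M) 'X_i ^+ 2 * p^`M(i)^`M(i))
  + \sum_(i < M) \sum_(j < M | j != i)
      tofrac ('X_i ^+ 2) / tofrac ('X_i - 'X_j) * tofrac (p^`M(i)).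

Definition is_jack (M : nat) (lam : 'X_{1..M}) (p : {mpoly Falpha[M]}) : Prop :=
  (exists e : Falpha, Dalpha p = tofrac (e *: p)) /\
  (exists v : 'X_{1..M} -> Falpha,
     p = msymm lam
         + \sum_(mu : 'X_{1..M < (mdeg lam).+1} |
                   is_part (val mu) && dominated (val mu) lam)
             v (val mu) *: msymm (val mu)).

Definition jack (M : nat) (lam : 'X_{1..M}) : {mpoly Falpha[M]} :=
  epsilon (inhabits 0) (is_jack lam).

Definition jack_normalized (M : nat) (lam : 'X_{1..M}) : {mpoly Falpha[M]} :=
  ((jack lam).@[fun _ => 1])^-1 *: jack lam.

(* [b] has finite support in the set of partitions; the bound [n] makes the sum
   over all partitions finite. *)
Definition is_binomial_row (M : nat) (lam : 'X_{1..M})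
    (b : 'X_{1..M} -> Falpha) : Prop :=
  exists n : nat,
    (forall mu : 'X_{1..M}, b mu != 0 -> is_part mu && (mdeg mu <= n)%N) /\
    jack_normalized lam \mPo [tuple 1 + 'X_i | i < M]
    = \sum_(mu : 'X_{1..M < n.+1} | is_part (val mu))
        b (val mu) *: jack_normalized (val mu).

Definition jack_binomial (M : nat) (lam : 'X_{1..M}) : 'X_{1..M} -> Falpha :=
  epsilon (inhabits (fun _ => 0)) (is_binomial_row lam).

Definition box (M : nat) : Type := ('I_M * nat)%type.

Definition diagram (M : nat) (lam : 'X_{1..M}) : seq (box M) :=
  [seq (i, j) | i <- enum 'I_M, j <- iota 0 (lam i)].

Definition colen (M : nat) (lam : 'X_{1..M}) (j : nat) : nat :=
  #|[set i : 'I_M | (j < lam i)%N]|.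

(* The truncated subtractions are exact, since [arm] and [leg] are only used on
   boxes of [lam]. *)
Definition arm (M : nat) (lam : 'X_{1..M}) (s : box M) : nat :=
  (lam s.1 - s.2.+1)%N.

Definition leg (M : nat) (lam : 'X_{1..M}) (s : box M) : nat :=
  (colen lam s.2 - s.1.+1)%N.

Definition c_low (M : nat) (lam : 'X_{1..M}) (s : box M) : Falpha :=
  (arm lam s)%:R + r * (leg lam s)%:R + r.

Definition c_up (M : nat) (lam : 'X_{1..M}) (s : box M) : Falpha :=
  (arm lam s)%:R + r * (leg lam s)%:R + 1.

Definition skewS (M : nat) (lam mu : 'X_{1..M}) : seq (box M) :=
  [seq s <- diagram lam | (mu s.1 <= s.2)%N].

Definition boxesR (M : nat) (lam mu : 'X_{1..M}) : seq (box M) :=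
  [seq s <- diagram mu |
     (mu s.1 < lam s.1)%N && (colen mu s.2 == colen lam s.2)].

Definition boxesC (M : nat) (lam mu : 'X_{1..M}) : seq (box M) :=
  [seq s <- diagram mu |
     (mu s.1 == lam s.1) && (colen mu s.2 < colen lam s.2)%N].

Definition boxesJ (M : nat) (lam mu : 'X_{1..M}) : seq (box M) :=
  [seq s <- diagram mu |
     (mu s.1 < lam s.1)%N && (colen mu s.2 < colen lam s.2)%N].

Definition stem (M : nat) (lam mu : 'X_{1..M}) : Falpha :=
  (\prod_(s <- boxesC lam mu) (c_low lam s / c_low mu s))
  * (\prod_(s <- boxesR lam mu) (c_up lam s / c_up mu s))
  * (\prod_(s <- boxesJ lam mu) (c_low mu s * c_up mu s)^-1).

Definition leaf (M : nat) (lam mu : 'X_{1..M}) : Falpha :=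
  jack_binomial lam mu / stem lam mu.

Definition skew_rows (M : nat) (lam mu : 'X_{1..M}) : seq 'I_M :=
  [seq i <- enum 'I_M | (mu i < lam i)%N].

(* [enum 'I_M] is increasing, so in the two-row case the first row listed is
   the upper one. *)
Definition tuple_u (M : nat) (lam mu : 'X_{1..M}) : nat :=
  if skew_rows lam mu is [:: p; _] then (lam p - mu p)%N
  else (mdeg lam - mdeg mu)%N.

Definition tuple_d (M : nat) (lam mu : 'X_{1..M}) : nat :=
  if skew_rows lam mu is [:: _; q] then (lam q - mu q)%N else 0%N.

Definition tuple_m (M : nat) (lam mu : 'X_{1..M}) : nat :=
  if skew_rows lam mu is [:: p; q] then
    count (fun j : nat => ((p, j) \in skewS lam mu) && ((q, j) \in skewS lam mu))
          (iota 0 (mdeg lam))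
  else 0%N.

(* When [tuple_m lam mu = 0] and [0 < tuple_d lam mu], the boxes of [boxesJ]
   all lie in one row and the filtered list is the singleton of its rightmost
   box. When [tuple_d lam mu = 0], [boxesJ] is empty and the value is 0. *)
Definition tuple_y (M : nat) (lam mu : 'X_{1..M}) : Falpha :=
  if tuple_m lam mu == 0%N then
    let J := boxesJ lam mu in
    if [seq x <- J | all (fun s : box M => (s.2 <= x.2)%N) J] is x :: _
    then (arm mu x)%:R + r * (leg mu x)%:R else 0
  else 0.

Definition leafL (u d m : nat) (y : Falpha) : Falpha :=
  let d' := (d - m)%N in
  \sum_(0 <= l < d'.+1) 'C(d', l)%:R
    * (\prod_(0 <= i < l) (((m + i + 1)%:R - r) * (i%:R + r)))
    * (\prod_(l.+1 <= j < d'.+1)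
         ((y + d'%:R + r - j%:R) * (y + u%:R + r + j%:R))).

(* Main.v *)
Require Import Defs.
From HB Require Import structures.
From mathcomp Require Import all_boot all_fingroup all_algebra fraction.
From mathcomp Require Import ring zify mpoly.

(* Jack polynomials are the symmetric eigenfunctions of the sum of the squares of
   the Cherednik operators. Symmetrizing the degree-lowering intertwiner of these
   operators expands the sum of the partial derivatives of a normalized Jack
   polynomial over the partitions [lam - e_i], with coefficients [a_i] that are
   products over the rows. Since the translation by 1 intertwines the Euler
   operator with its sum with that operator, the binomial coefficients are
   determined by
     (|lam| - |mu|) b(lam, mu) = sum_i a_i b(lam - e_i, mu).
   If [lam/mu] lies in the rows p < q, only i = p, q contribute. Telescoping hook
   ratios shows that the stem is the product of the parts of the [a_p] and [a_q]
   that do not depend on the other row, times a rational function of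
   (u, d, m, y). Dividing it out leaves a two-term recursion for the leaf, which
   the sum L satisfies by Zeilberger's algorithm. *)

(** Nonsymmetric Jack polynomials are not constructed. If f is a symmetric eigenfunction with
    spectrum b, the product of the b_j - U_i over i != 0, applied to f, is an eigenvector of the
    Cherednik operator U_0; interpolation in z writes f as a combination of these vectors, one for
    each j. Lowering one of them and symmetrizing gives an eigenfunction whose spectrum is b with
    b_j decreased by 1, and genericity of r identifies it, up to a scalar, with a Jack polynomial.
    The scalar is found by evaluating at (1, ..., 1), where the Dunkl operator T_0 and U_0 = x_0 T_0
    give the same value; this is why normalizing at (1, ..., 1) yields product formulas, and the
    same identity shows by induction that the value there is not 0. The gap and overlap cases need
    separate recursions for L: removing a box from the lower row changes y in the former and m in
    the latter. The weight that couples the two rows changes form at the same place, d = mu_p -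
    mu_q. *)

Set Implicit Arguments.
Unset Strict Implicit.
Unset Printing Implicit Defensive.

Import GRing.Theory.

Local Open Scope ring_scope.

(** * Dunkl and Cherednik operators *)

(* Abstracts [{mpoly F[n]}] with its symmetric group action and its partial
   derivatives, on which unification is intractable. *)
Record symring (F : fieldType) (n : nat) := Symring {
  symring_sort :> idomainType;
  cst : {rmorphism F -> symring_sort};
  var : 'I_n -> symring_sort;
  act : 'S_n -> {rmorphism symring_sort -> symring_sort};
  pd : 'I_n -> {additive symring_sort -> symring_sort};
  symring_ind : forall P : symring_sort -> Prop,
    P 1 -> (forall i f, P f -> P (var i * f)) ->
    (forall f g, P f -> P g -> P (f + g)) ->
    (forall c f, P f -> P (cst c * f)) -> forall f, P f;
  var_inj : injective var;
  act1 : forall f, act 1%g f = f;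
  actM : forall u v f, act (u * v)%g f = act v (act u f);
  act_var : forall u i, act u (var i) = var (u i);
  act_cst : forall u c, act u (cst c) = cst c;
  pdM : forall i f g, pd i (f * g) = pd i f * g + f * pd i g;
  pd_var : forall i j, pd i (var j) = (i == j)%:R;
  pd_cst : forall i c, pd i (cst c) = 0
}.

Arguments cst {F n V} : rename.
Arguments var {F n V} : rename.
Arguments act {F n V} : rename.
Arguments pd {F n V} : rename.

Section Dunkl.
Variables (F : fieldType) (n : nat) (V : symring F n) (k : F).
Implicit Types (i j l : 'I_n) (s : 'S_n) (c : F) (f g : V).

Local Notation x := (@var F n V).
Local Notation C := (@cst F n V).
Local Notation ms := (@act F n V).

Lemma pd1 i : pd i (1 : V) = 0.
Proof. by rewrite -(rmorph1 C) pd_cst. Qed.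

Lemma pdC i c f : pd i (C c * f) = C c * pd i f.
Proof. by rewrite pdM pd_cst mul0r add0r. Qed.

Definition sw i j f := ms (tperm i j) f.

HB.instance Definition _ i j := GRing.RMorphism.copy (sw i j) (ms (tperm i j)).

Lemma swC i j c f : sw i j (C c * f) = C c * sw i j f.
Proof. by rewrite /sw rmorphM /= act_cst. Qed.

Lemma swM i j f g : sw i j (f * g) = sw i j f * sw i j g.
Proof. exact: rmorphM. Qed.

Lemma sw_id i f : sw i i f = f.
Proof. by rewrite /sw tperm1 act1. Qed.

Lemma sw_sym i j f : sw i j f = sw j i f.
Proof. by rewrite /sw tpermC. Qed.

Lemma swK i j : involutive (sw i j).
Proof. by move=> f; rewrite /sw -actM tperm2 act1. Qed.

Lemma act_sw s i j f : ms s (sw i j f) = sw (s i) (s j) (ms s f).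
Proof. by rewrite /sw -!actM -tpermJ conjgC. Qed.

Lemma subX_neq0 i j : i != j -> x i - x j != 0.
Proof. by move=> ij; rewrite subr_eq0 (inj_eq (@var_inj _ _ _)). Qed.

(** The statement is Boolean so that [xchoose] applies. The second conjunct fixes the value 0 on the
    diagonal, where the first one says nothing, so that [dunkl] may sum over all [j]. *)
Lemma ddiff_exists i j f : exists g,
  (f - sw i j f == (x i - x j) * g) && ((i == j) ==> (g == 0)).
Proof.
have [->|ij] := eqVneq i j.
  by exists 0; rewrite sw_id !subrr mul0r !eqxx.
elim/symring_ind: f => [|l f [g /andP[/eqP Eg _]]
  |f f' [g /andP[/eqP Eg _]] [h /andP[/eqP Eh _]]|c f [g /andP[/eqP Eg _]]].
- by exists 0; rewrite /sw rmorph1 subrr mulr0 eqxx.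
(* Twisted Leibniz rule: with s the transposition, x_l f - s(x_l f) = x_l (f - s f) + (x_l - s x_l)
   s f. *)
- exists (x l * g + (if l == i then 1 else if l == j then -1 else 0) * sw i j f).
  rewrite implyFb andbT; apply/eqP; rewrite mulrDr mulrCA -Eg swM.
  rewrite {1}/sw act_var; case: tpermP => [->|->|/eqP li /eqP lj].
  + by rewrite eqxx; time ring.
  + by rewrite eqxx (eq_sym j) (negbTE ij); time ring.
  + by rewrite (negbTE li) (negbTE lj); time ring.
- by exists (g + h); rewrite andbT raddfD mulrDr -Eg -Eh opprD addrACA.
- by exists (C c * g); rewrite andbT swC mulrCA -Eg mulrBr.
Qed.

Definition ddiff i j f := xchoose (ddiff_exists i j f).

Lemma ddiffE i j f : f - sw i j f = (x i - x j) * ddiff i j f.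
Proof. by have /andP[/eqP] := xchooseP (ddiff_exists i j f). Qed.

Lemma ddiff_ii i f : ddiff i i f = 0.
Proof.
by have /andP[_ /implyP/(_ (eqxx i))/eqP] := xchooseP (ddiff_exists i i f).
Qed.

Lemma ddiff_uniq i j f g :
  i != j -> f - sw i j f = (x i - x j) * g -> ddiff i j f = g.
Proof. by move=> ij; rewrite ddiffE => /mulfI; apply; apply: subX_neq0. Qed.

Lemma ddiff_is_additive i j : {morph ddiff i j : f g / f - g}.
Proof.
move=> f g; have [<-|ij] := eqVneq i j; first by rewrite !ddiff_ii subr0.
by apply: ddiff_uniq => //; rewrite raddfB mulrBr -!ddiffE; ring.
Qed.

HB.instance Definition _ i j :=
  GRing.isAdditive.Build V V (ddiff i j)
    (ddiff_is_additive i j).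

Lemma ddiffC i j c f : ddiff i j (C c * f) = C c * ddiff i j f.
Proof.
have [<-|ij] := eqVneq i j; first by rewrite !ddiff_ii mulr0.
by apply: ddiff_uniq => //; rewrite swC mulrCA -ddiffE mulrBr.
Qed.

Lemma ddiffX i j l f : ddiff i j (x l * f) =
  x l * ddiff i j f + ((i == l)%:R - (j == l)%:R) * sw i j f.
Proof.
have [<-|ij] := eqVneq i j; first by rewrite !ddiff_ii subrr mul0r mulr0 addr0.
apply: ddiff_uniq => //; rewrite mulrDr mulrCA -ddiffE swM {1}/sw act_var.
case: tpermP => [->|->|/eqP li /eqP lj].
+ by rewrite eqxx (eq_sym j) (negbTE ij) /=; time ring.
+ by rewrite eqxx (negbTE ij) /=; time ring.
+ by rewrite 2!(eq_sym _ l) (negbTE li) (negbTE lj); time ring.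
Qed.

Lemma ddiff1 i j : ddiff i j 1 = 0.
Proof.
have [<-|ij] := eqVneq i j; first exact: ddiff_ii.
by apply: ddiff_uniq => //; rewrite /sw rmorph1 subrr mulr0.
Qed.

Lemma act_ddiff s i j f : ms s (ddiff i j f) = ddiff (s i) (s j) (ms s f).
Proof.
have [<-|ij] := eqVneq i j; first by rewrite !ddiff_ii rmorph0.
symmetry; apply: ddiff_uniq; first by rewrite (inj_eq perm_inj).
by rewrite -act_sw -rmorphB ddiffE rmorphM rmorphB !act_var.
Qed.

Lemma act_pd s i f : ms s (pd i f) = pd (s i) (ms s f).
Proof.
elim/symring_ind: f => [|l f E|f g Ef Eg|c f E].
- by rewrite pd1 raddf0 rmorph1 pd1.
- by rewrite !(pdM, rmorphD, rmorphM, act_var, pd_var) /= E (inj_eq perm_inj) rmorph_nat.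
- by rewrite !raddfD /= Ef Eg.
- by rewrite pdC !rmorphM /= !act_cst pdC E.
Qed.

Let dunkl_fun i f := pd i f + C k * \sum_j ddiff i j f.

Let dunkl_fun_is_additive i : {morph dunkl_fun i : f g / f - g}.
Proof.
move=> f g; rewrite /dunkl_fun raddfB.
under eq_bigr => j _ do rewrite raddfB.
by rewrite big_split /= sumrN mulrBr opprD addrACA.
Qed.

HB.instance Definition _ i :=
  GRing.isAdditive.Build V V (dunkl_fun i) (dunkl_fun_is_additive i).

(* An opaque witness keeps unification from unfolding [dunkl]. *)
Fact dunkl_key i :
  {T : {additive V -> V} | forall f, T f = pd i f + C k * \sum_j ddiff i j f}.
Proof. by exists (dunkl_fun i). Qed.

Definition dunkl i : {additive V -> V} := sval (dunkl_key i).

Lemma dunklE i f : dunkl i f = pd i f + C k * \sum_j ddiff i j f.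
Proof. exact: (svalP (dunkl_key i)). Qed.

Lemma dunklD i f g : dunkl i (f + g) = dunkl i f + dunkl i g.
Proof. exact: raddfD. Qed.

Lemma dunklB i f g : dunkl i (f - g) = dunkl i f - dunkl i g.
Proof. exact: raddfB. Qed.

Lemma dunklC i c f : dunkl i (C c * f) = C c * dunkl i f.
Proof.
rewrite !dunklE pdC; under eq_bigr => j _ do rewrite ddiffC.
by rewrite -mulr_sumr mulrDr mulrCA.
Qed.

Lemma dunkl1 i : dunkl i 1 = 0.
Proof.
rewrite dunklE pd1 add0r big1 ?mulr0 // => j _.
by rewrite ddiff1.
Qed.

Lemma act_dunkl s i f : ms s (dunkl i f) = dunkl (s i) (ms s f).
Proof.
rewrite !dunklE rmorphD act_pd rmorphM /= act_cst; congr (_ + _ * _).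
rewrite raddf_sum [RHS](reindex_inj (@perm_inj _ s)) /=; apply: eq_bigr => j _.
exact: act_ddiff.
Qed.

Lemma dunklXE i l f : dunkl i (x l * f) = x l * dunkl i f + (i == l)%:R * f
  + C k * \sum_j ((i == l)%:R - (j == l)%:R) * sw i j f.
Proof.
rewrite !dunklE pdM pd_var (eq_bigr _ (fun j _ => ddiffX i j l f)) big_split /=.
by rewrite -mulr_sumr; ring.
Qed.

Lemma dunklX i f : dunkl i (x i * f) =
  x i * dunkl i f + f + C k * \sum_(j | j != i) sw i j f.
Proof.
rewrite dunklXE eqxx mul1r; congr (_ + _ * _).
rewrite (bigD1 i) //= eqxx subrr mul0r add0r; apply: eq_bigr => j /negbTE->.
by rewrite subr0 mul1r.
Qed.

Lemma dunklX_neq i l f : i != l ->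
  dunkl i (x l * f) = x l * dunkl i f - C k * sw i l f.
Proof.
move=> /[dup] il /negbTE E; rewrite dunklXE E mul0r addr0 -mulrN.
congr (_ + _ * _); rewrite (bigD1 l) //= eqxx sub0r mulN1r big1 ?addr0 //.
by move=> j /negbTE->; rewrite subrr mul0r.
Qed.

Lemma sw_dunkl i j l f : sw i j (dunkl l f) = dunkl (tperm i j l) (sw i j f).
Proof. exact: act_dunkl. Qed.

Lemma dunkl_sym i f : (forall s, act s f = f) -> dunkl i f = pd i f.
Proof.
move=> sf; rewrite dunklE big1 ?mulr0 ?addr0 // => j _.
have [<-|ij] := eqVneq i j; first exact: ddiff_ii.
by apply: ddiff_uniq => //; rewrite /sw sf subrr mulr0.
Qed.

(** Induction on the generators of the ring. For [l] outside {i, j}, the reflection terms produced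
    by x_l are symmetric in [i] and [j]; for [l] in {i, j} ([aux]), they cancel because a
    transposition carries one Dunkl operator to the other. *)
Lemma dunkl_comm i j f : dunkl i (dunkl j f) = dunkl j (dunkl i f).
Proof.
have [->//|ij] := eqVneq i j.
have ji : j != i by rewrite eq_sym.
have aux (a b : 'I_n) g : a != b -> dunkl a (dunkl b g) = dunkl b (dunkl a g) ->
    dunkl a (dunkl b (x b * g)) = dunkl b (dunkl a (x b * g)).
  move=> ab E; have ba : b != a by rewrite eq_sym.
  rewrite dunklX dunklX_neq // dunklB dunklC dunklX !dunklD dunklC.
  rewrite dunklX_neq // E (bigD1 a) //=. rewrite dunklD. rewrite raddf_sum /=.
  rewrite [X in _ = _ + _ * X - _](bigD1 a) //=.
  have -> : \sum_(c < n | (c != b) && (c != a)) dunkl a (sw b c g)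
          = \sum_(c < n | (c != b) && (c != a)) sw b c (dunkl a g).
    by apply: eq_bigr => c /andP[cb ca]; rewrite sw_dunkl tpermD // eq_sym.
  rewrite (sw_sym b a g) (sw_sym b a) !(sw_dunkl a b) tpermL tpermR.
  by ring.
elim/symring_ind: f => [|l f E|f g Ef Eg|c f E].
- by rewrite !(dunkl1, raddf0).
- have [->|li] := eqVneq l i; first by symmetry; apply: aux.
  have [->|lj] := eqVneq l j; first exact: aux.
  have il : i != l by rewrite eq_sym.
  have jl : j != l by rewrite eq_sym.
  rewrite !dunklX_neq // !dunklB !dunklX_neq // !dunklC E !sw_dunkl.
  by rewrite !tpermD //; ring.
- by rewrite !raddfD /= Ef Eg.
- by rewrite !dunklC E.
Qed.

End Dunkl.

(** * Cherednik operators and their commutativity *)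

Section Cherednik.
Variables (F : fieldType) (n : nat) (V : symring F n) (k : F).
Implicit Types (i j l : 'I_n) (s : 'S_n) (c z : F) (f g : V) (L : seq 'I_n).

Local Notation x := (@var F n V).
Local Notation C := (@cst F n V).
Local Notation T := (@dunkl F n V k).

Let cher_fun i f := x i * T i f + C k * \sum_(j < n | (j < i)%N) sw i j f.

Let cher_fun_is_additive i : {morph cher_fun i : f g / f - g}.
Proof.
move=> f g; rewrite /cher_fun raddfB mulrBr.
under eq_bigr => j _ do rewrite raddfB.
by rewrite big_split /= sumrN mulrBr opprD addrACA.
Qed.

HB.instance Definition _ i :=
  GRing.isAdditive.Build V V (cher_fun i) (cher_fun_is_additive i).

Fact cher_key i : {U : {additive V -> V} |
  forall f, U f = x i * T i f + C k * \sum_(j < n | (j < i)%N) sw i j f}.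
Proof. by exists (cher_fun i). Qed.

(** Summing over [j < i] makes [cher ord0] equal to x_0 T_0, and puts on weakly increasing exponents
    [eta] the diagonal entries eta_i + k i, free of [n]. *)
Definition cher i : {additive V -> V} := sval (cher_key i).

Lemma cherE i f :
  cher i f = x i * T i f + C k * \sum_(j < n | (j < i)%N) sw i j f.
Proof. exact: (svalP (cher_key i)). Qed.

Lemma cherD i f g : cher i (f + g) = cher i f + cher i g.
Proof. exact: raddfD. Qed.

Lemma cherB i f g : cher i (f - g) = cher i f - cher i g.
Proof. exact: raddfB. Qed.

Lemma cherC i c f : cher i (C c * f) = C c * cher i f.
Proof.
rewrite !cherE dunklC; under eq_bigr => j _ do rewrite swC.
by rewrite -mulr_sumr; ring.
Qed.

Let jm i f := \sum_(j < n | (j < i)%N) sw i j f.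

(* The Jucys-Murphy parts commute because [jm j] is invariant under the
   permutations of the indices below [j]; the commutator of the two Dunkl
   parts cancels against the term [sw i j] of [jm j]. *)
Lemma cher_comm i j f : cher i (cher j f) = cher j (cher i f).
Proof.
wlog ij : i j / (i < j)%N => [H|].
  by case: (ltngtP i j) => [/H//|/H->//|/val_inj->].
have Nij : i != j by rewrite neq_ltn ij.
have Nji : j != i by rewrite eq_sym.
have jmD a g h : jm a (g + h) = jm a g + jm a h.
  by rewrite /jm -big_split; apply: eq_bigr => l _; rewrite raddfD.
have jmC a c g : jm a (C c * g) = C c * jm a g.
  by rewrite /jm mulr_sumr; apply: eq_bigr => l _; rewrite swC.
have TX a b g : x a * T a (sw a b g) = sw a b (x b * T b g).
  by rewrite swM {2}/sw act_var sw_dunkl tpermR.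
have E1 a b : a != b ->
    x a * T a (x b * T b f) = x a * x b * T a (T b f) - C k * (x a * T a (sw a b f)).
  by move=> ab; rewrite dunklX_neq // sw_dunkl tpermR; ring.
have E2 : x i * T i (jm j f) =
    jm j (x i * T i f) + x i * T i (sw i j f) - x j * T j (sw i j f).
  rewrite /jm (bigD1 i) //= [in RHS](bigD1 i) //= dunklD -TX raddf_sum /=.
  rewrite (sw_sym j i) mulrDr.
  have -> : x i * \sum_(l < n | (l < j)%N && (l != i)) T i (sw j l f) =
            \sum_(l < n | (l < j)%N && (l != i)) sw j l (x i * T i f).
    rewrite mulr_sumr; apply: eq_bigr => l /andP[_ li].
    by rewrite swM {2}/sw act_var sw_dunkl !tpermD // eq_sym.
  by ring.
have E3 : jm i (x j * T j f) = x j * T j (jm i f).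
  rewrite /jm raddf_sum mulr_sumr; apply: eq_bigr => l li /=.
  have lj : l != j by rewrite neq_ltn (ltn_trans li ij).
  by rewrite swM {1}/sw act_var sw_dunkl !tpermD.
have E4 : jm i (jm j f) = jm j (jm i f).
  transitivity (\sum_(l < n | (l < i)%N) jm j (sw i l f)).
    apply: eq_bigr => l li; rewrite /jm raddf_sum.
    rewrite (reindex_inj (@perm_inj _ (tperm i l))) /=.
    have lj : l != j by rewrite neq_ltn (ltn_trans li ij).
    apply: eq_big => m; last first.
      move=> _; rewrite -[LHS]/(act (tperm i l) _) act_sw tpermK.
      by rewrite tpermD.
    by case: (tpermP i l m) => // ->; rewrite ij (ltn_trans li ij).
  by rewrite /jm exchange_big; apply: eq_bigr => m _ /=; rewrite raddf_sum.
have E a b : cher a (cher b f) = x a * T a (x b * T b f)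
    + C k * (x a * T a (jm b f) + jm a (x b * T b f) + C k * jm a (jm b f)).
  by rewrite (cherE b) -/(jm b f) cherD cherC !(cherE a) -!/(jm a _) !dunklE; ring.
rewrite !E E3 E4 E2 (E1 i j) // (E1 j i) // (dunkl_comm k i j f) (sw_sym j i).
by ring.
Qed.
End Cherednik.

(** * Adjacent transpositions and symmetric functions of the Cherednik operators *)

Section AllPerms.
Variable n : nat.
Implicit Types (i j : 'I_n) (s : 'S_n).

(** The Cherednik operators have simple exchange relations with adjacent transpositions only; any
    other transposition is conjugate, by an adjacent one, to a shorter one. *)
Lemma perm_ind_adj (P : 'S_n -> Prop) :
  P 1%g -> (forall s t, P s -> P t -> P (s * t)%g) ->
  (forall i j, j = i.+1 :> nat -> P (tperm i j)) -> forall s, P s.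
Proof.
move=> P1 PM PA.
have PT d i j : j = (i + d)%N :> nat -> P (tperm i j).
  elim: d i j => [|d IH] i j E.
    have -> : j = i by apply: val_inj; rewrite /= E addn0.
    by rewrite tperm1.
  have h : (i + d < n)%N by have := ltn_ord j; lia.
  pose l := Ordinal h; have [E1|ij] := eqVneq d 0%N.
    by apply: (PA); rewrite E E1 addn1.
  have li : l != i by rewrite -(inj_eq val_inj) /=; apply/eqP; lia.
  have ji : j != i by rewrite -(inj_eq val_inj) /= E; apply/eqP; lia.
  have -> : tperm i j = (tperm l j * tperm i l * tperm l j)%g.
    by rewrite -{1}(tpermV l j) -mulgA -/(conjg _ _) tpermJ tpermD // tpermL.
  have Plj : P (tperm l j) by apply: (PA); rewrite /= E addnS.
  by apply: (PM) => //; apply: (PM) => //; apply: IH.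
move=> s; have [ts -> _] := prod_tpermP s.
elim: ts => [|[a b] ts IH]; first by rewrite big_nil.
rewrite big_cons; apply: (PM) => //=.
have [ab|/ltnW ba] := leqP a b; first by apply: (PT (b - a)%N); rewrite subnKC.
by rewrite tpermC; apply: (PT (a - b)%N); rewrite subnKC.
Qed.
End AllPerms.

Section OpProd.
Variables (F : fieldType) (n : nat) (V : symring F n) (k : F).
Implicit Types (i j l : 'I_n) (s : 'S_n) (c z : F) (f g : V) (L : seq 'I_n).

Local Notation x := (@var F n V).
Local Notation C := (@cst F n V).
Local Notation T := (@dunkl F n V k).
Local Notation U := (@cher F n V k).

Lemma act_cher s i f : act s (U i f) = x (s i) * T (s i) (act s f)
  + C k * \sum_(j < n | (j < i)%N) sw (s i) (s j) (act s f).
Proof.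
rewrite cherE rmorphD !rmorphM /= act_var act_cst act_dunkl raddf_sum.
by congr (_ + _ * _); apply: eq_bigr => j _; apply: act_sw.
Qed.

(** A relation of the degenerate affine Hecke algebra. The reflection sum for [j] has exactly one
    term more than the image of the sum for [i], namely [sw i j], and this term accounts for C k *
    f. *)
Lemma sw_cher i j f : j = i.+1 :> nat ->
  sw i j (U i f) = U j (sw i j f) - C k * f.
Proof.
move=> ij; rewrite [LHS]act_cher tpermL cherE -/(sw i j f).
rewrite [in RHS](bigD1 i) ?ij //= sw_sym swK mulrDr.
rewrite [C k * f + _]addrC addrA addrK; congr (_ + _ * _).
apply: eq_big => l; last by move=> li; rewrite tpermD //;
  rewrite -(inj_eq val_inj) /=; lia.
by rewrite ltnS ltn_neqAle andbC.
Qed.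

Lemma sw_cher' i j f : j = i.+1 :> nat ->
  sw i j (U j f) = U i (sw i j f) + C k * f.
Proof.
move=> ij; apply: (can_inj (swK i j)).
by rewrite swK raddfD /= (sw_cher _ ij) swK swC subrK.
Qed.

Lemma sw_cher_neq i j l f : j = i.+1 :> nat -> l != i -> l != j ->
  sw i j (U l f) = U l (sw i j f).
Proof.
move=> ij li lj; rewrite [LHS]act_cher cherE -/(sw i j f).
rewrite tpermD 1?eq_sym //; congr (_ + _ * _).
rewrite [RHS](reindex_inj (@perm_inj _ (tperm i j))) /=.
apply: eq_bigl => m; case: tpermP => // -> /=.
  have := li; have := lj; rewrite -!(inj_eq val_inj) /=; lia.
have := li; have := lj; rewrite -!(inj_eq val_inj) /=; lia.
Qed.

Definition opprod L z f := foldr (fun i g => C z * g - U i g) f L.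

Lemma opprod_is_additive L z : {morph opprod L z : f g / f - g}.
Proof.
move=> f g; elim: L => //= i L ->; rewrite cherB; ring.
Qed.

HB.instance Definition _ L z :=
  GRing.isAdditive.Build V V (opprod L z) (opprod_is_additive L z).

Lemma opprodB L z f g : opprod L z (f - g) = opprod L z f - opprod L z g.
Proof. exact: raddfB. Qed.

Lemma opprodD L z f g : opprod L z (f + g) = opprod L z f + opprod L z g.
Proof. exact: raddfD. Qed.

Lemma opprod_cst L z c f : opprod L z (C c * f) = C c * opprod L z f.
Proof. by elim: L => //= i L ->; rewrite cherC; ring. Qed.

Lemma opprod_cat L1 L2 z f : opprod (L1 ++ L2) z f = opprod L1 z (opprod L2 z f).
Proof. exact: foldr_cat. Qed.

Lemma opprod_cher L z i f : opprod L z (U i f) = U i (opprod L z f).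
Proof. by elim: L => //= j L ->; rewrite cherB cherC cher_comm. Qed.

Lemma opprodC L1 L2 z1 z2 f :
  opprod L1 z1 (opprod L2 z2 f) = opprod L2 z2 (opprod L1 z1 f).
Proof.
by elim: L1 => //= i L ->; rewrite raddfB /= opprod_cst opprod_cher.
Qed.

Lemma opprod_perm L1 L2 z f : perm_eq L1 L2 -> opprod L1 z f = opprod L2 z f.
Proof.
move: L2; elim: L1 => [|i L1 IH] L2; first by rewrite perm_sym => /perm_nilP->.
move=> p; have iL2 : i \in L2 by rewrite -(perm_mem p) mem_head.
case/splitPr: iL2 p => L L'; rewrite perm_sym -cat1s perm_catCA perm_cons perm_sym.
move/IH => /= ->; rewrite !opprod_cat /= raddfB /= opprod_cst.
by rewrite opprod_cher.
Qed.

Lemma sw_opprod i j L z f : j = i.+1 :> nat -> i \notin L -> j \notin L ->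
  sw i j (opprod L z f) = opprod L z (sw i j f).
Proof.
move=> ij; elim: L => //= l L IH; rewrite !inE !negb_or => /andP[il iL] /andP[jl jL].
by rewrite raddfB /= swC sw_cher_neq ?IH // eq_sym.
Qed.

(** Generating function in [z] of the elementary symmetric functions of the Cherednik operators; its
    eigenvalues record the whole spectrum with multiplicities. *)
Definition S z f := opprod (enum 'I_n) z f.

HB.instance Definition _ z := GRing.Additive.copy (S z) (opprod (enum 'I_n) z).

Lemma S_perm L z f : uniq L -> L =i 'I_n -> S z f = opprod L z f.
Proof.
move=> uL LE; apply: opprod_perm; apply: uniq_perm => //; first exact: enum_uniq.
by move=> i; rewrite mem_enum LE.
Qed.

(** The product of the two factors at [i] and [j] commutes with their transposition although neither
    factor does: the two corrections by k cancel. *)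
Lemma sw_opprod2 i j L z f : j = i.+1 :> nat -> uniq L -> i \in L -> j \in L ->
  sw i j (opprod L z f) = opprod L z (sw i j f).
Proof.
move=> ij uL iL jL; have Nij : i != j by rewrite -(inj_eq val_inj) /= ij; lia.
pose L' := rem j (rem i L).
have jL' : j \in rem i L by rewrite mem_rem_uniq // inE eq_sym Nij.
have LE : perm_eq L (i :: j :: L').
  by rewrite (perm_trans (perm_to_rem iL)) // perm_cons perm_to_rem.
have uL' : uniq (i :: j :: L') by rewrite -(perm_uniq LE).
have /andP[iL' jL''] : (i \notin L') && (j \notin L').
  by move: uL'; rewrite /= inE negb_or => /and3P[/andP[_ ->] -> _].
rewrite !(opprod_perm _ _ LE) /=.
have <- : sw i j (opprod L' z f) = opprod L' z (sw i j f) by apply: sw_opprod.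
set G := opprod L' z f; rewrite !cherB !cherC.
have swB g h : sw i j (g - h) = sw i j g - sw i j h by exact: raddfB.
rewrite !(swB, swC) (sw_cher (U j G) ij) (sw_cher' _ ij) cherD cherC.
by rewrite (sw_cher G ij) (cher_comm k i j); ring.
Qed.

Lemma act_S s z f : act s (S z f) = S z (act s f).
Proof.
elim/perm_ind_adj: s f => [f|s t IHs IHt f|i j ij f].
- by rewrite !act1.
- by rewrite !actM IHs IHt.
- by apply: sw_opprod2; rewrite ?mem_enum ?enum_uniq.
Qed.

(** Treated beside [S] because the sum of squares is the function that matches D(alpha), whereas [S]
    gives access to the whole spectrum. *)
Lemma act_sum_cher2 s f :
  act s (\sum_i U i (U i f)) = \sum_i U i (U i (act s f)).
Proof.
elim/perm_ind_adj: s f => [f|s t IHs IHt f|i j ij f].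
- by rewrite !act1.
- by rewrite !actM IHs IHt.
have Nij : j != i by rewrite -(inj_eq val_inj) /= ij; lia.
rewrite (bigD1 i) //= (bigD1 j) //= [RHS](bigD1 i) //= [X in _ = _ + X](bigD1 j) //=.
rewrite -!/(sw i j _) !rmorphD /= !addrA; congr (_ + _); last first.
  rewrite raddf_sum; apply: eq_bigr => l /andP[li lj] /=.
  by rewrite !sw_cher_neq.
rewrite -!/(sw i j _) (sw_cher (U i f) ij) (sw_cher f ij) (sw_cher' (U j f) ij).
by rewrite (sw_cher' f ij) cherB cherD !cherC; ring.
Qed.

End OpProd.

(** * Symmetrization of products with one factor omitted *)

Section Ladder.
Variables (F : fieldType) (m : nat).
Local Notation n := m.+1.
Variables (V : symring F n) (k : F).
Implicit Types (i j l : 'I_n) (s : 'S_n) (c z : F) (f g : V) (L : seq 'I_n).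

Local Notation x := (@var F n V).
Local Notation C := (@cst F n V).
Local Notation T := (@dunkl F n V k).
Local Notation U := (@cher F n V k).
Local Notation S := (@S F n V k).
Local Notation opprod := (@opprod F n V k).

Definition symmetrized f := \sum_(s : 'S_n) act s f.

Let symmetrized_is_additive : {morph symmetrized : f g / f - g}.
Proof.
move=> f g; rewrite -sumrB; apply: eq_bigr => s _; exact: raddfB.
Qed.

HB.instance Definition _ :=
  GRing.isAdditive.Build V V symmetrized symmetrized_is_additive.

Lemma symmetrized_act s f : symmetrized (act s f) = symmetrized f.
Proof.
rewrite /symmetrized [RHS](reindex_inj (mulgI s)).
by apply: eq_bigr => t _; rewrite actM.
Qed.

Lemma act_symmetrized s f : act s (symmetrized f) = symmetrized f.
Proof.
rewrite /symmetrized raddf_sum [RHS](reindex_inj (mulIg s)).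
by apply: eq_bigr => t _; rewrite actM.
Qed.

Lemma symmetrizedC c f : symmetrized (C c * f) = C c * symmetrized f.
Proof.
by rewrite mulr_sumr; apply: eq_bigr => s _; rewrite rmorphM /= act_cst.
Qed.

Lemma symmetrized_S z f : symmetrized (S z f) = S z (symmetrized f).
Proof. by rewrite raddf_sum; apply: eq_bigr => s _; rewrite act_S. Qed.

Lemma symmetrized_sym f :
  (forall s, act s f = f) -> symmetrized f = n`!%:R * f.
Proof.
by move=> sf; rewrite /symmetrized (eq_bigr _ (fun s _ => sf s)) sumr_const
  card_Sn mulr_natl.
Qed.

Definition R z f := opprod (map (lift ord0) (enum 'I_m)) z f.

Lemma S_R z f : S z f = C z * R z f - U ord0 (R z f).
Proof. by rewrite /S enum_ordSl. Qed.

Let below (a : nat) := [seq i : 'I_n <- enum 'I_n | (i < a)%N].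
Let above (a : nat) := [seq i : 'I_n <- enum 'I_n | (a <= i)%N].

Let mem_below a i : (i \in below a) = (i < a)%N.
Proof. by rewrite mem_filter mem_enum andbT. Qed.

Let mem_above a i : (i \in above a) = (a <= i)%N.
Proof. by rewrite mem_filter mem_enum andbT. Qed.

Let belowS l : perm_eq (below l.+1) (l :: below l).
Proof.
have ub a : uniq (below a) by exact: filter_uniq (enum_uniq _).
apply: uniq_perm; rewrite ?cons_uniq ?ub ?mem_below ?mem_above ?ltnn //.
by move=> i; rewrite inE !mem_below ltnS leq_eqVlt -(inj_eq val_inj).
Qed.

Let aboveS l : perm_eq (above l) (l :: above l.+1).
Proof.
have ub a : uniq (above a) by exact: filter_uniq (enum_uniq _).
apply: uniq_perm; rewrite ?cons_uniq ?ub ?mem_below ?mem_above ?ltnn //.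
move=> i; rewrite inE !mem_above leq_eqVlt -(inj_eq val_inj).
by rewrite eq_sym.
Qed.

(* Replacing [z] by [z - k] one factor at a time; the successive quotients
   are conjugate under adjacent transpositions. *)
Lemma symmetrized_R z f : (forall s, act s f = f) ->
  n`!%:R * (S z f - S (z - k) f) = C k * n%:R * symmetrized (R z f).
Proof.
move=> sf.
(* In [B a] the factors of index below [a] have been shifted; [A l] is the common part of [B l] and
   [B l.+1], which lacks the factor of index [l]. *)
pose A (a : nat) := opprod (below a) (z - k) (opprod (above a.+1) z f).
pose B (a : nat) := opprod (below a) (z - k) (opprod (above a) z f).
have BA l : B l - B l.+1 = C k * A l.
  rewrite /B (opprod_perm k _ _ (aboveS l)) (opprod_perm k _ _ (belowS l)) /=.
  by rewrite raddfB /= opprod_cst opprod_cher -/(A l) rmorphB; ring.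
have AS l l' : l' = l.+1 :> nat -> sw l l' (A l) = A l'.
  move=> ll'; have Al' : above l.+1 = above l' by rewrite ll'.
  have Bl' : below l' = below l.+1 by rewrite ll'.
  rewrite /A Bl' (opprod_perm k _ _ (belowS l)) Al'.
  rewrite (opprod_perm k _ _ (aboveS l')) /=.
  rewrite sw_opprod // ?mem_below ?ltnn //; last first.
    by rewrite ll' -leqNgt.
  set G := opprod (above l'.+1) z f.
  have GE : sw l l' G = G.
    rewrite sw_opprod // ?mem_above ?ltnn //; first by rewrite /sw sf.
    by rewrite ll' -ltnNge leqW.
  have swB g h : sw l l' (g - h) = sw l l' g - sw l l' h by exact: raddfB.
  rewrite swB swC (sw_cher' _ _ ll') GE.
  rewrite opprodB opprodD !opprod_cst opprod_cher rmorphB.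
  by ring.
have SyA l : symmetrized (A l) = symmetrized (R z f).
  case: l => a la; elim: a la => [|a IH] la.
    congr symmetrized; rewrite /A /R /=.
    have -> : below 0 = [::] by apply: size0nil; rewrite size_filter count_pred0.
    rewrite /=; apply: opprod_perm; rewrite -(perm_cons ord0) -enum_ordSl.
    have := aboveS ord0; rewrite perm_sym => /perm_trans->//.
    by rewrite /above (eq_filter (a2 := predT)) ?filter_predT.
  rewrite -(IH (ltnW la)) -[RHS](symmetrized_act (tperm (Ordinal (ltnW la)) (Ordinal la))).
  by congr symmetrized; rewrite -[RHS]/(sw _ _ _) (AS _ (Ordinal la)).
have XE : S z f - S (z - k) f = C k * \sum_(l < n) A l.
  have -> : S z f = B 0%N.
    rewrite /B /S /above (eq_filter (a2 := predT)) ?filter_predT //.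
    by have -> : below 0 = [::] by apply: size0nil; rewrite size_filter count_pred0.
  have -> : S (z - k) f = B n.
    rewrite /B /S /below (eq_in_filter (a2 := predT)) ?filter_predT; last first.
      by move=> i _; rewrite /= ltn_ord.
    have -> // : above n = [::].
    apply: size0nil; rewrite size_filter -(count_pred0 (enum 'I_n)).
    by apply: eq_count => i /=; rewrite leqNgt ltn_ord.
  rewrite mulr_sumr -(eq_bigr _ (fun l _ => BA l)).
  rewrite -(big_mkord xpredT (fun a : nat => B a - B a.+1)).
  have := telescope_sumr (fun a => - B a) (leq0n n).
  rewrite opprK addrC => <-; by apply: eq_bigr => a _; rewrite opprK addrC.
rewrite -symmetrized_sym => [|s].
  rewrite XE symmetrizedC raddf_sum /= (eq_bigr _ (fun l _ => SyA l)).
  by rewrite sumr_const card_ord; ring.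
by rewrite raddfB /= !act_S !sf.
Qed.
End Ladder.

(** * Lagrange interpolation *)

Section Lagrange.
Variables (F : fieldType) (m : nat) (b : 'I_m.+1 -> F).
Hypothesis b_inj : injective b.

(** The left side is the coefficient of X^m in the interpolant of X^t at the nodes b_j, which is X^t
    itself because [t <= m]. *)
Lemma sum_lagrange (t : nat) : (t <= m)%N ->
  \sum_j b j ^+ t / \prod_(l | l != j) (b j - b l) = (t == m)%:R.
Proof.
move=> tm; pose d j := \prod_(l | l != j) (b j - b l).
have d0 j : d j != 0.
  by apply/prodf_neq0 => l lj; rewrite subr_eq0 (inj_eq b_inj) eq_sym.
pose N j : {poly F} := \prod_(l | l != j) ('X - (b l)%:P).
have sN j : size (N j) = m.+1.
  by rewrite /N -big_filter size_prod_XsubC -sum1_size big_filter sum1_card cardC1 card_ord.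
have lN j : (N j)`_m = 1.
  have : N j \is monic by apply: monic_prod_XsubC.
  by rewrite monicE /lead_coef sN => /eqP.
pose q : {poly F} := \sum_j (b j ^+ t / d j) *: N j.
have -> : \sum_j b j ^+ t / d j = q`_m.
  by rewrite coef_sum; apply: eq_bigr => j _; rewrite coefZ lN mulr1.
have -> : q = 'X^t; last by rewrite coefXn eq_sym.
apply/eqP; rewrite -subr_eq0; apply/negPn/negP => h.
have ub : uniq [seq b j | j <- enum 'I_m.+1] by rewrite map_inj_uniq ?enum_uniq.
have rb : all (root (q - 'X^t)) [seq b j | j <- enum 'I_m.+1].
  apply/allP => _ /mapP[j _ ->]; rewrite rootE hornerD hornerN hornerXn horner_sum.
  rewrite (bigD1 j) //= hornerZ big1 => [|l lj].
    rewrite addr0 /N horner_prod; under eq_bigr => l _ do rewrite hornerXsubC.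
    by rewrite divfK ?subrr ?d0.
  rewrite hornerZ /N horner_prod (bigD1 j) 1?eq_sym //= hornerXsubC subrr.
  by rewrite mul0r mulr0.
have := max_poly_roots h rb ub; rewrite size_map size_enum_ord ltnNge => /negP; apply.
rewrite (leq_trans (size_polyD _ _)) // geq_max size_polyN size_polyXn ltnS tm andbT.
apply: leq_trans (size_sum _ _ _) _; apply/bigmax_leqP => j _.
by rewrite (leq_trans (size_scale_leq _ _)) ?sN.
Qed.
End Lagrange.

(** * The degree-lowering intertwiner and its action on eigenvectors *)

Section Lowering.
Variables (F : fieldType) (m : nat).
Local Notation n := m.+1.
Variables (V : symring F n) (k : F).
Implicit Types (i j l : 'I_n) (s : 'S_n) (c z : F) (f g : V) (L : seq 'I_n).

Local Notation x := (@var F n V).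
Local Notation C := (@cst F n V).
Local Notation T := (@dunkl F n V k).
Local Notation U := (@cher F n V k).
Local Notation S := (@S F n V k).
Local Notation R := (@R F m V k).
Local Notation opprod := (@opprod F n V k).

Let cyc : 'S_n := lift_perm ord_max ord0 1%g.

Let cyc_max : cyc ord_max = ord0. Proof. exact: lift_perm_id. Qed.

Let cyc_lift (i : 'I_m) : cyc (lift ord_max i) = lift ord0 i.
Proof. by rewrite /cyc lift_perm_lift perm1. Qed.

(* The affine intertwiner: it carries [cher] of one index to [cher] of the
   preceding one, cyclically, and lowers the degree by one. *)
Definition theta f := act cyc^-1%g (T ord0 f).

Lemma thetaB f g : theta (f - g) = theta f - theta g.
Proof. by rewrite /theta dunklB rmorphB. Qed.

Lemma thetaC c f : theta (C c * f) = C c * theta f.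
Proof. by rewrite /theta dunklC rmorphM /= act_cst. Qed.

Let act_cyc_theta f : act cyc (theta f) = T ord0 f.
Proof. by rewrite /theta -actM mulVg act1. Qed.

Lemma theta_lift (i : 'I_m) f :
  theta (U (lift ord0 i) f) = U (lift ord_max i) (theta f).
Proof.
rewrite -[RHS]act1 -(mulgV cyc) actM {1}/theta; congr (act _ _).
rewrite act_cher cyc_lift act_cyc_theta cherE dunklD dunklX_neq //.
rewrite sw_dunkl tpermR dunklC (bigD1 ord0) //= dunklD raddf_sum /=.
rewrite (sw_sym (lift _ _)) dunkl_comm.
have -> : \sum_(j < n | (j < lift ord_max i)%N) sw (lift ord0 i) (cyc j) (T ord0 f)
  = \sum_(j < n | (j < lift ord0 i)%N && (j != ord0)) T ord0 (sw (lift ord0 i) j f).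
  rewrite [RHS](reindex_inj (@perm_inj _ cyc)).
  apply: eq_big => j; last first.
    case: (unliftP ord_max j) => [j' ->|->]; rewrite ?cyc_max ?cyc_lift => h.
      by rewrite sw_dunkl tpermD.
    by move: h; rewrite lift_max /= ltnNge ltnW.
  case: (unliftP ord_max j) => [j' ->|->]; rewrite ?cyc_max ?cyc_lift ?andbF.
    by rewrite !lift_max !lift0 ltnS andbT.
  by rewrite lift_max /= ltnNge ltnW.
by ring.
Qed.

Lemma cher0 f : U ord0 f = x ord0 * T ord0 f.
Proof. by rewrite cherE big1 ?mulr0 ?addr0. Qed.

(** The index that wraps around loses 1 in its eigenvalue; this 1 is the term f in [dunklX], the
    commutator of T_0 with x_0. *)
Lemma theta_0 f : theta (U ord0 f) = U ord_max (theta f) + theta f.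
Proof.
rewrite -[RHS]act1 -(mulgV cyc) actM {1}/theta; congr (act _ _).
rewrite rmorphD /= act_cher cyc_max act_cyc_theta cher0 dunklX.
have -> : \sum_(j < n | (j < @ord_max m)%N) sw ord0 (cyc j) (T ord0 f)
  = \sum_(j < n | j != ord0) sw ord0 j (T ord0 f).
  rewrite [RHS](reindex_inj (@perm_inj _ cyc)); apply: eq_bigl => j.
  case: (unliftP ord_max j) => [j' ->|->]; rewrite ?cyc_max ?cyc_lift ?ltnn //.
  by rewrite lift_max /= ltn_ord.
by ring.
Qed.

Lemma theta_R z f :
  theta (R z f) = opprod (map (lift ord_max) (enum 'I_m)) z (theta f).
Proof.
rewrite /R; elim: (enum _) => //= i L IH.
by rewrite -IH -theta_lift thetaB thetaC.
Qed.

Lemma S_theta z f : S z (theta f) = theta (C (z + 1) * R z f - U ord0 (R z f)).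
Proof.
have -> : S z (theta f) = opprod (ord_max :: map (lift ord_max) (enum 'I_m)) z (theta f).
  apply: S_perm => [|i].
    rewrite /= map_inj_uniq ?enum_uniq ?andbT; last exact: lift_inj.
    by apply/mapP => -[i _ /eqP]; rewrite (negbTE (neq_lift _ _)).
  rewrite !inE; case: (unliftP ord_max i) => [i' ->|->]; rewrite ?eqxx //.
  by rewrite map_f ?orbT ?mem_enum.
rewrite /= -theta_R.
have -> : U ord_max (theta (R z f)) = theta (U ord0 (R z f)) - theta (R z f).
  by rewrite theta_0 addrK.
by rewrite thetaB thetaC rmorphD rmorph1; ring.
Qed.

Section Eigen.
Variables (b : 'I_n -> F) (f : V).
Hypothesis sf : forall s, act s f = f.
Hypothesis Sf : forall z, S z f = C (\prod_l (z - b l)) * f.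
Variable j : 'I_n.

(** Only the factor b_j - U_0 of [S (b j)] is missing. Since [S (b j)] kills [f], what remains is an
    eigenvector of U_0; it plays the role of a nonsymmetric Jack polynomial. *)
Definition eigen_part := R (b j) f.
Local Notation v := eigen_part.

Definition lowered := symmetrized (T ord0 v).

Lemma cher0_eigen : U ord0 v = C (b j) * v.
Proof.
apply/esym/eqP; rewrite -subr_eq0 -S_R Sf (bigD1 j) //= subrr mul0r rmorph0.
by rewrite mul0r.
Qed.

(** [S z] is (z - U_0) times [R z], and U_0 acts on [v] by b_j. The factor z - b_j stays on the left
    so that the identity holds at z = b_j too. *)
Lemma R_eigen z : C (z - b j) * R z v = C (\prod_l (z - b l)) * v.
Proof.
have : S z v = C (\prod_l (z - b l)) * v.
  by rewrite /S /v /R opprodC -/(S z f) Sf opprod_cst.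
by rewrite S_R /R -opprod_cher cher0_eigen opprod_cst rmorphB => <-; ring.
Qed.

(** Denominator-free form of the fact that lowering replaces b_j by b_j - 1 in the spectrum. *)
Lemma S_theta_eigen z : C (z - b j) * S z (theta v) =
  C ((z - b j + 1) * \prod_l (z - b l)) * theta v.
Proof.
rewrite S_theta {2}/R -opprod_cher cher0_eigen opprod_cst -mulrBl -rmorphB.
by rewrite -thetaC mulrCA R_eigen !thetaC !rmorphM addrAC; ring.
Qed.

Lemma loweredE : lowered = symmetrized (theta v).
Proof. by rewrite /theta symmetrized_act. Qed.

Lemma S_lowered z : C (z - b j) * S z lowered =
  C ((z - b j + 1) * \prod_l (z - b l)) * lowered.
Proof.
by rewrite loweredE -symmetrized_S -!symmetrizedC S_theta_eigen.
Qed.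

Lemma act_lowered s : act s lowered = lowered.
Proof. exact: act_symmetrized. Qed.

(** This is [symmetrized_R] at z = b_j: [S (b j)] kills [f], and the eigenvalue of [S (b j - k)] has
    the factor -k at l = j, which cancels k. *)
Lemma symmetrized_eigen : k != 0 -> n%:R * symmetrized v =
  n`!%:R * (C (\prod_(l | l != j) (b j - b l - k)) * f).
Proof.
move=> k0; have := symmetrized_R k (b j) sf; rewrite !Sf (bigD1 j) //= subrr mul0r.
rewrite rmorph0 mul0r sub0r (bigD1 j) //= => E.
have Ck : C k != 0 by rewrite fmorph_eq0.
apply: (mulfI Ck); rewrite mulrA -E; under eq_bigr => l _ do rewrite addrAC.
by rewrite rmorphM !rmorphB; ring.
Qed.

End Eigen.
End Lowering.

(** * The sum of the derivatives as a sum of lowered eigenvectors *)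

Section Lowered.
Variables (F : fieldType) (m : nat).
Local Notation n := m.+1.
Variables (V : symring F n) (k : F).
Implicit Types (i j l : 'I_n) (s : 'S_n) (c z : F) (g : V) (L : seq 'I_n).

Local Notation x := (@var F n V).
Local Notation C := (@cst F n V).
Local Notation T := (@dunkl F n V k).
Local Notation U := (@cher F n V k).
Local Notation S := (@S F n V k).
Local Notation R := (@R F m V k).
Local Notation opprod := (@opprod F n V k).

Hypothesis charF0 : forall a : nat, (a.+1%:R : F) != 0.

Lemma natV_neq0 (a : nat) : (0 < a)%N -> (a%:R : V) != 0.
Proof. by case: a => // a _; rewrite -(rmorph_nat C) fmorph_eq0. Qed.

(** Writing the product as a polynomial in [z] with coefficients in the module, and leading
    coefficient [g], makes scalar interpolation applicable to it. *)
Lemma opprod_expand L g : exists w : nat -> V, w (size L) = g /\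
  forall z, opprod L z g = \sum_(t < (size L).+1) C (z ^+ t) * w t.
Proof.
elim: L => [|i L [w [wL wE]]].
  by exists (fun=> g); split => // z; rewrite big_ord1 expr0 rmorph1 mul1r.
exists (fun t => (if t is t'.+1 then w t' else 0)
                 - (if (t <= size L)%N then U i (w t) else 0)).
split=> [|z]; first by rewrite /= ltnn subr0.
rewrite /= wE raddf_sum (eq_bigr _ (fun t _ => mulrBr _ _ _)) big_split /=.
rewrite sumrN; congr (_ - _).
  rewrite [RHS]big_ord_recl /= mulr0 add0r mulr_sumr; apply: eq_bigr => t _.
  by rewrite exprS rmorphM mulrA.
rewrite [RHS]big_ord_recr /= ltnn mulr0 addr0; apply: eq_bigr => t _.
by rewrite cherC -ltnS ltn_ord.
Qed.

Section Eigen.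
Variables (b : 'I_n -> F) (f : V).
Hypothesis sf : forall s, act s f = f.
Hypothesis Sf : forall z, S z f = C (\prod_l (z - b l)) * f.

Local Notation v := (eigen_part k b f).

(** [R z f] is a polynomial in [z] of degree n - 1 with leading coefficient [f], which
    [sum_lagrange] recovers from the values at the b_j. *)
Lemma sum_eigen_part : injective b ->
  f = \sum_j C (\prod_(l | l != j) (b j - b l))^-1 * v j.
Proof.
move=> b_inj; have [w [wf wE]] := opprod_expand (map (lift ord0) (enum 'I_m)) f.
rewrite size_map size_enum_ord in wf wE.
transitivity (\sum_j \sum_(t < n) C (b j ^+ t / \prod_(l | l != j) (b j - b l)) * w t).
  rewrite exchange_big /= -[LHS]wf big_ord_recr /= big1 => [|t _].
    by rewrite -mulr_suml -rmorph_sum sum_lagrange // eqxx rmorph1 mul1r add0r.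
  by rewrite -mulr_suml -rmorph_sum sum_lagrange ?(ltnW (ltn_ord t)) //
    (ltn_eqF (ltn_ord t)) rmorph0 mul0r.
apply: eq_bigr => j _; rewrite /eigen_part /R wE mulr_sumr; apply: eq_bigr => t _.
by rewrite rmorphM mulrCA mulrA.
Qed.

(** On symmetric [f] the Dunkl operators are the partial derivatives, and all [T i f] have the same
    symmetrization, whence the factor [n]. *)
Lemma sum_pd_lowered : injective b ->
  n`!%:R * \sum_i pd i f =
  n%:R * \sum_j C (\prod_(l | l != j) (b j - b l))^-1 * lowered k b f j.
Proof.
move=> b_inj; have -> : \sum_i pd i f = \sum_i T i f.
  by apply: eq_bigr => i _; rewrite dunkl_sym.
rewrite -symmetrized_sym => [|s]; last first.
  rewrite raddf_sum [RHS](reindex_inj (@perm_inj _ s)) /=.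
  by apply: eq_bigr => i _; rewrite act_dunkl sf.
rewrite raddf_sum (eq_bigr (fun=> symmetrized (T ord0 f))) => [|i _]; last first.
  by rewrite -(symmetrized_act (tperm ord0 i)) act_dunkl tpermL sf.
rewrite sumr_const card_ord -[LHS]mulr_natl; congr (_ * _).
rewrite [in LHS]sum_eigen_part // !raddf_sum; apply: eq_bigr => j _ /=.
by rewrite dunklC symmetrizedC.
Qed.

(** [R] contains the factors of all nonzero indices, so adjacent transpositions away from [ord0]
    commute with it; the others are obtained by conjugation. *)
Lemma sw_eigen_part j i l : i != ord0 -> l != ord0 -> sw i l (v j) = v j.
Proof.
wlog il : i l / (i < l)%N => [H i0 l0|].
  case: (ltngtP i l) => [/H|/H|/val_inj->]; rewrite ?sw_id //; first exact.
  by rewrite sw_sym; apply.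
elim: {l}(l - i)%N {-2}l (leqnn (l - i)%N) il => [|d IH] l li il i0 l0.
  by move: li; rewrite leqn0 subn_eq0 leqNgt il.
have [E|E] := eqVneq (l : nat) i.+1.
  rewrite /eigen_part /R sw_opprod2 //; first by rewrite /sw sf.
  - by rewrite map_inj_uniq ?enum_uniq //; apply: lift_inj.
  - case: (unliftP ord0 i) i0 => [i' ->|->]; rewrite ?eqxx // => _.
    by rewrite map_f ?mem_enum.
  - case: (unliftP ord0 l) l0 => [i' ->|->]; rewrite ?eqxx // => _.
    by rewrite map_f ?mem_enum.
have h : (l.-1 < n)%N by have := ltn_ord l; lia.
have h1 : (i < l.-1)%N by move/eqP: E; move: il; lia.
pose p := Ordinal h.
have p0 : p != ord0 by rewrite -(inj_eq val_inj) /=; lia.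
have pi : p != i by rewrite -(inj_eq val_inj) /=; lia.
have pl : p != l by rewrite -(inj_eq val_inj) /=; lia.
have li' : l != i by rewrite -(inj_eq val_inj) /=; lia.
have E1 : sw p l (v j) = v j.
  rewrite /eigen_part /R sw_opprod2 //=; first by rewrite /sw sf.
  - by lia.
  - by rewrite map_inj_uniq ?enum_uniq //; apply: lift_inj.
  - case: (unliftP ord0 p) p0 => [i' ->|->]; rewrite ?eqxx // => _.
    by rewrite map_f ?mem_enum.
  - case: (unliftP ord0 l) l0 => [i' ->|->]; rewrite ?eqxx // => _.
    by rewrite map_f ?mem_enum.
have E2 : sw i p (v j) = v j by apply: IH => //=; lia.
have := congr1 (sw p l) E2; rewrite E1 -[LHS]/(act _ _) act_sw -/(sw p l _) E1.
by rewrite tpermL tpermD.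
Qed.

(* If the symmetrization of [T ord0 v] vanishes, then so does the sum of its
   images under the transpositions moving [ord0]; this makes [T ord0 v] an
   eigenvector of [cher ord0] for an eigenvalue that [S_theta_eigen] excludes. *)
Lemma lowered_neq0 j : f != 0 -> k != 0 -> k != 1 -> b j != 0 ->
  (forall l, l != j -> b j - b l - k != 0) ->
  (forall l, l != j -> b j - 1 + k - b l != 0) -> lowered k b f j != 0.
Proof.
move=> f0 k0 k1 bj0 h1 h2; apply/eqP => low0.
set g := T ord0 (v j).
have sg i l : i != ord0 -> l != ord0 -> sw i l g = g.
  by move=> i0 l0; rewrite sw_dunkl tpermD // sw_eigen_part.
pose Y := \sum_l sw ord0 l g.
have sY s : act s Y = Y.
  elim/perm_ind_adj: s => [|s t Es Et|i l il]; rewrite ?act1 ?actM ?Es ?Et //.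
  have l0 : l != ord0 by rewrite -(inj_eq val_inj) /= il.
  rewrite raddf_sum; have [E|i0] := eqVneq i ord0; last first.
    rewrite [RHS](reindex_inj (@perm_inj _ (tperm i l))) /=.
    apply: eq_bigr => a _; rewrite act_sw -/(sw i l g) (sg i l) //.
    by rewrite (@tpermD _ i l ord0).
  rewrite {i il}E (bigD1 ord0) //= [RHS](bigD1 ord0) //= !sw_id.
  rewrite (bigD1 l) //= [in RHS](bigD1 l) //= -!/(sw ord0 l _) swK addrCA.
  congr (_ + (_ + _)); apply: eq_bigr => a /andP[a0 al].
  rewrite -/(sw ord0 l _) -{1}(sg l a) //.
  have -> : sw ord0 a (sw l a g) = sw ord0 l (sw ord0 a g).
    rewrite -[LHS]/(act _ _) act_sw tpermR tpermD // 1?eq_sym //.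
    by rewrite sw_sym.
  by rewrite swK.
have Y0 : Y = 0.
  have : n`!%:R * Y = 0.
    rewrite -symmetrized_sym // /Y raddf_sum (eq_bigr (fun=> 0)) ?sumr0 //.
      by rewrite big1_eq.
    by move=> l _; apply: etrans (symmetrized_act _ _) low0.
  by move/eqP; rewrite mulf_eq0 (negbTE (natV_neq0 (fact_gt0 n))) => /eqP.
have g_eig : U ord0 g = C (b j - 1 + k) * g.
  have : T ord0 (U ord0 (v j)) = C (b j) * g by rewrite cher0_eigen // dunklC.
  rewrite cher0 dunklX -/g.
  have -> : \sum_(l < n | l != ord0) sw ord0 l g = - g.
    by move: Y0; rewrite /Y (bigD1 ord0) //= sw_id addrC => /eqP; rewrite addr_eq0 => /eqP.
  rewrite -cher0 rmorphD rmorphB rmorph1 => E.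
  by rewrite !mulrDl -E; ring.
have Sg z : C (z - b j) * S z g = C ((z - b j + 1) * \prod_l (z - b l)) * g.
  pose cyc : 'S_n := lift_perm ord_max ord0 1%g.
  have -> : g = act cyc (theta k (v j)) by rewrite /theta -actM mulVg act1.
  rewrite -act_S; have := congr1 (act cyc) (S_theta_eigen Sf j z).
  by rewrite !rmorphM /= !act_cst.
(* At z = b_j - 1 + k the operator [S z] kills [g], while the scalar in [Sg] is a product of k, k -
   1 and the factors of [h2], all nonzero. *)
have g0 : g = 0.
  have := Sg (b j - 1 + k).
  have -> : S (b j - 1 + k) g = 0.
    by rewrite S_R /R -opprod_cher g_eig opprod_cst subrr.
  rewrite mulr0 => /esym/eqP; rewrite mulf_eq0 fmorph_eq0 => /orP[|/eqP//].
  rewrite mulf_eq0 => /orP[|/prodf_eq0[l _]].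
    by rewrite (_ : _ + 1 = k) ?(negbTE k0) //; ring.
  have [->|lj] := eqVneq l j; last by rewrite (negbTE (h2 _ lj)).
  by rewrite (_ : _ - b j = k - 1) ?subr_eq0 ?(negbTE k1) //; ring.
have v0 : v j = 0.
  have := cher0_eigen Sf j; rewrite cher0 -/g g0 mulr0 => /esym/eqP.
  by rewrite mulf_eq0 fmorph_eq0 (negbTE bj0) => /eqP.
(* The symmetrization of [v j] is a nonzero multiple of [f] by [h1], so [v j] cannot vanish. *)
have := symmetrized_eigen sf Sf j k0; rewrite v0 raddf0 mulr0 => /esym/eqP.
rewrite mulf_eq0 (negbTE (natV_neq0 (fact_gt0 n))) /= mulf_eq0 (negbTE f0) orbF.
by rewrite fmorph_eq0 => /prodf_eq0[l /h1 /negbTE->].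
Qed.

End Eigen.
End Lowered.

(** * Multivariate polynomials as an instance of the abstract ring *)

Section MpolySymring.
Variables (F : fieldType) (n : nat).

Let mp_ind (P : {mpoly F[n]} -> Prop) :
    P 1 -> (forall i f, P f -> P ('X_i * f)) ->
    (forall f g, P f -> P g -> P (f + g)) ->
    (forall c f, P f -> P (c%:MP * f)) ->
  forall f, P f.
Proof.
move=> P1 PX PD PZ; elim/mpolyind => [|c m p _ _ Pp].
  by rewrite -(mul0r 1) -mpolyC0; apply: PZ.
apply: PD => //; rewrite -mul_mpolyC; apply: PZ; rewrite mpolyXE_id.
elim: (index_enum _) => [|i r Pr]; first by rewrite big_nil.
rewrite big_cons; elim: (m i) => [|a]; first by rewrite mul1r.
by rewrite exprS -mulrA; apply: PX.
Qed.

Let mp_var_inj : injective (fun i : 'I_n => 'X_i : {mpoly F[n]}).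
Proof.
move=> i j /(congr1 (mcoeff U_(i))); rewrite !mcoeffX !eq_mnm1 eqxx.
by case: eqVneq => // _ /eqP; rewrite oner_eq0.
Qed.

Let mp_act_var (s : 'S_n) i : msym s 'X_i = 'X_(s i) :> {mpoly F[n]}.
Proof.
rewrite msymX; congr 'X_[_]; apply/mnmP => j; rewrite mnmE !mnm1E.
by rewrite -(inj_eq (@perm_inj _ s)) permKV.
Qed.

Let mp_act_cst (s : 'S_n) (c : F) : msym s c%:MP = c%:MP.
Proof. by rewrite -[c%:MP]mulr1 mul_mpolyC msymZ msym1. Qed.

Let mp_pd_var (i j : 'I_n) : ('X_j : {mpoly F[n]})^`M(i) = (i == j)%:R.
Proof.
rewrite mderivX mnm1E eq_sym; case: eqP => [->|_]; last by rewrite scale0r.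
by rewrite -[X in (X - _)%MM]add0m addmK mpolyX0 scale1r.
Qed.

Definition mpoly_symring : symring F n := @Symring F n {mpoly F[n]}
  (@mpolyC n F) (fun i => 'X_i) (@msym n F) (@mderiv n F) mp_ind mp_var_inj
  (@msym1m n F) (fun u v f => msymMm f u v) mp_act_var mp_act_cst
  (@mderivM n F) mp_pd_var (@mderivC n F).

End MpolySymring.

(** * A dominance order on exponent vectors *)

Section Monomials.
Variable n : nat.
Implicit Types (eta theta : 'X_{1..n}) (i j : 'I_n).

Definition mperm (s : 'S_n) eta : 'X_{1..n} := [multinom eta (s i) | i < n].

Definition antidom eta := forall i j, (i <= j)%N -> (eta i <= eta j)%N.

(* A numerical form of strict dominance that ignores the order of the parts. *)
Definition slow eta theta : Prop :=
  [/\ mdeg eta = mdeg theta,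
      forall c : nat, (\sum_i (eta i - c) <= \sum_i (theta i - c))%N
    & (\sum_i eta i ^ 2 < \sum_i theta i ^ 2)%N].

Definition low eta theta : Prop := (exists s, eta = mperm s theta) \/ slow eta theta.

Lemma mdegS eta : mdeg eta = (\sum_i eta i)%N.
Proof. by rewrite mdegE. Qed.

Lemma sum_mperm s eta (G : nat -> nat) :
  (\sum_i G (mperm s eta i) = \sum_i G (eta i))%N.
Proof.
rewrite [RHS](reindex_inj (@perm_inj _ s)); apply: eq_bigr => i _.
by rewrite mnmE.
Qed.

Lemma slow_mperm s t eta theta :
  slow (mperm s eta) (mperm t theta) <-> slow eta theta.
Proof.
rewrite /slow !mdegS (sum_mperm s eta id) (sum_mperm t theta id).
rewrite (sum_mperm s eta (fun a => a ^ 2)%N) (sum_mperm t theta (fun a => a ^ 2)%N).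
split=> -[h1 h2 h3]; split => // c; move: (h2 c);
by rewrite (sum_mperm s eta (fun a => a - c)%N) (sum_mperm t theta (fun a => a - c)%N).
Qed.

Lemma mperm1 eta : mperm 1 eta = eta.
Proof. by apply/mnmP => i; rewrite mnmE perm1. Qed.

Lemma mpermM s t eta : mperm s (mperm t eta) = mperm (s * t)%g eta.
Proof. by apply/mnmP => i; rewrite !mnmE permM. Qed.

Lemma slow_trans eta theta zeta : slow eta theta -> slow theta zeta -> slow eta zeta.
Proof.
move=> [a1 a2 a3] [b1 b2 b3]; split; first by rewrite a1.
  by move=> c; apply: leq_trans (a2 c) (b2 c).
exact: ltn_trans a3 b3.
Qed.

Lemma slow_low eta theta zeta : slow eta theta -> low theta zeta -> slow eta zeta.
Proof.
move=> h [[s E]|]; last exact: slow_trans.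
by move: h; rewrite E -{1}(mperm1 eta) slow_mperm.
Qed.

Lemma low_slow eta theta zeta : low eta theta -> slow theta zeta -> slow eta zeta.
Proof.
case=> [[s ->]|]; last exact: slow_trans.
by rewrite -{2}(mperm1 zeta) slow_mperm.
Qed.

Lemma low_trans eta theta zeta : low eta theta -> low theta zeta -> low eta zeta.
Proof.
case=> [[s ->]|h] h2; last by right; apply: slow_low h h2.
case: h2 => [[t ->]|h2]; first by left; exists (s * t)%g; rewrite mpermM.
by right; rewrite -(mperm1 zeta) slow_mperm.
Qed.

Lemma low_refl eta : low eta eta.
Proof. by left; exists 1%g; rewrite mperm1. Qed.

Lemma low_sq eta theta : low eta theta -> (\sum_i eta i ^ 2 <= \sum_i theta i ^ 2)%N.
Proof.
by case=> [[s ->]|[_ _ /ltnW //]]; rewrite (sum_mperm s theta (fun a => a ^ 2)%N).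
Qed.

Lemma low_mdeg eta theta : low eta theta -> mdeg eta = mdeg theta.
Proof.
by case=> [[s ->]|[]//]; rewrite !mdegS (sum_mperm s theta id).
Qed.

(** Moving units from coordinate [i] to [j] without reaching a swap decreases every convex symmetric
    sum; the sum of squares decreases strictly. *)
Lemma slow_move i j eta theta : i != j ->
  (forall l, l != i -> l != j -> eta l = theta l) ->
  (eta i + eta j = theta i + theta j)%N -> (theta j < eta i < theta i)%N ->
  slow eta theta.
Proof.
move=> ij E Es /andP[h1 h2]; have ji : j != i by rewrite eq_sym.
have split2 (G : nat -> nat) (z : 'X_{1..n}) : (\sum_l G (z l) =
    G (z i) + G (z j) + \sum_(l | (l != i) && (l != j)) G (z l))%N.
  by rewrite (bigD1 i) //= (bigD1 j) //= addnA.
have rest (G : nat -> nat) : (\sum_(l | (l != i) && (l != j)) G (eta l) =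
    \sum_(l | (l != i) && (l != j)) G (theta l))%N.
  by apply: eq_bigr => l /andP[li lj]; rewrite E.
split.
- by rewrite !mdegS !(split2 id) (rest id) Es.
- move=> c; rewrite !(split2 (fun a => a - c)%N) (rest (fun a => a - c)%N).
  rewrite leq_add2r; lia.
- rewrite !(split2 (fun a => a ^ 2)%N) (rest (fun a => a ^ 2)%N) ltn_add2r.
  have [d E1] : exists d, theta i = (eta i + d.+1)%N.
    by exists (theta i - eta i).-1; lia.
  have -> : eta j = (theta j + d.+1)%N by lia.
  by rewrite E1 -!mulnn; nia.
Qed.

End Monomials.

Section SuppIn.
Variables (F : fieldType) (n : nat).
Implicit Types (f g : {mpoly F[n]}) (eta theta : 'X_{1..n}) (P : 'X_{1..n} -> Prop).

Definition supp_in P g := forall eta, g@_eta != 0 -> P eta.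

Lemma supp_in0 P : supp_in P 0.
Proof. by move=> eta; rewrite mcoeff0 eqxx. Qed.

Lemma supp_inX P theta : P theta -> supp_in P 'X_[theta].
Proof.
by move=> Pt eta; rewrite mcoeffX; case: (eqVneq theta eta) => [<- _ //|_]; rewrite eqxx.
Qed.

Lemma supp_inD P f g : supp_in P f -> supp_in P g -> supp_in P (f + g).
Proof.
move=> Pf Pg eta; rewrite mcoeffD.
have [->|f0 _] := eqVneq f@_eta 0; last exact: Pf.
by rewrite add0r; apply: Pg.
Qed.

Lemma supp_inN P f : supp_in P f -> supp_in P (- f).
Proof. by move=> Pf eta; rewrite mcoeffN oppr_eq0; apply: Pf. Qed.

Lemma supp_inC P c f : supp_in P f -> supp_in P (c%:MP * f).
Proof.
by move=> Pf eta; rewrite mcoeffCM mulf_eq0 negb_or => /andP[_]; apply: Pf.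
Qed.

Lemma supp_in_sum P (I : Type) (r : seq I) (A : pred I) (G : I -> {mpoly F[n]}) :
  (forall a, A a -> supp_in P (G a)) -> supp_in P (\sum_(a <- r | A a) G a).
Proof.
move=> h; elim/big_rec: _ => [|a f Aa Pf]; first exact: supp_in0.
by apply: supp_inD => //; apply: h.
Qed.

Lemma supp_in_sub P Q f : (forall eta, P eta -> Q eta) -> supp_in P f -> supp_in Q f.
Proof. by move=> PQ Pf eta /Pf /PQ. Qed.

End SuppIn.

(** * Triangularity of the Cherednik operators on monomials *)

Section Triangular.
Variables (F : fieldType) (n : nat) (k : F).
Local Notation V := (mpoly_symring F n).
Implicit Types (f g : {mpoly F[n]}) (eta theta : 'X_{1..n}) (i j : 'I_n).
Local Notation U := (@cher F n V k).
Local Notation dd i j f := (@ddiff F n V i j f : {mpoly F[n]}).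

Lemma sw_mono i j theta : @sw F n V i j 'X_[theta] = 'X_[mperm (tperm i j) theta].
Proof. by rewrite /sw /= msymX tpermV. Qed.

Lemma ddiff_sw i j f : dd i j (@sw F n V i j f) = - dd i j f.
Proof.
have [<-|ij] := eqVneq i j; first by rewrite !ddiff_ii oppr0.
apply: (@ddiff_uniq F n V) => //; rewrite swK.
transitivity (- (('X_i - 'X_j) * dd i j f)); last by rewrite mulrN.
by rewrite -[('X_i - 'X_j) * _](@ddiffE F n V i j f) opprB.
Qed.

(** The divided difference is a sum over the monomials between the two exponents. After
    multiplication by x_i its first term is x^theta, and the others have exponents at [i] and [j]
    strictly between those of [theta]. *)
Lemma ddiff_mono_gt i j theta : (theta j < theta i)%N ->
  exists2 r : {mpoly F[n]}, supp_in (fun eta => slow eta theta) r &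
    'X_i * dd i j 'X_[theta] = 'X_[theta] + r.
Proof.
move=> ji; have ij : i != j by apply/eqP => E; rewrite E ltnn in ji.
pose d := (theta i - theta j)%N.
(* [theta] with its exponent at [i] lowered to the one at [j]: a monomial invariant under the
   transposition. *)
pose base := [multinom (if l == i then theta j else theta l) | l < n].
have Et : theta = (base + U_(i) *+ d)%MM.
  apply/mnmP => l; rewrite mnmDE mulmnE mnm1E mnmE.
  case: (eqVneq l i) => [->|_]; last by rewrite mul0n addn0.
  by rewrite mul1n /d subnKC // ltnW.
have sb : @sw F n V i j 'X_[base] = 'X_[base].
  rewrite sw_mono; congr 'X_[_]; apply/mnmP => l; rewrite !mnmE.
  case: tpermP => [->|->|/eqP li /eqP lj].
  - by rewrite eqxx eq_sym (negbTE ij).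
  - by rewrite eqxx eq_sym (negbTE ij).
  - by rewrite (negbTE li).
have tE (a b : nat) : 'X_i ^+ a * ('X_j ^+ b * 'X_[base]) =
    'X_[base + U_(i) *+ a + U_(j) *+ b] :> {mpoly F[n]}.
  by rewrite !mpolyXD !mpolyXn; ring.
have ddE : dd i j 'X_[theta] =
    'X_[base] * \sum_(t < d) 'X_i ^+ (d.-1 - t) * 'X_j ^+ t.
  apply: (@ddiff_uniq F n V) => //.
  rewrite Et mpolyXD -mpolyXn.
  have -> : @sw F n V i j ('X_[base] * 'X_i ^+ d) = 'X_[base] * 'X_j ^+ d.
    by rewrite swM sb /sw rmorphXn /= (@act_var F n V) tpermL.
  by rewrite -mulrBr subrXX mulrCA.
have d0 : (0 < d)%N by rewrite subn_gt0.
exists (\sum_(t < d.-1) 'X_[base + U_(i) *+ (d.-1 - t) + U_(j) *+ t.+1]).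
  apply: supp_in_sum => t _; apply: supp_inX.
  have ht := ltn_ord t.
  have bj : base j = theta j by rewrite mnmE eq_sym (negbTE ij).
  apply: (@slow_move _ i j) => // [l li lj||].
  - by rewrite !mnmDE !mulmnE !mnm1E mnmE !(eq_sym _ l) (negbTE li) (negbTE lj) !addn0.
  - rewrite !mnmDE !mulmnE !mnm1E !eqxx bj mnmE eqxx (negbTE ij) eq_sym (negbTE ij).
    by rewrite /d in ht *; lia.
  - rewrite !mnmDE !mulmnE !mnm1E !eqxx mnmE eqxx eq_sym (negbTE ij).
    by rewrite /d in ht *; lia.
rewrite ddE mulrCA mulr_sumr -(prednK d0) big_ord_recl /= subn0 expr0 mulr1.
rewrite mulrDr; congr (_ + _); first by rewrite -exprS prednK // Et mpolyXD -mpolyXn.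
rewrite mulr_sumr; apply: eq_bigr => t _; rewrite -tE /bump /= add1n.
have -> : (d.-1 - t)%N = (d.-1 - t.+1).+1 by have := ltn_ord t; lia.
by rewrite !exprS; ring.
Qed.

Lemma ddiff_mono i j theta : i != j ->
  exists2 r : {mpoly F[n]}, supp_in (fun eta => slow eta theta) r &
    'X_i * dd i j 'X_[theta] = (theta j < theta i)%N%:R * 'X_[theta]
      - (theta i < theta j)%N%:R * 'X_[mperm (tperm i j) theta] + r.
Proof.
move=> ij; case: (ltngtP (theta i) (theta j)) => h.
- pose th := mperm (tperm i j) theta.
  have [r rS rE] : exists2 r : {mpoly F[n]}, supp_in (fun eta => slow eta th) r &
      'X_i * dd i j 'X_[th] = 'X_[th] + r.
    by apply: ddiff_mono_gt; rewrite !mnmE tpermL tpermR.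
  exists (- r).
    apply: supp_inN; apply: supp_in_sub rS => eta.
    by rewrite -{1}(mperm1 eta) slow_mperm.
  have -> : 'X_[theta] = @sw F n V i j 'X_[th].
    by rewrite sw_mono mpermM tperm2 mperm1.
  by rewrite ddiff_sw mulrN rE mul0r mul1r sub0r opprD.
- have [r rS rE] := ddiff_mono_gt h; exists r => //.
  by rewrite rE mul1r mul0r subr0.
- exists 0; first exact: supp_in0.
  rewrite !mul0r subrr addr0; apply/eqP; rewrite mulf_eq0; apply/orP; right.
  apply/eqP; apply: (@ddiff_uniq F n V) => //; rewrite mulr0 sw_mono.
  suff -> : mperm (tperm i j) theta = theta by rewrite subrr.
  by apply/mnmP => l; rewrite mnmE; case: tpermP => // ->.
Qed.
End Triangular.

Section Top.
Variables (F : fieldType) (n : nat) (k : F).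
Local Notation V := (mpoly_symring F n).
Implicit Types (f g : {mpoly F[n]}) (eta theta : 'X_{1..n}) (i j : 'I_n).
Implicit Types (P : 'X_{1..n} -> Prop).
Local Notation U i f := (@cher F n V k i f : {mpoly F[n]}).
Local Notation dd i j f := (@ddiff F n V i j f : {mpoly F[n]}).

Lemma cher_mpolyE i f : U i f = 'X_i * f^`M(i) + k%:MP * (\sum_j 'X_i * dd i j f)
  + k%:MP * \sum_(j < n | (j < i)%N) (@sw F n V i j f : {mpoly F[n]}).
Proof.
rewrite cherE dunklE -mulr_sumr; congr (_ + _).
by rewrite mulrCA -mulrDr.
Qed.

Lemma mpolyX_deriv i theta : 'X_i * ('X_[theta])^`M(i) = (theta i)%:R%:MP * 'X_[theta]
  :> {mpoly F[n]}.
Proof.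
rewrite mderivX -mul_mpolyC mulrCA -mpolyXD.
have [->|h] := eqVneq (theta i) 0%N; first by rewrite mpolyC0 !mul0r.
congr (_ * 'X_[_]); rewrite addmC submK //.
by apply/mnm_lepP => j; rewrite mnm1E; case: eqP => // <-; rewrite lt0n.
Qed.

Lemma cher_mono_low i theta : supp_in (fun eta => low eta theta) (U i 'X_[theta]).
Proof.
have slow_ok (r : {mpoly F[n]}) : supp_in (fun eta => slow eta theta) r ->
    supp_in (fun eta => low eta theta) r.
  by apply: supp_in_sub => eta; right.
have Lt : supp_in (fun eta => low eta theta) ('X_[theta] : {mpoly F[n]}).
  by apply: supp_inX; exact: low_refl.
have Ls j : supp_in (fun eta => low eta theta)
    ('X_[mperm (tperm i j) theta] : {mpoly F[n]}).
  by apply: supp_inX; left; exists (tperm i j).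
rewrite cher_mpolyE mpolyX_deriv; apply: supp_inD; first apply: supp_inD.
- exact: supp_inC.
- apply: supp_inC; apply: supp_in_sum => j _.
  have [<-|ij] := eqVneq i j.
    by rewrite (@ddiff_ii F n V) mulr0; apply: supp_in0.
  have [r rS ->] := ddiff_mono F theta ij.
  rewrite -!mpolyC_nat; apply: supp_inD (slow_ok _ rS); apply: supp_inD.
    exact: supp_inC.
  by apply: supp_inN; apply: supp_inC.
- by apply: supp_inC; apply: supp_in_sum => j _; rewrite sw_mono.
Qed.

(** For [theta] different from [eta], a divided difference meeting [eta] is cancelled by the
    reflection with the same [j < i]. For [theta = eta], each [j < i] contributes k once: through
    the reflection if the two exponents are equal, through the divided difference otherwise. *)
Lemma cher_mono_coef i eta theta : antidom eta -> ~ slow eta theta ->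
  (U i 'X_[theta])@_eta = ((eta i)%:R + k * i%:R) * (theta == eta)%:R.
Proof.
move=> ad nsl; rewrite cher_mpolyE mpolyX_deriv !mcoeffD !mcoeffCM !(raddf_sum (mcoeff eta)) /=.
rewrite mcoeffX mulrDl -addrA; congr (_ + _).
  by case: (eqVneq theta eta) => [->|]; rewrite // !mulr0.
rewrite -mulrDr -mulrA; congr (_ * _).
have -> : \sum_(j < n | (j < i)%N) (@sw F n V i j 'X_[theta])@_eta
   = \sum_(j < n) if (j < i)%N then (mperm (tperm i j) theta == eta)%:R else 0.
  by rewrite -big_mkcond; apply: eq_bigr => j _; rewrite sw_mono mcoeffX.
rewrite -big_split /=.
have -> : i%:R * (theta == eta)%:R = \sum_(j < n) if (j < i)%N then (theta == eta)%:R else 0 :> F.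
  rewrite -big_mkcond sumr_const -[RHS]mulr_natl; congr (_%:R * _).
  rewrite -sum1_card (eq_bigl (fun j : 'I_n => (j < i)%N)) //.
  by rewrite (big_ord_narrow (ltnW (ltn_ord i))) sum1_card card_ord.
apply: eq_bigr => j _; have [<-|ij] := eqVneq i j.
  by rewrite (@ddiff_ii F n V) mulr0 mcoeff0 ltnn addr0.
have [r rS ->] := ddiff_mono F theta ij.
have r0 : r@_eta = 0 by apply/eqP/negPn/negP => /rS.
rewrite mcoeffD mcoeffB r0 addr0 -!mpolyC_nat !mcoeffCM !mcoeffX.
have nt (a b : 'I_n) : (a < b)%N -> (theta b < theta a)%N -> (theta == eta) = false.
  by move=> ab; rewrite ltnNge => /negP h; apply/eqP => E; apply: h; rewrite E ad // ltnW.
have ns (a b : 'I_n) : (a < b)%N -> (theta a < theta b)%N ->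
    (mperm (tperm a b) theta == eta) = false.
  move=> ab; rewrite ltnNge => /negP h; apply/eqP => E; apply: h.
  have := ad a b (ltnW ab); rewrite -E !mnmE tpermL tpermR; exact.
have [h1|h1|h1] := ltngtP (theta i) (theta j); rewrite ?mul0r ?mul1r ?subr0 ?sub0r.
- case: (ltngtP j i) => [ji|ji|E2].
  + by rewrite (nt _ _ ji h1) addNr.
  + by rewrite (ns _ _ ji h1) oppr0 addr0.
  + by rewrite (val_inj E2) eqxx in ij.
- case: (ltngtP j i) => [ji|ji|E2].
  + by rewrite tpermC (ns _ _ ji h1) addr0.
  + by rewrite (nt _ _ ji h1) addr0.
  + by rewrite (val_inj E2) eqxx in ij.
- have -> : mperm (tperm i j) theta = theta.
    by apply/mnmP => l; rewrite mnmE; case: tpermP => // ->.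
  by rewrite add0r.
Qed.

Lemma cher_mpoly_sum i g : U i g = \sum_(m <- msupp g) (g@_m)%:MP * U i 'X_[m].
Proof.
rewrite {1}(mpolyE g) (raddf_sum (@cher F n V k i)); apply: eq_bigr => m _.
by rewrite -mul_mpolyC; apply: (@cherC F n V).
Qed.

Lemma cher_supp_in P i g : (forall eta theta, low eta theta -> P theta -> P eta) ->
  supp_in P g -> supp_in P (U i g).
Proof.
move=> Pl Pg; rewrite cher_mpoly_sum big_seq; apply: supp_in_sum => m.
rewrite mcoeff_msupp => /Pg Pm; apply: supp_inC.
by apply: supp_in_sub (@cher_mono_low i m) => eta /Pl; apply.
Qed.

Lemma cher_coef i eta g : antidom eta -> supp_in (fun theta => ~ slow eta theta) g ->
  (U i g)@_eta = ((eta i)%:R + k * i%:R) * g@_eta.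
Proof.
move=> ad sg; have -> : g@_eta = \sum_(m <- msupp g) g@_m * (m == eta)%:R.
  rewrite {1}(mpolyE g) (raddf_sum (mcoeff eta)); apply: eq_bigr => m _ /=.
  by rewrite mcoeffZ mcoeffX.
rewrite cher_mpoly_sum (raddf_sum (mcoeff eta)) mulr_sumr !big_seq.
apply: eq_bigr => m; rewrite mcoeff_msupp => /sg nsl.
by rewrite /= mcoeffCM cher_mono_coef // mulrCA.
Qed.

Lemma not_slow_low eta : forall theta zeta, low theta zeta ->
  ~ slow eta zeta -> ~ slow eta theta.
Proof. by move=> theta zeta l h1 h2; apply: h1; apply: slow_low h2 l. Qed.

Lemma opprod_coef L z eta g : antidom eta ->
  supp_in (fun theta => ~ slow eta theta) g ->
  (opprod (V := V) k L z g : {mpoly F[n]})@_eta =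
  \prod_(i <- L) (z - ((eta i)%:R + k * i%:R)) * g@_eta.
Proof.
move=> ad sg.
suff [] : supp_in (fun theta => ~ slow eta theta) (opprod (V := V) k L z g : {mpoly F[n]}) /\
  (opprod (V := V) k L z g : {mpoly F[n]})@_eta =
  \prod_(i <- L) (z - ((eta i)%:R + k * i%:R)) * g@_eta by [].
elim: L => [|i L [IH1 IH2]] /=; first by rewrite big_nil mul1r.
split.
  apply: (@supp_inD F n); first exact: supp_inC.
  by apply: supp_inN; apply: cher_supp_in IH1; apply: not_slow_low.
by rewrite mcoeffB mcoeffCM cher_coef // IH2 big_cons; ring.
Qed.

Definition cher2 g : {mpoly F[n]} := \sum_i U i (U i g).

Lemma cher2_supp_in P g : (forall eta theta, low eta theta -> P theta -> P eta) ->
  supp_in P g -> supp_in P (cher2 g).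
Proof.
move=> Pl Pg; apply: supp_in_sum => i _.
by apply: cher_supp_in => //; apply: cher_supp_in.
Qed.

Definition ev2 eta : F := \sum_i ((eta i)%:R + k * i%:R) ^+ 2.

Lemma cher2_coef eta g : antidom eta -> supp_in (fun theta => ~ slow eta theta) g ->
  (cher2 g)@_eta = ev2 eta * g@_eta.
Proof.
move=> ad sg; rewrite (raddf_sum (mcoeff eta)) mulr_suml; apply: eq_bigr => i _.
rewrite /= (@cher_coef i eta (U i g)) // ?cher_coef // ?expr2 ?mulrA //.
by apply: cher_supp_in sg; apply: not_slow_low.
Qed.
End Top.

(** * Sorted exponents, leading partitions and triangular systems *)

Section Sorting.
Variable n : nat.
Implicit Types (eta theta lam mu : 'X_{1..n}) (i j : 'I_n).

(** Passes between partitions and the weakly increasing exponents on which the diagonal entries are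
    known. *)
Definition revm eta : 'X_{1..n} := mperm (perm (@rev_ord_inj n)) eta.

Lemma revmE eta i : revm eta i = eta (rev_ord i).
Proof. by rewrite mnmE permE. Qed.

Lemma revmK : involutive revm.
Proof. by move=> eta; apply/mnmP => i; rewrite !revmE rev_ordK. Qed.

Lemma is_partP lam : reflect (forall i j, (i <= j)%N -> (lam j <= lam i)%N) (is_part lam).
Proof.
apply: (iffP forallP) => [h i j ij|h i].
  by have /forallP/(_ j)/implyP := h i; apply.
by apply/forallP => j; apply/implyP; apply: h.
Qed.

Lemma antidom_revm lam : is_part lam -> antidom (revm lam).
Proof.
move=> /is_partP h i j ij; rewrite !revmE; apply: h => /=.
by have := ltn_ord j; lia.
Qed.

Lemma is_part_revm eta : antidom eta -> is_part (revm eta).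
Proof.
move=> h; apply/is_partP => i j ij; rewrite !revmE; apply: h => /=.
by have := ltn_ord j; lia.
Qed.

Lemma mpermP eta theta : reflect (exists s, eta = mperm s theta) (perm_eq eta theta).
Proof.
apply: (iffP (@tuple_permP _ _ _ _)) => -[s E]; exists s.
  have ET : multinom_val eta = [tuple tnth theta (s i) | i < n] by apply: val_inj.
  by apply/mnmP => i; rewrite mnmE mnm_tnth ET tnth_mktuple mnm_tnth.
have ET : multinom_val eta = [tuple tnth theta (s i) | i < n].
  by apply: eq_from_tnth => i; rewrite tnth_mktuple -mnm_tnth E mnmE mnm_tnth.
by rewrite ET.
Qed.

Definition asort eta : 'X_{1..n} := Multinom (sort_tuple leq eta).

Lemma asort_perm eta : exists s, asort eta = mperm s eta.
Proof. by apply/mpermP; rewrite /= perm_sort. Qed.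

Lemma asort_antidom eta : antidom (asort eta).
Proof.
move=> i j ij; rewrite !mnm_tnth !(tnth_nth 0%N) /=.
by apply: (sorted_leq_nth leq_trans leqnn) => //;
  rewrite ?inE ?size_sort ?size_tuple // sort_sorted // => a b; apply: leq_total.
Qed.

Lemma asort_mperm s eta : asort (mperm s eta) = asort eta.
Proof.
apply: val_inj; apply: val_inj => /=; apply/perm_sortP.
- exact: leq_total.
- exact: leq_trans.
- exact: anti_leq.
by apply: (introT (mpermP (mperm s eta) eta)); exists s.
Qed.

Lemma asort_id eta : antidom eta -> asort eta = eta.
Proof.
move=> ad; apply: val_inj; apply: val_inj => /=; apply: sorted_sort.
  exact: leq_trans.
apply/(sortedP 0%N) => i; rewrite size_tuple => h.
have := ad (Ordinal (ltnW h)) (Ordinal h) (leqnSn i).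
by rewrite !mnm_tnth !(tnth_nth 0%N).
Qed.
End Sorting.

Section Leading.
Variables (F : fieldType) (n : nat) (k : F).
Local Notation V := (mpoly_symring F n).
Implicit Types (f g h : {mpoly F[n]}) (eta theta lam mu : 'X_{1..n}) (i j : 'I_n).
Local Notation sq eta := (\sum_i (eta : 'X_{1..n}) i ^ 2)%N.

Lemma sym_coeff s g eta : g \is symmetric -> g@_(mperm s eta) = g@_eta.
Proof. exact: msym_coeff. Qed.

Lemma sym_cher2 g : g \is symmetric -> cher2 k g \is symmetric.
Proof.
move/issymP=> sg; apply/issymP => s.
have := @act_sum_cher2 F n V k s g; rewrite /= /cher2 => ->.
by have -> : @act F n V s g = g by apply: sg.
Qed.

Lemma slow_irr eta : ~ slow eta eta.
Proof. by case=> _ _; rewrite ltnn. Qed.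

Lemma sq_not_slow eta g : supp_in (fun theta => sq theta <= sq eta)%N g ->
  supp_in (fun theta => ~ slow eta theta) g.
Proof. by apply: supp_in_sub => theta h [_ _]; rewrite ltnNge h. Qed.

Lemma sq_mperm s eta : sq (mperm s eta) = sq eta.
Proof. exact: (sum_mperm s eta (fun a => a ^ 2)%N). Qed.

Lemma leading_exists g : g \is symmetric -> g != 0 -> exists mu,
  [/\ is_part mu, g@_mu != 0 & supp_in (fun theta => ~ slow (revm mu) theta) g].
Proof.
move=> sg g0; pose P q := has (fun m => sq m == q) (msupp g).
have exP : exists q, P q.
  move: g0; rewrite -msupp_eq0; case E : (msupp g) => [//|m r] _.
  by exists (sq m); rewrite /P E /= eqxx.
have ubP q : P q -> (q <= \sum_(m <- msupp g) sq m)%N.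
  by case/hasP => m mg /eqP <-; rewrite (big_rem m) //= leq_addr.
case: (ex_maxnP exP ubP) => q /hasP[m mg /eqP Em] qmax.
have [s E] := asort_perm m; have ad := asort_antidom m.
exists (revm (asort m)); rewrite revmK; split; first exact: is_part_revm.
  by rewrite /revm sym_coeff // E sym_coeff // -mcoeff_msupp.
apply: sq_not_slow => theta; rewrite -mcoeff_msupp => h.
by rewrite E sq_mperm Em; apply: qmax; apply/hasP; exists theta.
Qed.

Lemma revm_coeff g mu : g \is symmetric -> g@_(revm mu) = g@_mu.
Proof. exact: sym_coeff. Qed.

(** Back substitution, by induction on a bound [B] for the sums of squares: dividing the
    coefficients of [g] by the diagonal entries leaves a remainder with strictly smaller sums of
    squares. *)
Lemma cher2_solve lam e g : g \is symmetric -> supp_in (fun eta => slow eta lam) g ->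
  (forall eta, antidom eta -> slow eta lam -> ev2 k eta != e) ->
  exists h, [/\ h \is symmetric, supp_in (fun eta => slow eta lam) h &
    cher2 k h - e%:MP * h = g].
Proof.
move=> sg Sg He.
have [B BE] : exists B, supp_in (fun eta => sq eta < B)%N g.
  exists (sq lam); apply: supp_in_sub Sg => eta; by case.
elim: B => [|B IH] in g sg Sg BE *.
  exists 0; split; rewrite ?rpred0 //; first exact: supp_in0.
  rewrite mulr0 subr0 /cher2 big1 => [|i _]; last first.
    have U0 : @cher F n V k i 0 = 0 by apply: raddf0.
    exact: etrans (congr1 _ U0) U0.
  by apply/mpolyP => m; rewrite mcoeff0; apply/esym/eqP/negPn/negP => /BE.
(* Sorting makes [c] constant on orbits, so that [h0] is symmetric; [ev2] is the diagonal entry on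
   sorted exponents only. *)
pose c eta := (ev2 k (asort eta) - e)^-1.
pose h0 : {mpoly F[n]} := \sum_(m <- msupp g) (c m * g@_m) *: 'X_[m].
have h0E eta : h0@_eta = c eta * g@_eta.
  rewrite (raddf_sum (mcoeff eta)) /=.
  have [es|] := boolP (eta \in msupp g); last first.
    move=> es; rewrite big_seq big1 ?(memN_msupp_eq0 es) ?mulr0 // => m mg.
    rewrite mcoeffZ mcoeffX; case: eqP mg => [->|_]; last by rewrite mulr0.
    by rewrite (negbTE es).
  rewrite (bigD1_seq eta) ?msupp_uniq //= mcoeffZ mcoeffX eqxx mulr1 big1 ?addr0 //.
  by move=> m /negbTE me; rewrite mcoeffZ mcoeffX me mulr0.
have h0supp P : supp_in P g -> supp_in P h0.
  by move=> Pg eta; rewrite h0E mulf_eq0 negb_or => /andP[_]; apply: Pg.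
have sh0 : h0 \is symmetric.
  apply/issymP => s; apply/mpolyP => m; rewrite mcoeff_sym -/(mperm s m) !h0E.
  by rewrite /c asort_mperm sym_coeff.
pose g' := g - (cher2 k h0 - e%:MP * h0).
have sg' : g' \is symmetric.
  rewrite rpredB // rpredB ?sym_cher2 //; apply: rpredM => //.
  by apply/issymP => s; apply: (@act_cst F n V).
have clo P : (forall eta theta, low eta theta -> P theta -> P eta) ->
    supp_in P g -> supp_in P g'.
  move=> Pl Pg; apply: supp_inD => //; apply: supp_inN; apply: supp_inD.
    by apply: cher2_supp_in => //; apply: h0supp.
  by apply: supp_inN; apply: supp_inC; apply: h0supp.
have [||h1 [sh1 Sh1 E1]] := IH g' sg'.
- by apply: clo Sg => eta theta; apply: low_slow.
- have leB : supp_in (fun eta => sq eta <= B)%N g'.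
    by apply: clo => [eta theta /low_sq l1 l2|]; [apply: leq_trans l1 l2|].
  move=> theta nz; rewrite ltn_neqAle leB // andbT; apply/eqP => EB.
  have [s E] := asort_perm theta; have ad := asort_antidom theta.
  have nz' : g'@_(asort theta) != 0 by rewrite E sym_coeff.
  move: nz'; rewrite !mcoeffB mcoeffCM cher2_coef //; last first.
    apply: sq_not_slow; apply: h0supp; apply: supp_in_sub BE => eta.
    by rewrite E sq_mperm EB.
  have [g0|gn] := eqVneq g@_(asort theta) 0.
    by rewrite h0E g0 !mulr0 subrr subr0 eqxx.
  rewrite -mulrBl h0E /c (asort_id ad) mulVKf ?subrr ?eqxx //.
  by rewrite subr_eq0 He //; apply: Sg.
exists (h0 + h1); split.
- by rewrite rpredD.
- by apply: supp_inD => //; apply: h0supp.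
have -> : cher2 k (h0 + h1) = cher2 k h0 + cher2 k h1.
  rewrite /cher2 -big_split; apply: eq_bigr => i _ /=.
  by rewrite -!(@cherD F n V).
have -> : g = g' + (cher2 k h0 - e%:MP * h0) by rewrite subrK.
by rewrite -E1; ring.
Qed.

End Leading.

(** * Genericity of the parameter *)

Section Generic.

Lemma alpha_neq0 : alpha != 0.
Proof. by rewrite /alpha tofrac_eq0 polyX_eq0. Qed.

Lemma r_neq0 : r != 0.
Proof. by rewrite /r invr_eq0 alpha_neq0. Qed.

(** Multiplying by alpha leaves an identity between polynomials of degree at most 1. This is the
    hypothesis [k_generic] of the later sections. *)
Lemma r_generic (a b c d : nat) :
  a%:R + r * b%:R = c%:R + r * d%:R -> a = c /\ b = d.
Proof.
move=> /(congr1 (fun z => alpha * z)); rewrite !mulrDr !mulrA.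
rewrite /r divff ?alpha_neq0 // !mul1r.
have E (u v : nat) : alpha * u%:R + v%:R =
    tofrac (u%:R%:P * 'X + v%:R%:P : {poly rat}) :> Falpha.
  by rewrite tofracD tofracM mulrC !polyC_natr !rmorph_nat.
rewrite !E => /eqP; rewrite tofrac_eq => /eqP /polyP P.
have := P 0%N; have := P 1%N; rewrite !coefD !coefMX !coefC /= !addr0 !add0r.
by move=> /eqP; rewrite Num.Theory.eqr_nat => /eqP-> /eqP;
  rewrite Num.Theory.eqr_nat => /eqP->.
Qed.

Lemma charFalpha (a : nat) : (a.+1%:R : Falpha) != 0.
Proof.
apply/eqP => h; have := @r_generic a.+1 0 0 0.
by rewrite !mulr0 !addr0 h => /(_ erefl)[].
Qed.

End Generic.

(** * Comparison of the sum of squares with D(alpha) *)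

Section LaplaceBeltrami.
Variables (F : fieldType) (M : nat) (k : F).
Local Notation V := (mpoly_symring F M).
Implicit Types (p : {mpoly F[M]}) (i j : 'I_M).
Local Notation U i f := (@cher F M V k i f : {mpoly F[M]}).
Local Notation dd i j f := (@ddiff F M V i j f : {mpoly F[M]}).

Let sum_below (i : 'I_M) p : \sum_(j < M | (j < i)%N) p = i%:R * p.
Proof.
rewrite sumr_const -[LHS]mulr_natl; congr (_%:R * _).
rewrite -sum1_card (eq_bigl (fun j : 'I_M => (j < i)%N)) //.
by rewrite (big_ord_narrow (ltnW (ltn_ord i))) sum1_card card_ord.
Qed.

Lemma cher_symE i p : p \is symmetric ->
  U i p = 'X_i * p^`M(i) + (k * i%:R)%:MP * p.
Proof.
move=> /issymP sp; rewrite cherE mpolyCM mpolyC_nat -mulrA; congr (_ * _ + _ * _).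
  exact: (@dunkl_sym F M V k i p sp).
by rewrite -sum_below; apply: eq_bigr => j _; apply: sp.
Qed.

Let A p i := 'X_i * p^`M(i).

Let sw_A p i j : p \is symmetric -> @sw F M V i j (A p i) = A p j.
Proof.
move=> /issymP sp; rewrite swM {1}/sw (@act_var F M V) tpermL.
by rewrite /sw (@act_pd F M V) tpermL; congr (_ * mderiv _ _); apply: sp.
Qed.

(** The divided differences of x_i times the derivative become those of x_i^2 times the derivative
    by [ddiffX]; the reflection terms left over cancel after summation over [i], which is [E2]. *)
Lemma cher2_symE p : p \is symmetric ->
  cher2 k p = \sum_i 'X_i ^+ 2 * p^`M(i)^`M(i) + \sum_i 'X_i * p^`M(i)
    + k%:MP * \sum_i \sum_(j | j != i) dd i j ('X_i ^+ 2 * p^`M(i))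
    + (k ^+ 2 * \sum_(i < M) i%:R ^+ 2)%:MP * p.
Proof.
move=> sp.
have E1 i : U i (U i p) = 'X_i ^+ 2 * p^`M(i)^`M(i) + A p i
    + k%:MP * (\sum_(j | j != i) dd i j ('X_i ^+ 2 * p^`M(i)))
    - k%:MP * (\sum_(j | j != i) A p j)
    + k%:MP * (\sum_(j < M | (j < i)%N) A p j)
    + k%:MP * (i%:R * A p i) + (k ^+ 2 * i%:R ^+ 2)%:MP * p.
  transitivity (U i (A p i) + (k * i%:R)%:MP * U i p).
    apply: etrans (congr1 (fun z => U i z) (cher_symE i sp)) _.
    by rewrite (@cherD F M V) (@cherC F M V).
  rewrite (cher_symE i sp).
  have EA : U i (A p i) = 'X_i * (A p i)^`M(i) + k%:MP * (\sum_j 'X_i * dd i j (A p i))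
      + k%:MP * \sum_(j < M | (j < i)%N) A p j.
    rewrite cher_mpolyE; congr (_ + _ * _); apply: eq_bigr => j _; exact: sw_A.
  rewrite EA.
  rewrite (bigD1 i) //= (@ddiff_ii F M V) mulr0 add0r.
  have -> : \sum_(j | j != i) 'X_i * dd i j (A p i) =
      \sum_(j | j != i) dd i j ('X_i ^+ 2 * p^`M(i)) - \sum_(j | j != i) A p j.
    rewrite -sumrB; apply: eq_bigr => j ji.
    have -> : 'X_i ^+ 2 * p^`M(i) = 'X_i * A p i by rewrite /A; ring.
    rewrite [X in _ = X - _](@ddiffX F M V) eqxx (negbTE ji) subr0 mul1r.
    by rewrite sw_A // addrK.
  have -> : 'X_i * (A p i)^`M(i) = 'X_i ^+ 2 * p^`M(i)^`M(i) + A p i.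
    have X1 : ('X_i : {mpoly F[M]})^`M(i) = 1.
      by have := @pd_var F M V i i; rewrite eqxx.
    by rewrite /A mderivM X1; ring.
  have -> : (k ^+ 2 * i%:R ^+ 2)%:MP_[M] = k%:MP ^+ 2 * i%:R ^+ 2.
    by rewrite mpolyCM !rmorphXn /= mpolyC_nat.
  by rewrite -/(A p i) !mpolyCM !mpolyC_nat; ring.
have E2 : \sum_(i < M) \sum_(j | j != i) A p j =
    \sum_(i < M) \sum_(j < M | (j < i)%N) A p j + \sum_(i < M) i%:R * A p i.
  transitivity (\sum_(i < M) (\sum_(j < M | (j < i)%N) A p j + \sum_(j < M | (i < j)%N) A p j)).
    apply: eq_bigr => i _; rewrite (bigID (fun j : 'I_M => (j < i)%N)) /=.
    congr (_ + _); apply: eq_bigl => j; rewrite -(inj_eq val_inj) /=; lia.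
  rewrite big_split; congr (_ + _) => /=.
  rewrite (exchange_big_dep xpredT) //=; apply: eq_bigr => j _.
  by rewrite sum_below.
rewrite /cher2 (eq_bigr _ (fun i _ => E1 i)) !big_split /= !sumrN -!mulr_sumr E2.
rewrite -mulr_suml -(raddf_sum (@mpolyC M F)) -mulr_sumr /=.
by rewrite /A; ring.
Qed.

(** Each divided difference splits into two fractions, and exchanging [i] and [j] identifies the two
    resulting double sums, whence the 2. *)
Lemma tofrac_sum_ddiff p : p \is symmetric ->
  tofrac (\sum_i \sum_(j | j != i) dd i j ('X_i ^+ 2 * p^`M(i))) =
    2%:R * \sum_i \sum_(j | j != i)
      tofrac ('X_i ^+ 2) / tofrac ('X_i - 'X_j) * tofrac (p^`M(i)).
Proof.
move=> sp.
pose B i := tofrac ('X_i ^+ 2 * p^`M(i)).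
have dE i j : j != i -> tofrac (dd i j ('X_i ^+ 2 * p^`M(i))) =
   B i / tofrac ('X_i - 'X_j) + B j / tofrac ('X_j - 'X_i).
  move=> ji; have ij : i != j by rewrite eq_sym.
  have nz : tofrac ('X_i - 'X_j : {mpoly F[M]}) != 0.
    by rewrite tofrac_eq0; apply: (@subX_neq0 F M V).
  have -> : tofrac ('X_j - 'X_i) = - tofrac ('X_i - 'X_j : {mpoly F[M]}).
    by rewrite -tofracN opprB.
  rewrite invrN mulrN -mulrBl; apply: (mulIf nz); rewrite divfK // /B.
  rewrite -tofracB -tofracM mulrC -[_ * dd i j _](@ddiffE F M V).
  congr (tofrac (_ - _)).
  have -> : 'X_i ^+ 2 * p^`M(i) = 'X_i * A p i by rewrite /A; ring.
  transitivity ('X_j * A p j); last by rewrite /A; ring.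
  rewrite swM; congr (_ * _); last exact: sw_A.
  by rewrite /sw (@act_var F M V) tpermL.
rewrite (raddf_sum (@tofrac {mpoly F[M]})) /=.
transitivity (\sum_i \sum_(j | j != i) (B i / tofrac ('X_i - 'X_j) + B j / tofrac ('X_j - 'X_i))).
  apply: eq_bigr => i _; rewrite (raddf_sum (@tofrac {mpoly F[M]})) /=.
  by apply: eq_bigr => j ji; rewrite dE.
rewrite (eq_bigr (fun i => \sum_(j | j != i) B i / tofrac ('X_i - 'X_j) +
  \sum_(j | j != i) B j / tofrac ('X_j - 'X_i))) => [|i _]; last by rewrite big_split.
rewrite big_split /= [X in _ + X](exchange_big_dep xpredT) //=.
rewrite mulr_natl mulr2n; congr (_ + _); apply: eq_bigr => i _.
  by apply: eq_bigr => j _; rewrite /B tofracM mulrAC.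
apply: eq_big => j; first by rewrite eq_sym.
by move=> _; rewrite /B tofracM mulrAC.
Qed.

End LaplaceBeltrami.

(** The Euler operator and the constant act by scalars on homogeneous polynomials, so both operators
    have the same homogeneous symmetric eigenfunctions. *)
Lemma Dalpha_cher2 M (p : {mpoly Falpha[M]}) : p \is symmetric ->
  tofrac (cher2 r p) = tofrac (2%:R * r)%:MP * Dalpha p
    + tofrac (\sum_i 'X_i * p^`M(i) + (r ^+ 2 * \sum_(i < M) i%:R ^+ 2)%:MP * p).
Proof.
move=> sp; rewrite cher2_symE // /Dalpha mulrDr.
have rE : (2%:R * r)%:MP * ((alpha / 2%:R) *: \sum_(i < M) 'X_i ^+ 2 * p^`M(i)^`M(i))
    = \sum_(i < M) 'X_i ^+ 2 * p^`M(i)^`M(i).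
  have h2 : (2%:R : Falpha) != 0 by apply: (charFalpha 1).
  rewrite -mul_mpolyC mulrA -mpolyCM.
  have -> : 2%:R * r * (alpha / 2%:R) = 1.
    by rewrite /r -mulrA mulKf ?alpha_neq0 // divff.
  by rewrite mpolyC1 mul1r.
rewrite -tofracM rE !tofracD tofracM tofrac_sum_ddiff //.
have -> : (2%:R * r)%:MP_[M] = r%:MP * 2%:R by rewrite mpolyCM mpolyC_nat mulrC.
rewrite (tofracM r%:MP 2%:R) (rmorph_nat (@tofrac _)) mulrA -!addrA; congr (_ + _).
by rewrite addrCA.
Qed.

(** * Monomial symmetric polynomials and the dominance order *)

Section OrbitSum.
Variables (F : fieldType) (n : nat).
Implicit Types (eta theta lam mu : 'X_{1..n}).

Definition orbit_sum lam : {mpoly F[n]} :=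
  \sum_(m : 'X_{1..n < (mdeg lam).+1} | perm_eq (val m) lam) 'X_[val m].

Lemma perm_mdeg eta theta : perm_eq eta theta -> mdeg eta = mdeg theta.
Proof. by move/mpermP => [s ->]; rewrite !mdegS (sum_mperm s theta id). Qed.

Lemma orbit_sum_coeff lam theta : (orbit_sum lam)@_theta = (perm_eq theta lam)%:R.
Proof.
rewrite (raddf_sum (mcoeff theta)) /=.
have [h|h] := boolP (perm_eq theta lam); last first.
  rewrite big1 // => m pm; rewrite mcoeffX; case: eqP pm => // ->.
  by rewrite (negbTE h).
have hd : (mdeg theta < (mdeg lam).+1)%N by rewrite (perm_mdeg h).
rewrite (bigD1 (BMultinom hd)) //= mcoeffX eqxx big1 ?addr0 // => m /andP[_ ne].
rewrite mcoeffX; case: eqP => // E; case/eqP: ne; exact: val_inj.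
Qed.

Lemma perm_mperm s theta lam : perm_eq (mperm s theta) lam = perm_eq theta lam.
Proof.
by apply: (permPl (introT (mpermP (mperm s theta) theta) _)); exists s.
Qed.

Lemma orbit_sum_sym lam : orbit_sum lam \is symmetric.
Proof.
apply/issymP => s; apply/mpolyP => m; rewrite mcoeff_sym -/(mperm s m).
by rewrite !orbit_sum_coeff perm_mperm.
Qed.

Lemma part_perm_inj lam mu : is_part lam -> is_part mu -> perm_eq lam mu -> lam = mu.
Proof.
move=> pl pm /mpermP[s E]; apply: (can_inj (@revmK n)).
rewrite -(asort_id (antidom_revm pl)) -(asort_id (antidom_revm pm)).
by rewrite /revm !asort_mperm E asort_mperm.
Qed.

(** Truncating at the level c = lam_k turns the truncated sum of [lam] into its partial sum minus a
    multiple of c, while the one of [mu] is at least the same expression for [mu]. *)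
Lemma slow_partial lam mu (k : 'I_n) : is_part lam -> slow mu lam ->
  (\sum_(i < n | (i <= k)%N) mu i <= \sum_(i < n | (i <= k)%N) lam i)%N.
Proof.
move=> /is_partP pl [_ h _]; have := h (lam k); set c := lam k => hc.
have E : (\sum_i (lam i - c) = \sum_(i < n | (i <= k)%N) (lam i - c))%N.
  rewrite (bigID (fun i : 'I_n => (i <= k)%N)) /= [X in (_ + X)%N]big1 ?addn0 //.
  by move=> i; rewrite -ltnNge => /ltnW /pl; rewrite -subn_eq0 => /eqP.
have E2 : (\sum_(i < n | (i <= k)%N) lam i =
    \sum_(i < n | (i <= k)%N) (lam i - c) + \sum_(i < n | (i <= k)%N) c)%N.
  by rewrite -big_split; apply: eq_bigr => i /pl h'; rewrite /= subnK.
rewrite E2 -E; apply: leq_trans (leq_add hc (leqnn _)).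
rewrite [X in (_ <= X + _)%N](bigID (fun i : 'I_n => (i <= k)%N)) /=.
apply: leq_trans (_ : \sum_(i < n | (i <= k)%N) (mu i - c + c) <= _)%N.
  by apply: leq_sum => i _; rewrite addnC -leq_subLR.
by rewrite big_split /= leq_add2r leq_addr.
Qed.

Lemma slow_dominated lam mu : is_part lam -> slow mu lam -> dominated mu lam.
Proof.
move=> pl sl; apply/and3P; split; first by case: sl => ->.
  by apply/eqP => E; move: sl; rewrite E; apply: slow_irr.
by apply/forallP => k; apply: slow_partial.
Qed.

Lemma partial_inj lam mu : (forall k : 'I_n,
  \sum_(i < n | (i <= k)%N) mu i = \sum_(i < n | (i <= k)%N) lam i)%N -> mu = lam.
Proof.
move=> h; apply/mnmP => -[a la].
have S (eta : 'X_{1..n}) b (lb : (b.+1 < n)%N) :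
    (\sum_(i < n | (i <= b.+1)%N) eta i =
     \sum_(i < n | (i <= b)%N) eta i + eta (Ordinal lb))%N.
  rewrite (bigD1 (Ordinal lb)) //= addnC; congr (_ + _)%N; apply: eq_bigl => i.
  by rewrite -(inj_eq val_inj) /=; lia.
case: a la => [|a] la.
  have := h (Ordinal la).
  by rewrite !(eq_bigl (pred1 (Ordinal la))) ?big_pred1_eq // => i;
    rewrite /= -(inj_eq val_inj) leqn0.
by have := h (Ordinal la); rewrite /= !S (h (Ordinal (ltnW la))) => /addnI.
Qed.

(** Abel summation ([W]): the weight plus the size is the sum of all partial sums. These are
    compared term by term, and one of them differs. *)
Lemma dominated_weight lam mu : dominated mu lam ->
  (\sum_(i < n) i * revm mu i < \sum_(i < n) i * revm lam i)%N.
Proof.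
case/and3P => /eqP dE ne /forallP h.
have W (eta : 'X_{1..n}) : (\sum_(i < n) i * revm eta i + mdeg eta =
    \sum_(k < n) \sum_(i < n | (i <= k)%N) eta i)%N.
  rewrite (exchange_big_dep xpredT) //= mdegS.
  rewrite [X in (X + _)%N](reindex_inj (@rev_ord_inj n)).
  rewrite -big_split; apply: eq_bigr => i _; rewrite sum_nat_const /= revmE rev_ordK.
  rewrite -[X in (_ + X)%N]mul1n -mulnDl; congr (_ * _)%N.
  rewrite -sum1_card (eq_bigl (fun k : 'I_n => (i <= k)%N)) //.
  rewrite (reindex_inj rev_ord_inj) /= (eq_bigl (fun k : 'I_n => (k < n - i)%N)).
    rewrite (big_ord_narrow (leq_subr _ _)) sum1_card card_ord.
    by have := ltn_ord i; lia.
  by move=> k; have := ltn_ord k; have := ltn_ord i; lia.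
rewrite -(ltn_add2r (mdeg mu)) {2}dE !W.
have [k0 hk0] : exists k0 : 'I_n, (\sum_(i < n | (i <= k0)%N) mu i !=
    \sum_(i < n | (i <= k0)%N) lam i)%N.
  apply/existsP; rewrite -[X in is_true X]negbK negb_exists; apply/forallP => E.
  by case/eqP: ne; apply: partial_inj => k; apply/eqP; have := E k; rewrite negbK.
rewrite (bigD1 k0) //= [X in (_ < X)%N](bigD1 k0) //= -addSn.
by apply: leq_add; [rewrite ltn_neqAle hk0 h|apply: leq_sum => k _; apply: h].
Qed.
End OrbitSum.

(** * Existence and uniqueness of Jack polynomials *)

Section JackGeneric.
Variables (F : fieldType) (n : nat) (k : F).
Local Notation V := (mpoly_symring F n).
Implicit Types (f g h p : {mpoly F[n]}) (eta theta lam mu : 'X_{1..n}) (i j : 'I_n).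

Hypothesis k_generic : forall a b c d : nat,
  a%:R + k * b%:R = c%:R + k * d%:R -> a = c /\ b = d.

Lemma ev2E eta : ev2 k eta = (\sum_i eta i ^ 2)%:R
  + k * (2 * \sum_(i < n) i * eta i)%:R + k ^+ 2 * (\sum_(i < n) i ^ 2)%:R.
Proof.
rewrite natrM !natr_sum !mulr_sumr -!big_split /=; apply: eq_bigr => i _.
by rewrite natrM !natrX; ring.
Qed.

(** The coefficients of 1 and of k separate by genericity. The first invariant tells apart exponents
    comparable for [slow], the second tells apart partitions comparable for [dominated]. *)
Lemma ev2_inj eta theta : ev2 k eta = ev2 k theta ->
  (\sum_i eta i ^ 2 = \sum_i theta i ^ 2)%N /\
  (\sum_(i < n) i * eta i = \sum_(i < n) i * theta i)%N.
Proof.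
rewrite !ev2E => /addIr /k_generic[-> /eqP].
by rewrite eqn_mul2l => /eqP.
Qed.

Lemma ev2_slow eta lam : slow eta lam -> ev2 k eta != ev2 k (revm lam).
Proof.
case=> _ _ h; apply/eqP => /ev2_inj[E _]; move: h.
by rewrite E sq_mperm ltnn.
Qed.

(** A working form of [is_jack], with [cher2] as operator and [low] as triangularity; for k = r the
    two agree on partitions by [is_jack_Jack] and [Jack_is_jack]. *)
Definition Jack lam p := [/\ p \is symmetric, p@_lam = 1,
  supp_in (fun theta => low theta lam) p & cher2 k p = (ev2 k (revm lam))%:MP * p].

Lemma cher2B f g : cher2 k (f - g) = cher2 k f - cher2 k g.
Proof.
rewrite /cher2 -sumrB; apply: eq_bigr => i _.
by rewrite -!(@cherB F n V).
Qed.

Lemma cher2D f g : cher2 k (f + g) = cher2 k f + cher2 k g.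
Proof.
rewrite /cher2 -big_split; apply: eq_bigr => i _ /=.
by rewrite -!(@cherD F n V).
Qed.

Lemma cher2C c f : cher2 k (c%:MP * f) = c%:MP * cher2 k f.
Proof.
rewrite /cher2 mulr_sumr; apply: eq_bigr => i _.
by rewrite -!(@cherC F n V).
Qed.

Lemma cst_sym c : (c%:MP : {mpoly F[n]}) \is symmetric.
Proof. by apply/issymP => s; apply: (@act_cst F n V). Qed.

Lemma cher2_low lam g : supp_in (fun theta => low theta lam) g ->
  supp_in (fun theta => low theta lam) (cher2 k g).
Proof. by apply: cher2_supp_in => a b; apply: low_trans. Qed.

Lemma low_slow_supp lam g : g \is symmetric -> g@_lam = 0 ->
  supp_in (fun theta => low theta lam) g -> supp_in (fun theta => slow theta lam) g.
Proof.
move=> sg g0 Sg theta nz; case: (Sg theta nz) => // -[s E]; move: nz.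
by rewrite E sym_coeff // g0 eqxx.
Qed.

Lemma low_not_slow_revm lam g : supp_in (fun theta => low theta lam) g ->
  supp_in (fun theta => ~ slow (revm lam) theta) g.
Proof.
apply: supp_in_sub => theta l sl.
have := slow_low sl l; rewrite -{2}(mperm1 lam) slow_mperm.
exact: slow_irr.
Qed.

Lemma slow_eigen0 lam g : g \is symmetric -> supp_in (fun theta => slow theta lam) g ->
  cher2 k g = (ev2 k (revm lam))%:MP * g -> g = 0.
Proof.
move=> sg Sg Eg; apply/eqP/negPn/negP => g0.
have [mu [pm gm tm]] := leading_exists sg g0.
have := cher2_coef k (antidom_revm pm) tm; rewrite Eg mcoeffCM revm_coeff //.
move/(mulIf gm) => E; have sl : slow (revm mu) lam by apply: Sg; rewrite revm_coeff.
by have := ev2_slow sl; rewrite E eqxx.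
Qed.

(** The defect of the orbit sum from being an eigenvector has coefficient 0 at [lam], hence is
    supported strictly below [lam], where [cher2_solve] corrects it. *)
Lemma Jack_exists lam : is_part lam -> exists p, Jack lam p.
Proof.
move=> pl; pose m := orbit_sum F lam; pose e := ev2 k (revm lam).
have sm : m \is symmetric by apply: orbit_sum_sym.
have ml : m@_lam = 1 by rewrite orbit_sum_coeff perm_refl.
have lm : supp_in (fun theta => low theta lam) m.
  move=> theta; rewrite orbit_sum_coeff; case: (mpermP theta lam) => [h _|_].
    by left.
  by rewrite eqxx.
have [h [sh Sh Eh]] : exists h, [/\ h \is symmetric,
    supp_in (fun eta => slow eta lam) h &
    cher2 k h - e%:MP * h = e%:MP * m - cher2 k m].
  apply: cher2_solve.
  - by rewrite rpredB ?sym_cher2 // rpredM // cst_sym.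
  - apply: low_slow_supp.
    + by rewrite rpredB ?sym_cher2 // rpredM // cst_sym.
    + rewrite mcoeffB mcoeffCM -[(cher2 k m)@_lam]revm_coeff ?sym_cher2 //.
      rewrite cher2_coef; last exact: low_not_slow_revm.
        by rewrite revm_coeff // subrr.
      exact: antidom_revm.
    + apply: supp_inD; first exact: supp_inC.
      by apply: supp_inN; apply: cher2_low.
  - by move=> eta _; apply: ev2_slow.
exists (m + h); split.
- by rewrite rpredD.
- rewrite mcoeffD ml; have [->|/Sh/slow_irr//] := eqVneq h@_lam 0.
  by rewrite addr0.
- by apply: supp_inD => //; apply: supp_in_sub Sh => eta; right.
rewrite cher2D; move/eqP: Eh; rewrite subr_eq => /eqP ->; rewrite mulrDr.
by rewrite -/e; ring.
Qed.

(* The weaker triangularity required in the definition of Jack polynomials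
   suffices: eigenvalues separate dominance-comparable partitions. *)
Lemma Jack_dominated lam p e : is_part lam -> p \is symmetric -> p@_lam = 1 ->
  supp_in (fun theta => exists mu, [/\ is_part mu, perm_eq theta mu &
     (mu == lam) || dominated mu lam]) p ->
  cher2 k p = e%:MP * p -> Jack lam p.
Proof.
move=> pl sp p1 Sp Ep.
have nsl : supp_in (fun theta => ~ slow (revm lam) theta) p.
  apply: supp_in_sub Sp => theta [mu [pm /mpermP[s E] h]] sl.
  have {}sl : slow lam mu by move: sl; rewrite E slow_mperm.
  case/orP: h => [/eqP E2|dm]; first by move: sl; rewrite E2; apply: slow_irr.
  have := dominated_weight dm; have := dominated_weight (slow_dominated pm sl); lia.
have Ee : e = ev2 k (revm lam).
  have := cher2_coef k (antidom_revm pl) nsl; rewrite Ep mcoeffCM revm_coeff //.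
  by rewrite p1 !mulr1.
have [q Jq] := Jack_exists pl; have [sq' q1 lq eq'] := Jq.
suff -> : p = q by [].
apply/eqP; rewrite -subr_eq0; apply/negPn/negP => g0.
have sg : p - q \is symmetric by rewrite rpredB.
have [mu [pm gm tm]] := leading_exists sg g0.
have Eg : cher2 k (p - q) = (ev2 k (revm lam))%:MP * (p - q).
  by rewrite cher2B Ep eq' Ee; ring.
have := cher2_coef k (antidom_revm pm) tm; rewrite Eg mcoeffCM revm_coeff //.
move/(mulIf gm)/esym/ev2_inj => [E1 E2].
have ml : mu != lam.
  by apply: contraNneq gm => ->; rewrite mcoeffB p1 q1 subrr.
have dm : dominated mu lam.
  have [q0|qm] := eqVneq q@_mu 0.
    move: gm; rewrite mcoeffB q0 subr0 => /Sp[nu [pn mn]].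
    by rewrite -(part_perm_inj pm pn mn) (negbTE ml).
  apply: slow_dominated => //; case: (lq mu qm) => // -[s E].
  by case/eqP: ml; apply: part_perm_inj => //; apply/mpermP; exists s.
by have := dominated_weight dm; rewrite E2 ltnn.
Qed.

Lemma opprod_sym_S z g : g \is symmetric ->
  (S (V := V) k z g : {mpoly F[n]}) \is symmetric.
Proof.
move/issymP => sg; apply/issymP => s.
have := @act_S F n V k s z g; rewrite /= => ->.
by have -> : @act F n V s g = g by apply: sg.
Qed.

Lemma opprod_supp_in (P : 'X_{1..n} -> Prop) L z g :
  (forall eta theta, low eta theta -> P theta -> P eta) ->
  supp_in P g -> supp_in P (opprod (V := V) k L z g : {mpoly F[n]}).
Proof.
move=> Pl Pg; elim: L => //= i L IH; apply: (@supp_inD F n); first exact: supp_inC.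
by apply: supp_inN; apply: cher_supp_in.
Qed.

Lemma cher2_S z g : cher2 k (S (V := V) k z g : {mpoly F[n]}) = S (V := V) k z (cher2 k g).
Proof.
have -> : S (V := V) k z (cher2 k g) = \sum_i S (V := V) k z (cher V k i (cher V k i g)).
  exact: raddf_sum.
apply: eq_bigr => i _; rewrite /S !(@opprod_cher F n V); done.
Qed.

Definition content lam i : F := (revm lam i)%:R + k * i%:R.

(** [S] commutes with [cher2], so the difference of the two sides is an eigenvector with the
    eigenvalue of [lam] but supported strictly below [lam]; [slow_eigen0] kills it. *)
Lemma Jack_S lam p z : is_part lam -> Jack lam p ->
  S (V := V) k z p = (\prod_i (z - content lam i))%:MP * p :> {mpoly F[n]}.
Proof.
move=> pl [sp p1 lp ep]; set c := \prod_i _.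
apply/eqP; rewrite -subr_eq0; apply/eqP; apply: (@slow_eigen0 lam).
- by rewrite rpredB ?opprod_sym_S // rpredM // cst_sym.
- apply: low_slow_supp; first by rewrite rpredB ?opprod_sym_S // rpredM // cst_sym.
    rewrite mcoeffB mcoeffCM -[X in X - _]revm_coeff ?opprod_sym_S //.
    rewrite /S opprod_coef ?revm_coeff // ?p1 ?mulr1; last exact: low_not_slow_revm.
      by rewrite big_enum subrr.
    exact: antidom_revm.
  apply: supp_inD; last by apply: supp_inN; apply: supp_inC.
  by apply: opprod_supp_in => // a b; apply: low_trans.
rewrite cher2B cher2C ep cher2_S ep mulrBr.
have -> : S (V := V) k z ((ev2 k (revm lam))%:MP * p) =
  (ev2 k (revm lam))%:MP * S (V := V) k z p by apply: (@opprod_cst F n V).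
by congr (_ - _); rewrite mulrCA.
Qed.

End JackGeneric.

(** * Lowering a Jack polynomial by one box *)

Section JackLowering.
Variables (F : fieldType) (m : nat) (k : F).
Local Notation n := m.+1.
Local Notation V := (mpoly_symring F n).
Implicit Types (f g p q : {mpoly F[n]}) (eta theta lam mu : 'X_{1..n}) (i j l : 'I_n).

Hypothesis k_generic : forall a b c d : nat,
  a%:R + k * b%:R = c%:R + k * d%:R -> a = c /\ b = d.

Lemma generic_char0 (a : nat) : (a.+1%:R : F) != 0.
Proof.
apply/eqP => h; have := @k_generic a.+1 0 0 0.
by rewrite !mulr0 !addr0 h => /(_ erefl)[].
Qed.

Lemma content_eq lam mu i j (a b c d : nat) :
  content k lam i + a%:R + k * b%:R = content k mu j + c%:R + k * d%:R ->
  (revm lam i + a = revm mu j + c)%N /\ (i + b = j + d)%N.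
Proof.
move=> E; apply: k_generic; rewrite !natrD !mulrDr.
transitivity (content k lam i + a%:R + k * b%:R); first by rewrite /content; ring.
by rewrite E /content; ring.
Qed.

(** The index is the coefficient of k, so the spectrum is simple even when parts coincide. *)
Lemma content_inj lam : injective (content k lam).
Proof.
move=> i j E; have := @content_eq lam lam i j 0 0 0 0.
by rewrite !mulr0 !addr0 !addn0 E => /(_ erefl)[_ /val_inj].
Qed.

Lemma content_neq0 lam i : (0 < revm lam i)%N -> content k lam i != 0.
Proof.
move=> h; apply/eqP => E; have := @k_generic (revm lam i) i 0 0.
by rewrite mulr0 addr0 -/(content k lam i) E => /(_ erefl)[E2]; rewrite E2 in h.
Qed.

(** As in [content], the index counts from the bottom row: the box is taken from row [rev_ord j],
    and the result need not be a partition. *)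
Definition low_part lam j : 'X_{1..n} := revm (revm lam - U_(j))%MM.

Definition jlow lam p j : {mpoly F[n]} := @lowered F m V k (content k lam) p j.

Section Fixed.
Variables (lam : 'X_{1..n}) (p : {mpoly F[n]}).
Hypothesis pl : is_part lam.
Hypothesis Jp : Jack k lam p.
Variable j : 'I_n.
Local Notation b := (content k lam).

Let sf (s : 'S_n) : @act F n V s p = p.
Proof. by have [/issymP sp _ _ _] := Jp; apply: sp. Qed.

Let Sf z : @S F n V k z p = (\prod_l (z - b l))%:MP * p.
Proof. exact: Jack_S. Qed.

Lemma jlow_sym : jlow lam p j \is symmetric.
Proof. by apply/issymP => s; apply: (@act_lowered F m V k). Qed.

Lemma jlow_S z : (z - b j)%:MP * (@S F n V k z (jlow lam p j) : {mpoly F[n]}) =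
  ((z - b j + 1) * \prod_l (z - b l))%:MP * jlow lam p j.
Proof. exact: (@S_lowered F m V k b p Sf j z). Qed.

(** The degree of T_0 v is read off from U_0 = x_0 T_0, since U_0 preserves degrees. *)
Lemma jlow_mdeg : supp_in (fun theta => (mdeg theta).+1 = mdeg lam) (jlow lam p j).
Proof.
have [_ _ lp _] := Jp.
have Pl d (eta theta : 'X_{1..n}) : low eta theta -> mdeg theta = d -> mdeg eta = d.
  by move=> /low_mdeg ->.
pose v : {mpoly F[n]} := @eigen_part F m V k b p j.
have Sv : supp_in (fun theta => mdeg theta = mdeg lam) v.
  apply: opprod_supp_in; first exact: Pl.
  by apply: supp_in_sub lp => theta /low_mdeg.
have ST : supp_in (fun theta => (mdeg theta).+1 = mdeg lam)
    (@dunkl F n V k ord0 v : {mpoly F[n]}).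
  move=> theta nz; have SU := cher_supp_in (@Pl (mdeg lam)) Sv (i := ord0) (k := k).
  have := SU (U_(ord0) + theta)%MM; rewrite mdegD mdeg1 add1n; apply.
  rewrite (@cher0 F m V k) /= mulrC.
  by rewrite mcoeffMX.
rewrite /jlow /lowered; apply: supp_in_sum => s _ theta; rewrite mcoeff_sym => h.
rewrite -(ST _ h) !mdegS.
by rewrite -(sum_mperm s theta id).
Qed.

(** Leading coefficients turn the hypothesis into an equality of spectra. By genericity each content
    of the leading partition is that of [lam] at the same index or, at [j] only, 1 less; the degree
    excludes [lam] itself. A general [g] is allowed because [jlow_Jack] applies this to a
    difference. *)
Lemma lowered_leading g : g \is symmetric -> g != 0 ->
  supp_in (fun theta => (mdeg theta).+1 = mdeg lam) g ->
  (forall z, (z - b j)%:MP * (@S F n V k z g : {mpoly F[n]}) =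
     ((z - b j + 1) * \prod_l (z - b l))%:MP * g) ->
  [/\ (0 < revm lam j)%N, is_part (low_part lam j) & g@_(low_part lam j) != 0].
Proof.
move=> sg g0 dg Eg; have [mu [pm gm tm]] := leading_exists sg g0.
have Ez z : (z - b j) * \prod_i (z - content k mu i) =
    (z - b j + 1) * \prod_l (z - b l).
  apply: (mulIf gm); have := congr1 (mcoeff (revm mu)) (Eg z).
  rewrite !mcoeffCM /S opprod_coef //; last exact: antidom_revm.
  by rewrite big_enum revm_coeff // mulrA.
have H i : revm mu i = revm lam i \/ i = j /\ (revm mu i).+1 = revm lam i.
  have /esym/eqP := Ez (content k mu i).
  have -> : \prod_l (content k mu i - content k mu l) = 0.
    by rewrite (bigD1 i) //= subrr mul0r.
  rewrite mulr0 mulf_eq0 => /orP[|/prodf_eq0[l _]].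
    rewrite addrAC subr_eq0 => /eqP E; right.
    have [|] := @content_eq mu lam i j 1 0 0 0.
      by rewrite mulr0 !addr0 -E.
    by rewrite !addn0 addn1 => E1 /val_inj E2; split=> //; rewrite {2}E2.
  rewrite subr_eq0 => /eqP E; left; have [|] := @content_eq mu lam i l 0 0 0 0.
    by rewrite mulr0 !addr0.
  by rewrite !addn0 => E1 /val_inj E2; rewrite {2}E2.
have dm := dg mu gm.
have Hj : (revm mu j).+1 = revm lam j.
  have [E|[]//] := H j; move: dm.
  have -> : mu = lam.
    apply: (can_inj (@revmK n)); apply/mnmP => i; have [//|[Ei _]] := H i.
    by rewrite Ei.
  by move=> E'; lia.
have Emu : mu = low_part lam j.
  apply: (can_inj (@revmK n)); rewrite /low_part revmK; apply/mnmP => i.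
  rewrite mnmBE mnm1E; have [<-|ij] := eqVneq j i; first by rewrite -Hj subn1.
  by rewrite subn0; have [//|[Ei _]] := H i; rewrite Ei eqxx in ij.
by rewrite -Hj -Emu.
Qed.

Lemma jlow_neq0 : jlow lam p j != 0 ->
  (0 < revm lam j)%N /\ is_part (low_part lam j).
Proof.
move=> h; have [//|//] := lowered_leading jlow_sym h jlow_mdeg _.
exact: jlow_S.
Qed.

Lemma content_low i : (0 < revm lam j)%N ->
  content k (low_part lam j) i = b i - (i == j)%:R.
Proof.
move=> lj; rewrite /content /low_part revmK mnmBE mnm1E eq_sym.
by case: eqVneq => [->|_]; rewrite ?subr0 ?subn0 // natrB //; ring.
Qed.

Lemma mdeg_low : (0 < revm lam j)%N -> (mdeg (low_part lam j)).+1 = mdeg lam.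
Proof.
move=> lj; have md (eta : 'X_{1..n}) : mdeg (revm eta) = mdeg eta.
  by rewrite !mdegS (sum_mperm _ eta id).
have {2}-> : lam = revm (revm lam - U_(j) + U_(j))%MM.
  by rewrite submK ?revmK //; apply/mnm_lepP => i; rewrite mnm1E; case: eqP => // <-.
by rewrite !md mdegD mdeg1 addn1.
Qed.

(** The difference of the two sides satisfies the hypotheses of [lowered_leading], yet its
    coefficient at the only possible leading partition is 0. *)
Lemma jlow_Jack q : (0 < revm lam j)%N -> is_part (low_part lam j) ->
  Jack k (low_part lam j) q ->
  jlow lam p j = ((jlow lam p j)@_(low_part lam j))%:MP * q.
Proof.
move=> lj pn Jq; set c := (jlow lam p j)@__.
have [sq q1 lq _] := Jq.
apply/eqP; rewrite -subr_eq0; apply/negPn/negP => g0.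
have [||z|] := lowered_leading _ g0.
- by rewrite rpredB ?jlow_sym // rpredM // cst_sym.
- apply: supp_inD; first exact: jlow_mdeg.
  apply: supp_inN; apply: supp_inC; apply: supp_in_sub lq => theta /low_mdeg ->.
  exact: mdeg_low.
- have -> : @S F n V k z (jlow lam p j - c%:MP * q) =
      @S F n V k z (jlow lam p j) - c%:MP * @S F n V k z q.
    apply: etrans (raddfB (@S F n V k z) _ _) _.
    by congr (_ - _); apply: (@opprod_cst F n V).
  rewrite mulrBr jlow_S mulrCA (Jack_S k_generic z pn Jq) mulrBr.
  congr (_ - _); rewrite [in RHS]mulrCA; congr (_ * _).
  rewrite mulrA -mpolyCM; congr (_%:MP * _).
  rewrite (bigD1 j) //= [in RHS](bigD1 j) //= content_low // eqxx /=.
  rewrite (eq_bigr (fun l => z - b l)) => [|l lj']; last first.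
    by rewrite content_low // (negbTE lj') subr0.
  by ring.
by move=> _ _; rewrite mcoeffB mcoeffCM q1 mulr1 subrr eqxx.
Qed.

Lemma meval_msym s (g : {mpoly F[n]}) : (msym s g).@[fun=> 1] = g.@[fun=> 1].
Proof.
elim/mpolyind: g => [|c eta g _ _ IH]; first by rewrite msym0.
rewrite msymD msymZ msymX !mevalD !mevalZ IH !mevalX.
by rewrite !big1 // => i _; rewrite expr1n.
Qed.

Local Notation ev g := (g.@[fun=> 1]).

(** At (1, ..., 1) the factor x_0 of U_0 = x_0 T_0 is invisible, so T_0 v has the value of b_j v;
    the value of v comes from [symmetrized_eigen]. *)
Lemma ev_jlow : k != 0 ->
  n%:R * ev (jlow lam p j) =
  n`!%:R * (b j * \prod_(l | l != j) (b j - b l - k) * ev p).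
Proof.
move=> k0.
have evS (g : {mpoly F[n]}) : ev (@symmetrized F m V g : {mpoly F[n]}) = n`!%:R * ev g.
  rewrite /symmetrized (raddf_sum (meval (fun=> 1))) /=.
  rewrite (eq_bigr (fun=> ev g)) => [|s _]; last exact: meval_msym.
  by rewrite sumr_const card_Sn mulr_natl.
pose v : {mpoly F[n]} := @eigen_part F m V k b p j.
have E1 : ev (jlow lam p j) = n`!%:R * (b j * ev v).
  rewrite /jlow /lowered evS; congr (_ * _).
  have := congr1 (meval (fun=> 1)) (@cher0_eigen F m V k b p Sf j).
  rewrite (@cher0 F m V k) /= !mevalM mevalXU mul1r mevalC; exact.
have E2 : n%:R * ev v = \prod_(l | l != j) (b j - b l - k) * ev p.
  have := congr1 (meval (fun=> 1)) (@symmetrized_eigen F m V k b p sf Sf j k0).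
  have natE (a : nat) (g : {mpoly F[n]}) : ev (a%:R * g) = a%:R * ev g.
    by rewrite mevalM rmorph_nat.
  rewrite !natE evS mevalM mevalC mulrCA => /mulfI -> //.
  by case: (_`!) (fact_gt0 n) => // a _; apply: generic_char0.
by rewrite E1 mulrCA [n%:R * _]mulrCA E2; ring.
Qed.

End Fixed.
End JackLowering.

(** * The sum of the derivatives of a normalized Jack polynomial *)

Section JackDerivative.
Variables (F : fieldType) (m : nat) (k : F).
Local Notation n := m.+1.
Local Notation V := (mpoly_symring F n).
Implicit Types (f g p q : {mpoly F[n]}) (eta theta lam mu : 'X_{1..n}) (i j l : 'I_n).
Local Notation ev g := (g.@[fun=> 1]).

Hypothesis k_generic : forall a b c d : nat,
  a%:R + k * b%:R = c%:R + k * d%:R -> a = c /\ b = d.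

Let k_neq0 : k != 0.
Proof.
apply/eqP => h; have := @k_generic 0 1 0 0.
by rewrite h !mul0r => /(_ erefl)[].
Qed.

Let k_neq1 : k != 1.
Proof.
apply/eqP => h; have := @k_generic 0 1 1 0.
by rewrite h !mul1r addrC => /(_ erefl)[].
Qed.

Let char0 := generic_char0 k_generic.

Let nat_neq0 (a : nat) : (0 < a)%N -> (a%:R : F) != 0.
Proof. by case: a => // a _; apply: char0. Qed.

(** Induction on the size through [ev_jlow]: if the value were 0, then so would be the scalar in
    front of the smaller Jack polynomial, against [lowered_neq0]. *)
Lemma Jack_ev_neq0 lam p : is_part lam -> Jack k lam p -> ev p != 0.
Proof.
elim: {lam}(mdeg lam) {-2}lam (erefl (mdeg lam)) p => [|d IH] lam dl p pl Jp.
  have [sp p1 lp _] := Jp; have -> : p = 1.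
    apply/mpolyP => theta; rewrite mcoeff1.
    have l0 : lam = 0%MM by apply/eqP; rewrite -mdeg_eq0 dl.
    have [->|t0] := eqVneq theta 0%MM; first by rewrite -l0 p1.
    apply/eqP/negPn/negP => /lp /low_mdeg; rewrite dl => /eqP.
    by rewrite mdeg_eq0 (negbTE t0).
  by rewrite meval1 oner_eq0.
(* The last nonempty row. The factor b_j - b_l - k vanishes only if the next row has the same
   length, which is impossible here. *)
have [j lj jmin] : exists2 j, (0 < revm lam j)%N &
    forall l, (l < j)%N -> revm lam l = 0%N.
  have exP : exists a : nat, [exists j : 'I_n, (j == a :> nat) && (0 < revm lam j)%N].
    have [j hj] : exists j, (0 < revm lam j)%N.
      apply/existsP; rewrite -[X in is_true X]negbK negb_exists; apply/forallP => h.
      move: dl; rewrite mdegS -(sum_mperm (perm (@rev_ord_inj n)) lam id) big1 // => i _.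
      by apply/eqP; have := h i; rewrite lt0n negbK.
    by exists j; apply/existsP; exists j; rewrite eqxx.
  case: (ex_minnP exP) => a /existsP[j /andP[/eqP ja lj]] amin.
  exists j => // l lj'; apply/eqP; rewrite -leqn0 leqNgt; apply/negP => h.
  have := amin l; rewrite leqNgt -ja lj' => /(_ _)/negP; apply => //.
  by apply/existsP; exists l; rewrite eqxx.
have [/issymP sp p1 _ _] := Jp.
have ad := antidom_revm pl.
have p0 : p != 0 by apply/eqP => h; move: p1; rewrite h mcoeff0 => /esym/eqP; rewrite oner_eq0.
have low0 : jlow k lam p j != 0.
  apply: (@lowered_neq0 F m V k char0 (content k lam) p) => //.
  - by move=> z; apply: (Jack_S k_generic z pl Jp).
  - exact: content_neq0.
  - move=> l lj'; rewrite -addrA -opprD subr_eq0; apply/eqP => E.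
    have [|E1 E2] := @content_eq F m k k_generic lam lam j l 0 0 0 1.
      by rewrite mulr0 !addr0 E mulr1.
    have lj2 : (l < j)%N by lia.
    by have := jmin l lj2; lia.
  - move=> l lj'; rewrite subr_eq0; apply/eqP => E.
    have [|E1 E2] := @content_eq F m k k_generic lam lam j l 0 1 1 0.
      by rewrite mulr0 !addr0 -E mulr1; ring.
    have jl : (j <= l)%N by lia.
    by have := ad j l jl; lia.
have [lj' pn] := jlow_neq0 k_generic pl Jp low0.
have [q Jq] := Jack_exists k_generic pn.
have qE := jlow_Jack k_generic pl Jp lj pn Jq.
have dq : mdeg (low_part lam j) = d by apply: succn_inj; rewrite mdeg_low.
have evq := IH _ dq q pn Jq.
apply/eqP => evp; have := ev_jlow k_generic pl Jp j k_neq0.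
rewrite evp !mulr0 qE mevalM mevalC => /eqP.
rewrite !mulf_eq0 (negbTE evq) (negbTE (char0 _)) orbF /= => /eqP c0.
by move: low0; rewrite qE c0 mpolyC0 mul0r eqxx.
Qed.

Definition row_content lam i : F := (lam i)%:R + k * (rev_ord i)%:R.

(** The coefficient a_i of the overview. Its factor at the next row vanishes when that row has the
    same length, that is, when the box cannot be removed. *)
Definition down_coef lam i : F := row_content lam i *
  \prod_(l | l != i) ((row_content lam i - row_content lam l - k) /
                      (row_content lam i - row_content lam l)).

Definition removable lam i := (0 < lam i)%N && is_part (lam - U_(i))%MM.

Lemma low_part_rev lam i : low_part lam (rev_ord i) = (lam - U_(i))%MM.
Proof.
apply/mnmP => l; rewrite revmE !mnmBE revmE rev_ordK !mnm1E.
by rewrite (inj_eq rev_ord_inj).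
Qed.

Lemma content_rev lam i : content k lam (rev_ord i) = row_content lam i.
Proof. by rewrite /content revmE rev_ordK. Qed.

Variable P : 'X_{1..n} -> {mpoly F[n]}.
Hypothesis JP : forall lam, is_part lam -> Jack k lam (P lam).

Definition jnorm lam : {mpoly F[n]} := (ev (P lam))^-1%:MP * P lam.

(** Combines [sum_pd_lowered] with [ev_jlow]: normalization makes the unknown leading coefficient of
    each lowering explicit, and lowerings that are not partitions vanish by [jlow_neq0]. *)
Lemma sum_mderiv_jnorm lam : is_part lam ->
  \sum_i (jnorm lam)^`M(i) =
  \sum_(i | removable lam i) (down_coef lam i)%:MP * jnorm (lam - U_(i))%MM.
Proof.
move=> pl; have Jp := JP pl; have [/issymP sp p1 _ _] := Jp.
have ep := Jack_ev_neq0 pl Jp.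
have E := @sum_pd_lowered F m V k (content k lam) (P lam) sp
  (content_inj k_generic (lam := lam)).
have n0 : (n%:R : F) != 0 by apply: char0.
have nf0 : (n`!%:R : F) != 0 by apply/nat_neq0/fact_gt0.
have lowE j : (n%:R)%:MP * jlow k lam (P lam) j =
   if removable lam (rev_ord j) then
     (n`!%:R * (content k lam j * \prod_(l | l != j) (content k lam j - content k lam l - k)
        * ev (P lam)))%:MP * jnorm (lam - U_(rev_ord j))%MM else 0.
  have lpE : low_part lam j = (lam - U_(rev_ord j))%MM.
    by rewrite -{1}(rev_ordK j) low_part_rev.
  case: ifPn => [/andP[lj pn]|h]; last first.
    have [->|/(jlow_neq0 k_generic pl Jp)[lj pn]] := eqVneq (jlow k lam (P lam) j) 0.
      by rewrite mulr0.
    by case/negP: h; rewrite /removable -lpE pn andbT -revmE.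
  rewrite -lpE in pn *; have Jq := JP pn.
  have eq := Jack_ev_neq0 pn Jq.
  have lj' : (0 < revm lam j)%N by rewrite revmE.
  rewrite -(ev_jlow k_generic pl Jp j k_neq0).
  rewrite {1 2}(jlow_Jack k_generic pl Jp lj' pn Jq) mevalM mevalC /jnorm.
  rewrite !mulrA -!mpolyCM; congr (_%:MP * _).
  by rewrite -!mulrA mulfV // mulr1.
have nC (a : nat) : (a%:R : {mpoly F[n]}) = (a%:R)%:MP by rewrite mpolyC_nat.
have nfC : ((n`!%:R)%:MP : {mpoly F[n]}) != 0 by rewrite mpolyC_eq0.
have -> : \sum_i (jnorm lam)^`M(i) = (ev (P lam))^-1%:MP * \sum_i (P lam)^`M(i).
  by rewrite mulr_sumr; apply: eq_bigr => i _; rewrite mderiv_mulC.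
apply: (mulfI nfC); rewrite mulrCA -nC.
transitivity ((ev (P lam))^-1%:MP * (n%:R * \sum_j
   (\prod_(l | l != j) (content k lam j - content k lam l))^-1%:MP * jlow k lam (P lam) j)).
  by congr (_ * _); exact: E.
rewrite (nC n) (nC n`!) !mulr_sumr (reindex_inj rev_ord_inj) /= [RHS]big_mkcond /=.
apply: eq_bigr => i _. rewrite [X in _ * X = _]mulrCA lowE rev_ordK.
case: ifP => // _; last by rewrite !mulr0.
rewrite !mulrA -!mpolyCM; congr (_%:MP * _).
rewrite /down_coef prodf_div content_rev.
have -> : \prod_(l | l != rev_ord i) (row_content lam i - content k lam l) =
    \prod_(l | l != i) (row_content lam i - row_content lam l).
  rewrite (reindex_inj rev_ord_inj); apply: eq_big => l.
    by rewrite (inj_eq rev_ord_inj).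
  by rewrite content_rev.
have -> : \prod_(l | l != rev_ord i) (row_content lam i - content k lam l - k) =
    \prod_(l | l != i) (row_content lam i - row_content lam l - k).
  rewrite (reindex_inj rev_ord_inj); apply: eq_big => l.
    by rewrite (inj_eq rev_ord_inj).
  by rewrite content_rev.
set X := \prod_(l | _) _; set Y := \prod_(l | _) _.
move: (ev (P lam)) ep => e ep; transitivity (e^-1 * e * (n`!%:R * (row_content lam i * (Y / X))
  / ev (P (lam - U_(i))%MM))); first by ring.
by rewrite mulVf // mul1r.
Qed.

End JackDerivative.

(** * Binomial coefficients *)

Section Shift.
Variables (F : fieldType) (n : nat).
Local Notation V := (mpoly_symring F n).
Implicit Types (f g h p q : {mpoly F[n]}) (eta theta lam mu : 'X_{1..n}) (i j l : 'I_n).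

Definition shift g : {mpoly F[n]} := g \mPo [tuple 1 + 'X_i | i < n].

Lemma shiftD f g : shift (f + g) = shift f + shift g.
Proof. exact: raddfD. Qed.

Lemma shiftM f g : shift (f * g) = shift f * shift g.
Proof. exact: rmorphM. Qed.

Lemma shiftC c : shift c%:MP = c%:MP.
Proof. exact: comp_mpolyC. Qed.

Lemma shift1 : shift 1 = 1.
Proof. exact: rmorph1. Qed.

Lemma shift_var i : shift 'X_i = 1 + 'X_i.
Proof. by rewrite /shift comp_mpolyXU -tnth_nth tnth_mktuple. Qed.

Lemma shift_sum (I : Type) (r : seq I) (A : pred I) (G : I -> {mpoly F[n]}) :
  shift (\sum_(a <- r | A a) G a) = \sum_(a <- r | A a) shift (G a).
Proof. exact: raddf_sum. Qed.

Lemma mderiv_shift i g : (shift g)^`M(i) = shift (g^`M(i)).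
Proof.
have dX a b : ('X_b : {mpoly F[n]})^`M(a) = (a == b)%:R by apply: (@pd_var F n V).
have d1 a : (1 : {mpoly F[n]})^`M(a) = 0 by apply: (@pd1 F n V).
have s0 : shift 0 = 0 by apply: raddf0.
have snat (a : nat) : shift (a%:R) = a%:R by rewrite -mpolyC_nat shiftC mpolyC_nat.
elim/(@symring_ind F n V): g => /= [|l f E|f g Ef Eg|c f E].
- by rewrite shift1 !d1 s0.
- rewrite shiftM !mderivM shift_var mderivD d1 add0r dX E shiftD !shiftM shift_var.
  by rewrite snat.
- by rewrite shiftD !mderivD shiftD Ef Eg.
- by rewrite shiftM shiftC !mderiv_mulC E shiftM shiftC.
Qed.

Definition euler g : {mpoly F[n]} := \sum_i 'X_i * g^`M(i).

Lemma shift_euler g : shift (euler g) = euler (shift g) + shift (\sum_i g^`M(i)).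
Proof.
rewrite /euler !shift_sum -big_split; apply: eq_bigr => i _ /=.
by rewrite shiftM shift_var mderiv_shift; ring.
Qed.

Lemma euler_coeff g theta : (euler g)@_theta = (mdeg theta)%:R * g@_theta.
Proof.
have EX m : euler 'X_[m] = (mdeg m)%:R%:MP * 'X_[m].
  rewrite /euler (eq_bigr _ (fun i _ => mpolyX_deriv F i m)) -mulr_suml.
  by rewrite mdegE natr_sum (raddf_sum (@mpolyC n F)).
have -> : euler g = \sum_(m <- msupp g) (g@_m)%:MP * euler 'X_[m].
  rewrite /euler; under [RHS]eq_bigr => m _ do rewrite mulr_sumr.
  rewrite exchange_big; apply: eq_bigr => i _ /=.
  rewrite {1}(mpolyE g) (raddf_sum (mderiv i)) mulr_sumr; apply: eq_bigr => m _ /=.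
  by rewrite -mul_mpolyC mderiv_mulC mulrCA.
have -> : g@_theta = \sum_(m <- msupp g) g@_m * (m == theta)%:R.
  rewrite {1}(mpolyE g) (raddf_sum (mcoeff theta)); apply: eq_bigr => m _ /=.
  by rewrite mcoeffZ mcoeffX.
rewrite (raddf_sum (mcoeff theta)) mulr_sumr; apply: eq_bigr => m _ /=.
rewrite EX !mcoeffCM mcoeffX; case: (eqVneq m theta) => [->|_]; first by ring.
by rewrite !mulr0.
Qed.

Lemma supp_in_mulX (d : nat) i h : supp_in (fun theta => mdeg theta < d)%N h ->
  supp_in (fun theta => mdeg theta < d.+1)%N ('X_i * h).
Proof.
move=> Sh; rewrite (mpolyE h) mulr_sumr big_seq; apply: supp_in_sum => m.
rewrite mcoeff_msupp => /Sh hm; rewrite -mul_mpolyC mulrCA -mpolyXD.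
by apply: supp_inC; apply: supp_inX; rewrite mdegD mdeg1 add1n ltnS.
Qed.

Lemma shift_mono_top eta :
  supp_in (fun theta => mdeg theta < mdeg eta)%N (shift 'X_[eta] - 'X_[eta]).
Proof.
elim: {eta}(mdeg eta) {-2}eta (erefl (mdeg eta)) => [|d IH] eta dE.
  move/eqP: dE; rewrite mdeg_eq0 => /eqP ->.
  by rewrite mpolyX0 shift1 subrr; apply: supp_in0.
have [i ei] : exists i, (0 < eta i)%N.
  apply/existsP; rewrite -[X in is_true X]negbK negb_exists; apply/forallP => h.
  move: dE; rewrite mdegE big1 // => i _; by apply/eqP; have := h i; rewrite lt0n negbK.
have {2 3}-> : eta = (U_(i) + (eta - U_(i)))%MM.
  rewrite addmC submK //; apply/mnm_lepP => j; rewrite mnm1E.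
  by case: eqP => // <-.
set eta' := (eta - U_(i))%MM.
have dE' : mdeg eta' = d.
  apply: succn_inj; rewrite -dE -[in RHS](submK (m := U_(i)%MM) (m' := eta)).
    by rewrite mdegD mdeg1 addn1.
  by apply/mnm_lepP => j; rewrite mnm1E; case: eqP => // <-.
have {}IH := IH eta' dE'; rewrite dE.
rewrite mpolyXD shiftM shift_var.
have -> : (1 + 'X_i) * shift 'X_[eta'] - 'X_i * 'X_[eta'] =
  'X_i * (shift 'X_[eta'] - 'X_[eta']) + ((shift 'X_[eta'] - 'X_[eta']) + 'X_[eta']).
  by ring.
apply: supp_inD; first by apply: supp_in_mulX; rewrite dE' in IH.
apply: supp_inD.
  by apply: supp_in_sub IH => theta h; rewrite dE' in h; apply: leq_trans h _.
by apply: supp_inX; rewrite dE'.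
Qed.

Lemma shift_top g theta : supp_in (fun eta => mdeg eta <= mdeg theta)%N g ->
  (shift g)@_theta = g@_theta.
Proof.
move=> Sg; apply/eqP; rewrite -subr_eq0 -mcoeffB; apply/negPn/negP => nz.
have : supp_in (fun eta => mdeg eta < mdeg theta)%N (shift g - g).
  have -> : shift g - g = \sum_(m <- msupp g) (g@_m)%:MP * (shift 'X_[m] - 'X_[m]).
    rewrite {1 2}(mpolyE g) shift_sum -sumrB; apply: eq_bigr => m _.
    by rewrite -mul_mpolyC shiftM shiftC mulrBr.
  rewrite big_seq; apply: supp_in_sum => m; rewrite mcoeff_msupp => /Sg hm.
  apply: supp_inC; apply: supp_in_sub (@shift_mono_top m) => eta h.
  exact: leq_trans h hm.
by move/(_ _ nz); rewrite ltnn.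
Qed.

End Shift.

Section Binomials.
Variables (F : fieldType) (m : nat) (k : F).
Local Notation n := m.+1.
Local Notation V := (mpoly_symring F n).
Implicit Types (f g h p q : {mpoly F[n]}) (eta theta lam mu nu : 'X_{1..n}) (i j l : 'I_n).
Local Notation ev g := (g.@[fun=> 1]).

Hypothesis k_generic : forall a b c d : nat,
  a%:R + k * b%:R = c%:R + k * d%:R -> a = c /\ b = d.

Variable P : 'X_{1..n} -> {mpoly F[n]}.
Hypothesis JP : forall lam, is_part lam -> Jack k lam (P lam).
Local Notation jn := (jnorm P).

(** [d] is fuel; each call removes one box, so [mdeg lam] is enough. *)
Fixpoint binom_rec (d : nat) lam mu : F :=
  if d is d'.+1 then
    if (mdeg lam <= mdeg mu)%N then (lam == mu)%:R else
    (mdeg lam - mdeg mu)%:R^-1 *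
      \sum_(i | removable lam i) down_coef k lam i * binom_rec d' (lam - U_(i))%MM mu
  else (lam == mu)%:R.

Definition jbinom lam mu := binom_rec (mdeg lam) lam mu.

Lemma mdeg_removable lam i : removable lam i -> (mdeg (lam - U_(i))%MM).+1 = mdeg lam.
Proof.
case/andP => li _; rewrite -[in RHS](submK (m := U_(i)%MM) (m' := lam)).
  by rewrite mdegD mdeg1 addn1.
by apply/mnm_lepP => j; rewrite mnm1E; case: eqP => // <-.
Qed.

Lemma jbinom_top lam mu : (mdeg lam <= mdeg mu)%N -> jbinom lam mu = (lam == mu)%:R.
Proof.
move=> h; rewrite /jbinom; case E : (mdeg lam) => [|d] //=.
by rewrite h.
Qed.

Lemma jbinomE lam mu : (mdeg mu < mdeg lam)%N ->
  (mdeg lam - mdeg mu)%:R * jbinom lam mu =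
  \sum_(i | removable lam i) down_coef k lam i * jbinom (lam - U_(i))%MM mu.
Proof.
move=> h; rewrite {1}/jbinom; case E : (mdeg lam) => [|d] /=; first by rewrite E in h.
rewrite -E leqNgt h /= mulVKf.
  by apply: eq_bigr => i /mdeg_removable; rewrite E => -[dE]; rewrite /jbinom dE.
have -> : (mdeg lam - mdeg mu = (mdeg lam - mdeg mu).-1.+1)%N by lia.
exact: (generic_char0 k_generic).
Qed.

Lemma jnorm_supp lam : is_part lam ->
  supp_in (fun theta => mdeg theta = mdeg lam) (jn lam).
Proof.
move=> pl; have [_ _ lp _] := JP pl.
by apply: supp_inC; apply: supp_in_sub lp => theta /low_mdeg.
Qed.

Lemma euler_homog g d : supp_in (fun theta => mdeg theta = d) g ->
  euler g = d%:R%:MP * g.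
Proof.
move=> Sg; apply/mpolyP => theta; rewrite euler_coeff mcoeffCM.
by have [->|/Sg ->//] := eqVneq g@_theta 0; rewrite !mulr0.
Qed.

Lemma eulerD f g : euler (f + g) = euler f + euler g.
Proof. by apply/mpolyP => t; rewrite mcoeffD !euler_coeff mcoeffD mulrDr. Qed.

Lemma eulerB f g : euler (f - g) = euler f - euler g.
Proof. by apply/mpolyP => t; rewrite mcoeffB !euler_coeff mcoeffB mulrBr. Qed.

Lemma euler_sum (I : Type) (r : seq I) (A : pred I) (G : I -> {mpoly F[n]}) :
  euler (\sum_(a <- r | A a) G a) = \sum_(a <- r | A a) euler (G a).
Proof.
elim/big_rec2: _ => [|a x y _ <-]; last exact: eulerD.
by apply/mpolyP => t; rewrite euler_coeff mcoeff0 mulr0.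
Qed.

Lemma eulerC c g : euler (c%:MP * g) = c%:MP * euler g.
Proof. by apply/mpolyP => t; rewrite mcoeffCM !euler_coeff mcoeffCM mulrCA. Qed.

Definition binom_sum d lam : {mpoly F[n]} :=
  \sum_(mu : 'X_{1..n < d.+1} | is_part (val mu)) (jbinom lam (val mu))%:MP * jn (val mu).

Lemma removable_part lam i : removable lam i -> is_part (lam - U_(i))%MM.
Proof. by case/andP. Qed.

Lemma nat_inj_F (a b : nat) : a%:R = b%:R :> F -> a = b.
Proof.
by move=> E; have := @k_generic a 0 b 0; rewrite !mulr0 !addr0 => /(_ E)[].
Qed.

(* Both sides solve (deg - Euler) G = G' with the same right-hand side and have
   the same top homogeneous component. *)
Lemma shift_jnorm d lam : is_part lam -> (mdeg lam <= d)%N ->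
  shift (jn lam) = binom_sum d lam.
Proof.
have [e] := ubnP (mdeg lam); elim: e lam => // e IH lam le pl ld.
pose G := shift (jn lam) - binom_sum d lam.
have EG : (mdeg lam)%:R%:MP * G - euler G = 0.
  have -> : (mdeg lam)%:R%:MP * G - euler G =
      ((mdeg lam)%:R%:MP * shift (jn lam) - euler (shift (jn lam)))
      - ((mdeg lam)%:R%:MP * binom_sum d lam - euler (binom_sum d lam)).
    by rewrite /G eulerB; ring.
  have -> : (mdeg lam)%:R%:MP * shift (jn lam) - euler (shift (jn lam)) =
      \sum_(i | removable lam i) (down_coef k lam i)%:MP * binom_sum d (lam - U_(i))%MM.
    have := shift_euler (jn lam); rewrite (euler_homog (jnorm_supp pl)) shiftM shiftC => ->.
    rewrite addrAC subrr add0r (sum_mderiv_jnorm k_generic JP pl) shift_sum.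
    apply: eq_bigr => i ri; have di := mdeg_removable ri.
    rewrite shiftM shiftC IH ?removable_part //; lia.
  rewrite /binom_sum euler_sum mulr_sumr -sumrB.
  under eq_bigr => i _ do rewrite mulr_sumr.
  rewrite exchange_big /= -sumrB big1 // => mu pm.
  rewrite eulerC (euler_homog (jnorm_supp pm)).
  have -> : \sum_(i | removable lam i)
        (down_coef k lam i)%:MP * ((jbinom (lam - U_(i))%MM (val mu))%:MP * jn (val mu)) =
      (\sum_(i | removable lam i) down_coef k lam i * jbinom (lam - U_(i))%MM (val mu))%:MP
        * jn (val mu).
    rewrite (raddf_sum (@mpolyC n F)) mulr_suml; apply: eq_bigr => i _ /=.
    by rewrite mulrA -mpolyCM.
  have [h|h] := ltnP (mdeg (val mu)) (mdeg lam).
    rewrite -(jbinomE h) natrB ?(ltnW h) // mpolyCM mpolyCB; ring.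
  rewrite big1 ?mpolyC0 ?mul0r ?sub0r => [|i ri].
    rewrite jbinom_top //; case: eqVneq => [E|_]; last first.
      by rewrite mpolyC0 !mul0r mulr0 subrr oppr0.
    by rewrite -E mpolyC1 !mul1r subrr oppr0.
  have di := mdeg_removable ri.
  have h2 : (mdeg (lam - U_(i))%MM < mdeg (val mu))%N by rewrite -ltnS di ltnS in h *.
  rewrite jbinom_top ?(ltnW h2) //; case: eqVneq => [E|_]; last by rewrite mulr0.
  by rewrite E ltnn in h2.
apply/eqP; rewrite -subr_eq0 -/G; apply/eqP/mpolyP => theta; rewrite mcoeff0.
have := congr1 (mcoeff theta) EG; rewrite mcoeff0 mcoeffB mcoeffCM euler_coeff.
rewrite -mulrBl => /eqP; rewrite mulf_eq0 => /orP[|/eqP//].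
rewrite subr_eq0 => /eqP/nat_inj_F dth; rewrite /G mcoeffB shift_top; last first.
  by apply: supp_in_sub (jnorm_supp pl) => eta ->; rewrite dth.
have ld' : (mdeg lam < d.+1)%N by [].
rewrite (raddf_sum (mcoeff theta)) (bigD1 (BMultinom ld')) //= jbinom_top //.
rewrite eqxx mpolyC1 mul1r big1 ?addr0 ?subrr // => mu /andP[pm ne].
rewrite mcoeffCM; have [->|/(jnorm_supp pm) dm] := eqVneq (jn (val mu))@_theta 0.
  by rewrite mulr0.
have nlm : (lam == val mu) = false.
  by apply/eqP => E; case/eqP: ne; apply: val_inj.
by rewrite jbinom_top -?dm ?dth // nlm mul0r.
Qed.

Lemma jnorm_diag lam mu : is_part lam -> is_part mu -> (jn lam)@_mu != 0 ->
  mu = lam \/ slow mu lam.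
Proof.
move=> pl pm; have [_ _ lp _] := JP pl.
rewrite mcoeffCM mulf_eq0 negb_or => /andP[_] /lp[[s E]|]; last by right.
by left; apply: part_perm_inj => //; apply/mpermP; exists s.
Qed.

(** Among the partitions with nonzero coefficient, choose [nu] with the largest sum of squares: x^nu
    then occurs in no other term. *)
Lemma jnorm_free d (c : 'X_{1..n} -> F) :
  \sum_(mu : 'X_{1..n < d.+1} | is_part (val mu)) (c (val mu))%:MP * jn (val mu) = 0 ->
  forall mu, is_part mu -> (mdeg mu <= d)%N -> c mu = 0.
Proof.
move=> E mu pm dm; apply/eqP/negPn/negP => cm.
have dm' : (mdeg mu < d.+1)%N by [].
pose A (nu : 'X_{1..n < d.+1}) := is_part (val nu) && (c (val nu) != 0).
have A0 : A (BMultinom dm') by rewrite /A /= pm cm.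
case: (arg_maxnP (fun nu : 'X_{1..n < d.+1} => \sum_i val nu i ^ 2)%N A0) => nu /andP[pn cn] nmax.
have := congr1 (mcoeff (val nu)) E; rewrite mcoeff0 (raddf_sum (mcoeff (val nu))).
rewrite (bigD1 nu) //= mcoeffCM big1 ?addr0 => [|ka /andP[pk kn]]; last first.
  rewrite mcoeffCM; have [->|ck] := eqVneq (c (val ka)) 0; first by rewrite mul0r.
  have [->|nz] := eqVneq (jn (val ka))@_(val nu) 0; first by rewrite mulr0.
  have [E2|[_ _ sq]] := jnorm_diag pk pn nz.
    by case/eqP: kn; apply: val_inj.
  have h : (\sum_i val ka i ^ 2 <= \sum_i val nu i ^ 2)%N.
    by apply: nmax; rewrite /A pk ck.
  by rewrite ltnNge h in sq.
have [_ p1 _ _] := JP pn.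
move/eqP; rewrite mulf_eq0 (negbTE cn) mcoeffCM p1 mulr1 invr_eq0.
by rewrite (negbTE (Jack_ev_neq0 k_generic pn (JP pn))).
Qed.
(** The bound in [is_binomial_row] is arbitrary, so the coefficient of x^lam is first used to show
    |lam| <= d; freeness then applies. *)
Lemma binomial_row_uniq d lam (b : 'X_{1..n} -> F) : is_part lam ->
  (forall mu, b mu != 0 -> is_part mu && (mdeg mu <= d)%N) ->
  shift (jn lam) =
    \sum_(mu : 'X_{1..n < d.+1} | is_part (val mu)) (b (val mu))%:MP * jn (val mu) ->
  forall mu, is_part mu -> b mu = jbinom lam mu.
Proof.
move=> pl bs E mu pm.
have ld : (mdeg lam <= d)%N.
  rewrite leqNgt; apply/negP => h; have := congr1 (mcoeff lam) E.
  rewrite shift_top; last by apply: supp_in_sub (jnorm_supp pl) => eta ->.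
  rewrite (raddf_sum (mcoeff lam)) big1 => [|nu pn]; last first.
    rewrite /= mcoeffCM; have [->|/(jnorm_supp pn) dl] := eqVneq (jn (val nu))@_lam 0.
      by rewrite mulr0.
    by have := bmdeg nu; rewrite -dl ltnS leqNgt h.
  have [_ p1 _ _] := JP pl; move/eqP; rewrite mcoeffCM p1 mulr1 invr_eq0.
  by rewrite (negbTE (Jack_ev_neq0 k_generic pl (JP pl))).
have [dm|dm] := leqP (mdeg mu) d; last first.
  have [->|/bs/andP[_]] := eqVneq (b mu) 0; last by rewrite leqNgt dm.
  have lm := leq_trans ld (ltnW dm).
  rewrite jbinom_top //; case: eqVneq => // E2.
  by move: dm; rewrite -E2 ltnNge ld.
apply/eqP; rewrite -subr_eq0; apply/eqP.
apply: (@jnorm_free d (fun nu => b nu - jbinom lam nu)) => //.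
apply/eqP; rewrite -(subr_eq0 _ (0 : {mpoly F[n]})) subr0; apply/eqP.
transitivity (shift (jn lam) - binom_sum d lam).
  rewrite E /binom_sum -sumrB; apply: eq_bigr => nu _.
  by rewrite mpolyCB mulrBl.
by rewrite (shift_jnorm pl ld) subrr.
Qed.

Lemma jbinom_row lam (b : 'X_{1..n} -> F) : is_part lam ->
  (forall mu, is_part mu -> (mdeg mu <= mdeg lam)%N -> b mu = jbinom lam mu) ->
  shift (jn lam) = \sum_(mu : 'X_{1..n < (mdeg lam).+1} | is_part (val mu))
    (b (val mu))%:MP * jn (val mu).
Proof.
move=> pl bE; rewrite (shift_jnorm pl (leqnn _)); apply: eq_bigr => mu pm.
by rewrite bE // -ltnS bmdeg.
Qed.

End Binomials.

(** * Agreement with the given definitions of Jack polynomials and binomials *)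

Section JackExpansion.
Variables (F : fieldType) (n : nat) (k : F).
Implicit Types (p : {mpoly F[n]}) (eta theta lam mu : 'X_{1..n}).

Lemma orbit_sum_part lam mu : is_part lam -> is_part mu ->
  (orbit_sum F lam)@_mu = (mu == lam)%:R.
Proof.
move=> pl pm; rewrite orbit_sum_coeff; congr (nat_of_bool _)%:R.
by apply/idP/eqP => [/part_perm_inj|->]; [apply|apply: perm_refl].
Qed.

(** Both sides are symmetric, so coefficients at partitions suffice, and there [slow] implies
    [dominated]. *)
Lemma Jack_expand lam p : is_part lam -> Jack k lam p ->
  p = orbit_sum F lam + \sum_(mu : 'X_{1..n < (mdeg lam).+1} |
    is_part (val mu) && dominated (val mu) lam) p@_(val mu) *: orbit_sum F (val mu).
Proof.
move=> pl [sp p1 lp _].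
set q := _ + _; have sq : q \is symmetric.
  rewrite rpredD ?orbit_sum_sym // rpred_sum // => mu _.
  by rewrite rpredZ // orbit_sum_sym.
have part_eq mu : is_part mu -> p@_mu = q@_mu.
  move=> pm; rewrite /q mcoeffD orbit_sum_part // (raddf_sum (mcoeff mu)) /=.
  have [->|ml] := eqVneq mu lam.
    rewrite p1 big1 ?addr0 // => nu /andP[pn dn].
    rewrite mcoeffZ orbit_sum_part //; case: eqP => [E|]; last by rewrite mulr0.
    by move: dn; rewrite -E /dominated !eqxx.
  rewrite add0r; have [dm|ndm] := boolP (dominated mu lam).
    have dm' : (mdeg mu < (mdeg lam).+1)%N by case/and3P: dm => /eqP ->.
    rewrite (bigD1 (BMultinom dm')) /= ?pm // mcoeffZ orbit_sum_part // eqxx mulr1.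
    rewrite big1 ?addr0 // => nu /andP[/andP[pn _] ne].
    rewrite mcoeffZ orbit_sum_part //; case: eqP => [E|]; last by rewrite mulr0.
    by case/eqP: ne; apply: val_inj.
  rewrite big1 => [|nu /andP[pn dn]]; last first.
    rewrite mcoeffZ orbit_sum_part //; case: eqP => [E|]; last by rewrite mulr0.
    by move: ndm; rewrite E dn.
  apply/eqP/negPn/negP => /lp[[s E]|sl].
    by case/eqP: ml; apply: part_perm_inj => //; apply/mpermP; exists s.
  by move: ndm; rewrite slow_dominated.
apply/mpolyP => theta; have [s E] := asort_perm theta.
have := part_eq _ (is_part_revm (asort_antidom theta)).
by rewrite /revm !sym_coeff // E !sym_coeff.
Qed.

(** The eigenvalue equation is assumed only under symmetry and homogeneity, because the passage from
    D(alpha) to [cher2] needs both. *)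
Lemma expand_Jack lam p e (v : 'X_{1..n} -> F) : (forall a b c d : nat,
    a%:R + k * b%:R = c%:R + k * d%:R -> a = c /\ b = d) -> is_part lam ->
  p = orbit_sum F lam + \sum_(mu : 'X_{1..n < (mdeg lam).+1} |
    is_part (val mu) && dominated (val mu) lam) v (val mu) *: orbit_sum F (val mu) ->
  (p \is symmetric -> supp_in (fun theta => mdeg theta = mdeg lam) p ->
    cher2 k p = e%:MP * p) ->
  Jack k lam p.
Proof.
move=> k_generic pl pE Hp.
have sp : p \is symmetric.
  rewrite pE rpredD ?orbit_sum_sym // rpred_sum // => mu _.
  by rewrite rpredZ // orbit_sum_sym.
have Sp : supp_in (fun theta => exists mu, [/\ is_part mu, perm_eq theta mu &
     (mu == lam) || dominated mu lam]) p.
  rewrite pE; apply: supp_inD.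
    move=> theta; rewrite orbit_sum_coeff => h; exists lam; rewrite eqxx pl.
    by split=> //; apply: contraNT h => /negbTE ->.
  apply: supp_in_sum => mu /andP[pm dm]; rewrite -mul_mpolyC; apply: supp_inC.
  move=> theta; rewrite orbit_sum_coeff => h; exists (val mu); rewrite dm orbT.
  by split=> //; apply: contraNT h => /negbTE ->.
apply: (Jack_dominated k_generic pl sp _ Sp (Hp sp _)).
  rewrite pE mcoeffD orbit_sum_part // eqxx (raddf_sum (mcoeff lam)) big1 ?addr0 //.
  move=> mu /andP[pm dm]; rewrite /= mcoeffZ orbit_sum_part //.
  case: eqP => [E|]; last by rewrite mulr0.
  have E2 : val mu = lam by exact: esym E.
  by move: dm; rewrite E2 /dominated !eqxx.
apply: supp_in_sub Sp => theta [mu [_ /perm_mdeg -> /orP[/eqP -> //|]]].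
by case/and3P => /eqP.
Qed.
End JackExpansion.

Section JackPolynomials.
Variable m : nat.
Local Notation M := m.+1.
Implicit Types (lam mu : 'X_{1..M}) (p : {mpoly Falpha[M]}).

Lemma euler_mderiv p d : supp_in (fun theta => mdeg theta = d) p ->
  \sum_i 'X_i * p^`M(i) = d%:R%:MP * p.
Proof. exact: euler_homog. Qed.

Lemma is_jack_Jack lam p : is_part lam -> is_jack lam p -> Jack r lam p.
Proof.
move=> pl [[e De] [v pE]].
pose c : Falpha := r ^+ 2 * \sum_(i < M) i%:R ^+ 2.
apply: (expand_Jack (e := 2%:R * r * e + (mdeg lam)%:R + c) r_generic pl pE) => sp Sp.
apply/eqP; rewrite -tofrac_eq Dalpha_cher2 // De -tofracM -tofracD (euler_mderiv Sp).
by rewrite -/c tofrac_eq -mul_mpolyC mulrA -mpolyCM addrA -mulrDl -mulrDl -!mpolyCD.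
Qed.

Lemma Jack_is_jack lam p : is_part lam -> Jack r lam p -> is_jack lam p.
Proof.
move=> pl Jp; split; last by exists (fun mu => p@_mu); apply: Jack_expand Jp.
have [sp _ lp Ep] := Jp.
pose c : Falpha := r ^+ 2 * \sum_(i < M) i%:R ^+ 2.
have Sp : supp_in (fun theta => mdeg theta = mdeg lam) p.
  by apply: supp_in_sub lp => theta /low_mdeg.
have h2 : 2%:R * r != 0 by apply: mulf_neq0; [exact: (charFalpha 1)|exact: r_neq0].
pose e := (2%:R * r)^-1 * (ev2 r (revm lam) - ((mdeg lam)%:R + c)).
have nz : tofrac (2%:R * r)%:MP_[M] != 0 by rewrite tofrac_eq0 mpolyC_eq0.
exists e; apply: (mulfI nz); have := Dalpha_cher2 sp.
rewrite Ep (euler_mderiv Sp) -/c => E.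
have -> : tofrac (2%:R * r)%:MP_[M] * Dalpha p = tofrac ((ev2 r (revm lam))%:MP * p)
    - tofrac ((mdeg lam)%:R%:MP * p + c%:MP * p) by rewrite E addrK.
rewrite -tofracB -tofracM; congr tofrac; rewrite -mul_mpolyC mulrA -mpolyCM.
by rewrite /e mulVKf // mpolyCB mpolyCD !mulrDl mulNr mulrDl.
Qed.

Lemma jack_Jack lam : is_part lam -> Jack r lam (jack lam).
Proof.
move=> pl; have [p Jp] := Jack_exists r_generic pl.
have ex : exists p, is_jack lam p by exists p; apply: Jack_is_jack.
by apply: is_jack_Jack => //; apply: ClassicalEpsilon.epsilon_spec.
Qed.

Lemma jack_normalizedE lam : jack_normalized lam = jnorm (@jack M) lam.
Proof. by rewrite /jack_normalized /jnorm mul_mpolyC. Qed.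

Lemma jack_binomialE lam mu : is_part lam -> is_part mu ->
  jack_binomial lam mu = jbinom r lam mu.
Proof.
move=> pl pm; have JJ := jack_Jack.
have ex : exists b, is_binomial_row lam b.
  (* Cut off outside the partitions of bounded size, as the support condition of [is_binomial_row]
     demands. *)
  pose b nu := if is_part nu && (mdeg nu <= mdeg lam)%N then jbinom r lam nu else 0.
  exists b; exists (mdeg lam); split.
    by move=> nu; rewrite /b; case: ifP => //; rewrite eqxx.
  rewrite jack_normalizedE -/(shift _).
  rewrite (jbinom_row r_generic JJ (b := b) pl) => [|nu pn dn]; last by rewrite /b pn dn.
  by apply: eq_bigr => nu _; rewrite jack_normalizedE mul_mpolyC.
have [d [bs E]] := ClassicalEpsilon.epsilon_spec (inhabits (fun=> 0)) _ ex.
rewrite -/(jack_binomial lam) in bs E.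
apply: (binomial_row_uniq r_generic JJ pl bs) => //.
rewrite jack_normalizedE -/(shift _) in E; rewrite E.
by apply: eq_bigr => nu _; rewrite jack_normalizedE mul_mpolyC.
Qed.

End JackPolynomials.

(** * The recursion for leaves *)

Section LeafSums.
Variables (F : fieldType) (k : F).
Implicit Types (x y w : F) (n m l t : nat).

Definition rising x t := \prod_(0 <= i < t) (x + i%:R).

Lemma rising0 x : rising x 0 = 1.
Proof. by rewrite /rising big_nil. Qed.

Lemma risingSr x t : rising x t.+1 = rising x t * (x + t%:R).
Proof. by rewrite /rising big_nat_recr. Qed.

Lemma risingSl x t : rising x t.+1 = x * rising (x + 1) t.
Proof.
rewrite /rising big_nat_recl //= addr0; congr (_ * _).
by apply: eq_bigr => i _; rewrite -addrA -natr1 [1 + _]addrC.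
Qed.

(** Here w stands for y + u + k. As an independent parameter it lets the recursions shift y and w
    separately. *)
Definition leaf_sum n m y w := \sum_(0 <= l < n.+1) 'C(n, l)%:R *
  (\prod_(0 <= i < l) (((m + i + 1)%:R - k) * (i%:R + k))) *
  (\prod_(l.+1 <= j < n.+1) ((y + n%:R + k - j%:R) * (w + j%:R))).

Definition leaf_term n m y w l := 'C(n, l)%:R *
  (rising (m%:R + 1 - k) l * rising k l) *
  (rising (y + k) (n - l) * rising (w + l%:R + 1) (n - l)).

Lemma leaf_sumE n m y w : leaf_sum n m y w = \sum_(l < n.+1) leaf_term n m y w l.
Proof.
rewrite /leaf_sum big_mkord; apply: eq_bigr => -[l ln] _ /=.
rewrite /leaf_term; congr (_ * _ * _).
  by rewrite /rising -big_split; apply: eq_bigr => i _ /=; rewrite !natrD; ring.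
rewrite big_split /rising; congr (_ * _) => /=.
  rewrite -{1}[l.+1]add0n big_addn subSS big_nat_rev /=; apply: eq_big_nat => i hi.
  have -> : (0 + (n - l) - i.+1 + l.+1 = n - i)%N by lia.
  by rewrite natrB; [ring|lia].
rewrite -{1}[l.+1]add0n big_addn subSS; apply: eq_bigr => i _.
by rewrite natrD -natr1; ring.
Qed.

Lemma bin_mul_succ n l : ('C(n, l.+1)%:R * l.+1%:R : F) = (n%:R - l%:R) * 'C(n, l)%:R.
Proof.
have [ln|nl] := leqP l n.
  by rewrite -natrB // -!natrM; congr (_%:R); rewrite mulnC mul_bin_left.
by rewrite !bin_small ?mulr0n ?mul0r ?mulr0 // ltnW.
Qed.

Lemma bin_pred_mul n l : (n.+1%:R * 'C(n, l)%:R : F) = (n.+1%:R - l%:R) * 'C(n.+1, l)%:R.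
Proof.
have [ln|nl] := leqP l n.+1.
  by rewrite -natrB // -!natrM; congr (_%:R); rewrite mul_bin_down.
by rewrite !bin_small ?mulr0 // ltnW.
Qed.

(* Zeilberger certificate: the summand of the recursion is
   [cert l.+1 - cert l]. *)
Lemma leaf_sum_gap n y w (u := w - y - k) :
  (u + n.+1%:R) * w * leaf_sum n.+1 0 y w =
    u * (w + n.+1%:R) * leaf_sum n.+1 0 y (w - 1)
    + n.+1%:R * (w + k) * (w + 1 - k) * (y + k) * leaf_sum n 0 (y + 1) (w + 1).
Proof.
set N := n.+1; pose cert l := - ('C(N, l)%:R * l%:R *
  (rising (0%:R + 1 - k) l * rising k l) * rising (y + k) (N.+1 - l)
  * rising (w + l%:R + 1) (N - l)).
(* The shorter sum is extended by 0 at l = N, so that all three sums have the same range. *)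
pose tail l := if (l <= n)%N then leaf_term n 0 (y + 1) (w + 1) l else 0.
have step l : (l <= N)%N -> (u + N%:R) * w * leaf_term N 0 y w l
    - u * (w + N%:R) * leaf_term N 0 y (w - 1) l
    - N%:R * (w + k) * (w + 1 - k) * (y + k) * tail l = cert l.+1 - cert l.
  move=> lN; set c : F := 'C(N, l)%:R.
  set a := rising (0%:R + 1 - k) l * rising k l.
  have [ln|nl] := leqP l n; last first.
    have El : l = N by apply/eqP; rewrite eqn_leq lN.
    have E1 : (N - l = 0)%N by lia.
    have E2 : (N.+1 - l = 1)%N by lia.
    have E3 : c = 1 by rewrite /c El binn.
    have E4 : ('C(N, l.+1)%:R : F) = 0 by rewrite El bin_small.
    rewrite /tail leqNgt nl /= /cert /leaf_term E1 E2 E4 -/c E3 -/a.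
    rewrite !rising0 !mul0r [rising (y + k) 1]risingSr rising0 El /u mulr0n addr0.
    by ring.
  have E1 : (N - l = (n - l).+1)%N by rewrite /N; lia.
  have E2 : (N.+1 - l = (n - l).+2)%N by rewrite /N; lia.
  have E3 : (N.+1 - l.+1 = (n - l).+1)%N by rewrite /N; lia.
  have E4 : (N - l.+1 = n - l)%N by rewrite /N; lia.
  have nlE : (n - l)%:R = N%:R - l%:R - 1 :> F by rewrite natrB // /N -natr1; ring.
  set P := rising (y + k) (n - l).+1.
  pose Q := rising (w + l%:R + 1 + 1) (n - l).
  have t1 : leaf_term N 0 y w l = c * a * (P * ((w + l%:R + 1) * Q)).
    by rewrite /leaf_term E1 [rising (w + _ + 1) _]risingSl.
  have t2 : (w + N%:R) * leaf_term N 0 y (w - 1) l =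
      c * a * (P * ((w + l%:R) * ((w + l%:R + 1) * Q))).
    rewrite /leaf_term E1 -/P -/a -/c (_ : w - 1 + l%:R + 1 = w + l%:R); last by ring.
    rewrite [rising (w + l%:R) _]risingSl -[X in _ = _ * (_ * (_ * X))]risingSl risingSr nlE.
    by ring.
  have t3 : N%:R * (y + k) * leaf_term n 0 (y + 1) (w + 1) l =
      (N%:R - l%:R) * c * a * (P * Q).
    rewrite /leaf_term -/a /P [rising (y + k) _]risingSl /Q.
    rewrite (_ : y + 1 + k = y + k + 1); last by ring.
    rewrite (_ : w + 1 + l%:R + 1 = w + l%:R + 1 + 1); last by ring.
    by have := bin_pred_mul n l; rewrite -/N -/c => <-; ring.
  have c1 : cert l.+1 = - ((N%:R - l%:R) * c * (a * ((l%:R + 1 - k) * (k + l%:R))) * P * Q).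
    rewrite /cert E3 E4 -/P (_ : w + l.+1%:R + 1 = w + l%:R + 1 + 1); last by rewrite -natr1; ring.
    by rewrite -/Q bin_mul_succ ![rising _ l.+1]risingSr -/c /a; ring.
  have c0 : cert l = - (c * l%:R * a * (P * (y + k + N%:R - l%:R)) * ((w + l%:R + 1) * Q)).
    rewrite /cert E2 E1 [rising (y + k) _]risingSr -/P [rising (w + _ + 1) _]risingSl -/Q.
    by rewrite -[(n - l).+1%:R]natr1 nlE -/c -/a; ring.
  rewrite /tail ln c1 c0.
  have -> : (u + N%:R) * w * leaf_term N 0 y w l
      - u * (w + N%:R) * leaf_term N 0 y (w - 1) l
      - N%:R * (w + k) * (w + 1 - k) * (y + k) * leaf_term n 0 (y + 1) (w + 1) l =
    (u + N%:R) * w * leaf_term N 0 y w l - u * ((w + N%:R) * leaf_term N 0 y (w - 1) l)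
      - (w + k) * (w + 1 - k) * (N%:R * (y + k) * leaf_term n 0 (y + 1) (w + 1) l).
    by ring.
  by rewrite t1 t2 t3 /u; ring.
have T : \sum_(l < N.+1) tail l = leaf_sum n 0 (y + 1) (w + 1).
  rewrite leaf_sumE big_ord_recr /= /tail ltnn addr0; apply: eq_bigr => l _ /=.
  by rewrite -ltnS ltn_ord.
rewrite -T !leaf_sumE; apply/eqP; rewrite -subr_eq0 opprD addrA !mulr_sumr -!sumrB.
rewrite (eq_bigr (fun l : 'I_N.+1 => cert l.+1 - cert l)) => [|l _]; last first.
  by apply: step; rewrite -ltnS.
rewrite -(big_mkord xpredT (fun l => cert l.+1 - cert l)) telescope_sumr //.
by rewrite /cert bin_small // !mulr0 !mul0r oppr0 subr0.
Qed.

(** Again by a Zeilberger certificate, the summand now being [cert l - cert l.+1]. In the overlap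
    case d' stays fixed: shortening the lower row lowers m, shortening the upper row lowers w. *)
Lemma leaf_sum_overlap n m w (u := w - k) :
  (u + n%:R + m.+1%:R) * (w - m.+1%:R) * leaf_sum n m.+1 0 w =
    (u - m.+1%:R) * (w + n%:R) * leaf_sum n m.+1 0 (w - 1)
    + (n%:R + m.+1%:R) * (w - m.+1%:R + k) * leaf_sum n m 0 w.
Proof.
set m1 := m.+1%:R; have m1E : m1 = m%:R + 1 :> F by rewrite /m1 -natr1.
(* The rising factorial of m1 + 1 - k has length l - 1, hence the split at l = 0, where the
   certificate vanishes. *)
pose cert l := if l is l'.+1 then 'C(n, l)%:R * l%:R *
  (rising (m1 + 1 - k) l' * rising k l) * rising (0 + k) (n.+1 - l)
  * rising (w + l%:R) (n.+1 - l) else 0.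
have step l : (l <= n)%N -> (u + n%:R + m1) * (w - m1) * leaf_term n m.+1 0 w l
    - (u - m1) * (w + n%:R) * leaf_term n m.+1 0 (w - 1) l
    - (n%:R + m1) * (w - m1 + k) * leaf_term n m 0 w l = cert l - cert l.+1.
  move=> ln; set c : F := 'C(n, l)%:R.
  have E2 : (n.+1 - l = (n - l).+1)%N by lia.
  have E3 : (n.+1 - l.+1 = n - l)%N by lia.
  have nlE : (n - l)%:R = n%:R - l%:R :> F by rewrite natrB.
  set K := rising k l; set P := rising (0 + k) (n - l).
  set Q := rising (w + l%:R + 1) (n - l).
  have t2 : (w + n%:R) * rising (w - 1 + l%:R + 1) (n - l) = (w + l%:R) * Q.
    rewrite (_ : w - 1 + l%:R + 1 = w + l%:R); last by ring.
    rewrite -risingSl risingSr nlE; ring.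
  have -> : (u + n%:R + m1) * (w - m1) * leaf_term n m.+1 0 w l
      - (u - m1) * (w + n%:R) * leaf_term n m.+1 0 (w - 1) l
      - (n%:R + m1) * (w - m1 + k) * leaf_term n m 0 w l =
    c * K * P * (((u + n%:R + m1) * (w - m1) * Q
      - (u - m1) * ((w + n%:R) * rising (w - 1 + l%:R + 1) (n - l))) * rising (m1 + 1 - k) l
      - (n%:R + m1) * (w - m1 + k) * Q * rising (m%:R + 1 - k) l).
    by rewrite /leaf_term -/c -/K -/P -/Q -/m1; ring.
  rewrite t2.
  have c1 : cert l.+1 = (n%:R - l%:R) * c * (rising (m1 + 1 - k) l * (K * (k + l%:R))) * P * Q.
    rewrite /cert E3 -/P bin_mul_succ [rising k _]risingSr -/K.
    by rewrite (_ : w + l.+1%:R = w + l%:R + 1) // -natr1; ring.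
  rewrite c1; case: l ln @c E2 E3 nlE @K @P @Q t2 c1 => [|l] ln c E2 E3 nlE K P Q t2 c1.
    by rewrite /cert !rising0 /u; ring.
  have c0 : cert l.+1 = c * l.+1%:R * (rising (m1 + 1 - k) l * K) * (P * (k + n%:R - l.+1%:R))
      * ((w + l.+1%:R) * Q).
    by rewrite /cert E2 [rising (0 + k) _]risingSr -/P [rising (w + _) _]risingSl -/Q nlE
      -/c -/K; ring.
  rewrite c0 [rising (m1 + 1 - k) _]risingSr [rising (m%:R + 1 - k) _]risingSl.
  rewrite (_ : m%:R + 1 - k + 1 = m1 + 1 - k); last by rewrite m1E; ring.
  by rewrite m1E /u -(natr1 l); ring.
rewrite !leaf_sumE; apply/eqP; rewrite -subr_eq0 opprD addrA !mulr_sumr -!sumrB.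
rewrite (eq_bigr (fun l : 'I_n.+1 => - (cert l.+1 - cert l))) => [|l _]; last first.
  by rewrite step ?opprB // -ltnS.
rewrite sumrN -(big_mkord xpredT (fun l => cert l.+1 - cert l)) telescope_sumr //.
by rewrite /cert bin_small // !mul0r subr0 oppr0.
Qed.

End LeafSums.

(** * The coupling of two rows and the recursion in (u, d) *)

Section TwoRowWeights.
Variables (F : fieldType) (k : F).
Hypothesis k_generic : forall a b c d : nat,
  a%:R + k * b%:R = c%:R + k * d%:R -> a = c /\ b = d.
Variables (delta b : nat).
Implicit Types (u d t : nat).

Lemma generic_neq0 (a c : nat) : (0 < a + c)%N -> a%:R + k * c%:R != 0.
Proof.
move=> h; apply/eqP => E; have := @k_generic a c 0 0.
by rewrite mulr0 addr0 E => /(_ erefl)[]; lia.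
Qed.

(** Used with delta = mu_p - mu_q and b the number of rows strictly between p and q; in the gap case
    y = Y0 - d. *)
Definition row_gap : F := delta%:R + k * b%:R.
Local Notation Y0 := row_gap.

(** The part of the stem that is not a product of single-row coefficients: the effect of row q on
    row p, the factorials of u and d, and the boxes of J, which lie in min(d, delta) columns. *)
Definition row_weight u d :=
  (\prod_(t < u) ((Y0 + t.+1%:R) / ((Y0 + t.+1%:R + k) * t.+1%:R)))
  * (\prod_(t < d) t.+1%:R^-1)
  * \prod_(t < minn d delta) ((Y0 - t.+1%:R + k) * (Y0 - t.+1%:R + u%:R + 1))^-1.

(** In the second branch m = d - delta, so that d' = delta. *)
Definition row_leaf u d :=
  if (d <= delta)%N then leaf_sum k d 0 (Y0 - d%:R) (Y0 - d%:R + u%:R + k)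
  else leaf_sum k delta (d - delta) 0 (u%:R + k).

Let char0 := generic_char0 k_generic.

(** The quotient of the two products over t < d telescopes. *)
Lemma row_weight_gap1 u d : (d <= delta)%N ->
  (Y0 - d%:R + u.+1%:R) * row_weight u d =
  u.+1%:R * (Y0 + u.+1%:R + k) * row_weight u.+1 d.
Proof.
move=> dd; rewrite /row_weight big_ord_recr /= (minn_idPl dd).
set A := \prod_(t < u) _; set B := \prod_(t < d) t.+1%:R^-1.
have N1 : Y0 + u.+1%:R != 0.
  rewrite (_ : _ + _ = (delta + u.+1)%:R + k * b%:R); last by rewrite /Y0 natrD; ring.
  by apply: generic_neq0; lia.
have N2 : Y0 + u.+1%:R + k != 0.
  rewrite (_ : _ + k = (delta + u.+1)%:R + k * b.+1%:R); last by rewrite /Y0 natrD -(natr1 b); ring.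
  by apply: generic_neq0; lia.
have N3 := char0 u.
suff E : (Y0 - d%:R + u.+1%:R) *
    \prod_(t < d) ((Y0 - t.+1%:R + k) * (Y0 - t.+1%:R + u%:R + 1))^-1 =
    (Y0 + u.+1%:R) *
    \prod_(t < d) ((Y0 - t.+1%:R + k) * (Y0 - t.+1%:R + u.+1%:R + 1))^-1.
  rewrite mulrCA E.
  set C := \prod_(t < d) ((_ + k) * _)^-1.
  by clearbody A B C; move: (u.+1%:R) N2 N3 => z N2 N3; field; rewrite N2 N3.
clear A B; elim: d dd => [|d IH] dd; first by rewrite !big_ord0 !mulr1; ring.
rewrite !big_ord_recr /=.
have N4 : Y0 - d.+1%:R + u%:R + 1 != 0.
  rewrite (_ : _ + 1 = (delta - d.+1 + u.+1)%:R + k * b%:R); last first.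
    by rewrite /Y0 natrD natrB // -(natr1 u); ring.
  by apply: generic_neq0; lia.
have N5 : Y0 - d%:R + u.+1%:R != 0.
  rewrite (_ : _ + _ = (delta - d + u.+1)%:R + k * b%:R); last first.
    by rewrite /Y0 natrD natrB 1?ltnW //; ring.
  by apply: generic_neq0; lia.
have N6 : Y0 - d.+1%:R + k != 0.
  rewrite (_ : _ + k = (delta - d.+1)%:R + k * b.+1%:R); last first.
    by rewrite /Y0 natrB // -(natr1 b); ring.
  by apply: generic_neq0; lia.
have {}IH := IH (ltnW dd).
rewrite mulrA [RHS]mulrA -IH.
rewrite -[d.+1%:R]natr1 -[u.+1%:R]natr1 in N4 N5 N6 *.
field; rewrite N4 N6 /= andbT.
by apply: contraNneq N5 => <-; apply/eqP; ring.
Qed.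

Lemma row_weight_gap2 u d : (d < delta)%N ->
  row_weight u d =
  d.+1%:R * (Y0 - d.+1%:R + k) * (Y0 - d.+1%:R + u%:R + 1) * row_weight u d.+1.
Proof.
move=> dd; rewrite /row_weight (minn_idPl dd) (minn_idPl (ltnW dd)) !big_ord_recr /=.
set A := \prod_(t < u) _; set B := \prod_(t < d) t.+1%:R^-1.
set C := \prod_(t < d) ((_ + k) * _)^-1.
have N4 : Y0 - d.+1%:R + u%:R + 1 != 0.
  rewrite (_ : _ + 1 = (delta - d.+1 + u.+1)%:R + k * b%:R); last first.
    by rewrite /Y0 natrD natrB // -(natr1 u); ring.
  by apply: generic_neq0; lia.
have N6 : Y0 - d.+1%:R + k != 0.
  rewrite (_ : _ + k = (delta - d.+1)%:R + k * b.+1%:R); last first.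
    by rewrite /Y0 natrB // -(natr1 b); ring.
  by apply: generic_neq0; lia.
have N3 := char0 d.
move: (d.+1%:R) N3 N4 N6 => z N3 N4 N6.
by field; rewrite N3 N4 N6.
Qed.

(** From d = delta on, the part of the weight that depends on u no longer changes with d, so the gap
    relation at d = delta carries over. *)
Lemma row_weight_overlap1 u d : b = 0%N -> (delta <= d)%N ->
  row_weight u d = (delta%:R + u.+1%:R + k) * row_weight u.+1 d.
Proof.
move=> b0 dd; have := row_weight_gap1 u (leqnn delta).
have Y0E : Y0 = delta%:R by rewrite /Y0 b0 mulr0 addr0.
rewrite /row_weight (minn_idPr dd) minnn Y0E subrr add0r.
set D := \prod_(t < delta) t.+1%:R^-1.
set D' := \prod_(t < d) t.+1%:R^-1.
have D0 : D != 0 by apply/prodf_neq0 => i _; rewrite invr_eq0 char0.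
set C := \prod_(t < delta) _; set C' := \prod_(t < delta) _.
set A := \prod_(t < u) _; set A' := \prod_(t < u.+1) _.
rewrite -[in RHS]mulrA => /(mulfI (char0 u)) E; apply: (mulfI D0).
transitivity (D' * (A * D * C)); first by ring.
by rewrite E; ring.
Qed.

Lemma row_weight_overlap2 u d : (delta <= d)%N ->
  row_weight u d = d.+1%:R * row_weight u d.+1.
Proof.
move=> dd; rewrite /row_weight (minn_idPr dd) (minn_idPr (leqW dd)) big_ord_recr /=.
set A := \prod_(t < u) _; set B := \prod_(t < d) t.+1%:R^-1.
have N3 := char0 d; move: (d.+1%:R) N3 => z N3.
by field.
Qed.

Lemma leaf_sum0 m y w : leaf_sum k 0 m y w = 1.
Proof. by rewrite /leaf_sum big_nat1 !big_geq ?bin0 // !mulr1. Qed.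

(** The recursion of the binomials once the single-row coefficients are divided out; the factors Y +
    u, Y + u + k and Y + u + 2k are the interactions in [down_coef_up] and [down_coef_down]. The
    side condition holds when the two rows complete [mu] to a partition ([two_rows_cond]). *)
Lemma row_leaf_rec u d : (0 < u + d)%N ->
  (d <= delta)%N || (b == 0%N) && (d - delta <= u)%N ->
  let Y := Y0 - d%:R in
  (u%:R + d%:R) * (Y + u%:R + k) * (row_weight u d * row_leaf u d) =
    (if u is u'.+1 then (Y + u%:R) * (row_weight u' d * row_leaf u' d) else 0)
    + (if d is d'.+1 then (Y + u%:R + k + k) * (row_weight u d' * row_leaf u d') else 0).
Proof.
move=> ud cond Y; have [dd|dd] := leqP d delta.
  have U : u%:R * (Y + d%:R + u%:R + k) * leaf_sum k d 0 Y (Y + u%:R + k - 1) * row_weight u d =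
      if u is u'.+1 then (Y + u%:R) * (row_weight u' d * row_leaf u' d) else 0.
    case: u {ud cond} => [|u']; first by rewrite !mul0r.
    rewrite [RHS]mulrA row_weight_gap1 // /row_leaf dd -/Y.
    rewrite (_ : Y + u'%:R + k = Y + u'.+1%:R + k - 1); last by rewrite -natr1; ring.
    by rewrite /Y; ring.
  case: d dd @Y cond U ud => [|d'] dd Y cond U ud.
    rewrite addr0 addr0 -U /row_leaf leq0n !leaf_sum0 /Y.
    by ring.
  rewrite -U /row_leaf dd (ltnW dd) (row_weight_gap2 u dd) -/Y.
  have := leaf_sum_gap k d' Y (Y + u%:R + k).
  rewrite (_ : Y + u%:R + k - Y - k = u%:R); last by ring.
  rewrite (_ : Y + u%:R + k + 1 = Y0 - d'%:R + u%:R + k); last by rewrite /Y -natr1; ring.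
  rewrite (_ : Y + 1 = Y0 - d'%:R); last by rewrite /Y -natr1; ring.
  set L0 := leaf_sum k d'.+1 0 Y _; set L1 := leaf_sum k d'.+1 0 Y _.
  set L2 := leaf_sum k d' 0 _ _ => E.
  transitivity (row_weight u d'.+1 * ((u%:R + d'.+1%:R) * (Y + u%:R + k) * L0)); first by ring.
  by rewrite E -/Y /Y -(natr1 d'); ring.
have {cond} [/eqP b0 du] : (b == 0%N) /\ (d - delta <= u)%N.
  by move: cond; rewrite leqNgt dd /= => /andP[].
case: d dd @Y ud du => [//|d'] dd Y ud du; case: u ud du => [|u'] ud du; first by lia.
have [mm dE] : exists mm, d' = (delta + mm)%N by exists (d' - delta)%N; lia.
have YE : Y = - mm.+1%:R.
  by rewrite /Y /Y0 b0 dE -addnS natrD; ring.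
have := leaf_sum_overlap k delta mm (u'.+1%:R + k).
rewrite (_ : u'.+1%:R + k - k = u'.+1%:R); last by ring.
rewrite (_ : u'.+1%:R + k - 1 = u'%:R + k); last by rewrite -natr1; ring.
have -> : row_leaf u'.+1 d'.+1 = leaf_sum k delta mm.+1 0 (u'.+1%:R + k).
  by rewrite /row_leaf leqNgt dd /=; congr leaf_sum; lia.
have -> : row_leaf u' d'.+1 = leaf_sum k delta mm.+1 0 (u'%:R + k).
  by rewrite /row_leaf leqNgt dd /=; congr leaf_sum; lia.
(* For mm = 0 the shortened lower row falls into the gap branch; there y = Y0 - delta = 0, and both
   branches agree. *)
have -> : row_leaf u'.+1 d' = leaf_sum k delta mm 0 (u'.+1%:R + k).
  rewrite /row_leaf; case: leqP => h.
    have m0 : mm = 0%N by lia.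
    by rewrite dE m0 addn0 /Y0 b0 mulr0 addr0 subrr add0r.
  by congr leaf_sum; lia.
rewrite (@row_weight_overlap1 u' d'.+1 b0 (ltnW dd)) (@row_weight_overlap2 u'.+1 d' dd).
set L0 := leaf_sum _ _ _ _ _; set L1 := leaf_sum _ _ _ _ _; set L2 := leaf_sum _ _ _ _ _.
have dF : d'.+1%:R = delta%:R + mm.+1%:R :> F by rewrite dE -addnS natrD.
move=> E.
transitivity (row_weight u'.+1 d'.+1 *
  ((u'.+1%:R + delta%:R + mm.+1%:R) * (u'.+1%:R + k - mm.+1%:R) * L0)).
  by rewrite dF YE; ring.
by rewrite E dF YE; ring.
Qed.

End TwoRowWeights.

(** * Binomial coefficients of one-row and two-row skew diagrams *)

Section TwoRows.
Variables (F : fieldType) (m : nat) (k : F).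
Local Notation n := m.+1.
Implicit Types (lam mu nu : 'X_{1..n}) (i j l s : 'I_n) (u d t : nat).

Hypothesis k_generic : forall a b c d : nat,
  a%:R + k * b%:R = c%:R + k * d%:R -> a = c /\ b = d.

Let char0 := generic_char0 k_generic.

Lemma jbinom_sub lam mu : jbinom k lam mu != 0 -> (mu <= lam)%MM.
Proof.
elim: {lam}(mdeg lam) {-2}lam (erefl (mdeg lam)) => [|e IH] lam le.
  rewrite jbinom_top ?le //; case: (lam =P mu) => [-> _|_]; last by rewrite eqxx.
  by apply/mnm_lepP.
have [h|h] := leqP (mdeg lam) (mdeg mu).
  by rewrite jbinom_top //; case: (lam =P mu) => [-> _|_]; [apply/mnm_lepP | rewrite eqxx].
move=> nz; have := jbinomE k_generic h.
have [|none] := boolP [exists i, removable lam i && (mu <= lam - U_(i))%MM].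
  case/existsP => i /andP[_ /mnm_lepP mi] _; apply/mnm_lepP => j.
  by apply: leq_trans (mi j) _; rewrite mnmBE leq_subr.
rewrite big1 => [/eqP|i ri].
  rewrite mulf_eq0 (negbTE nz) orbF.
  have -> : (mdeg lam - mdeg mu = (mdeg lam - mdeg mu).-1.+1)%N by lia.
  by rewrite (negbTE (char0 _)).
have [->|nzi] := eqVneq (jbinom k (lam - U_(i))%MM mu) 0; first by rewrite mulr0.
case/negP: none; apply/existsP; exists i; rewrite ri IH //.
by have := mdeg_removable ri; rewrite le => -[].
Qed.

Lemma jbinom_rec lam mu : (mdeg mu < mdeg lam)%N -> (mu <= lam)%MM ->
  (mdeg lam - mdeg mu)%:R * jbinom k lam mu =
  \sum_(i | (mu i < lam i)%N) (is_part (lam - U_(i))%MM)%:R *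
     (down_coef k lam i * jbinom k (lam - U_(i))%MM mu).
Proof.
move=> h /mnm_lepP sub; rewrite jbinomE // [RHS]big_mkcond [LHS]big_mkcond.
apply: eq_bigr => i _; rewrite /removable; case: ifP => [/andP[l0 ->]|].
  case: ifP; rewrite ?mul1r // => /negbT; rewrite -leqNgt => li.
  have [->|/jbinom_sub/mnm_lepP/(_ i)] := eqVneq (jbinom k (lam - U_(i))%MM mu) 0.
    by rewrite mulr0.
  by rewrite mnmBE mnm1E eqxx; have := sub i; lia.
move=> nr; case: ifP => // mi; case: (boolP (is_part _)) nr => [_|_ _]; last by rewrite mul0r.
by rewrite (leq_ltn_trans (leq0n _) mi).
Qed.

(** The part of [down_coef] for a row [s] of length mu_s + t that comes from the rows in [A], each
    with its length in [mu]. *)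
Definition row_coef (A : pred 'I_n) mu s t := (row_content k mu s + t%:R) *
  \prod_(l | A l) ((row_content k mu s + t%:R - row_content k mu l - k) /
                   (row_content k mu s + t%:R - row_content k mu l)).

Lemma row_contentB lam i l : row_content k lam i - row_content k lam l =
  (lam i)%:R - (lam l)%:R + k * (l%:R - i%:R).
Proof.
rewrite /row_content /= !subSS !natrB -1?ltnS //; ring.
Qed.

Section OneRow.
Variables (mu : 'X_{1..n}) (s : 'I_n).
Hypothesis pmu : is_part mu.
Local Notation lam t := (mu + U_(s) *+ t)%MM.

Lemma one_rowE t i : lam t i = (mu i + (s == i) * t)%N.
Proof. by rewrite mnmDE mulmnE mnm1E. Qed.

Lemma jbinom_one_row t : is_part (lam t) ->
  jbinom k (lam t) mu = \prod_(e < t) (row_coef (predC1 s) mu s e.+1 / e.+1%:R).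
Proof.
elim: t => [|t IH] pt.
  by rewrite mulm0n addm0 jbinom_top // eqxx big_ord0.
have pt' : is_part (lam t).
  apply/is_partP => i j ij; have /is_partP/(_ i j ij) := pt; have /is_partP/(_ i j ij) := pmu.
  by rewrite !one_rowE; case: (s =P i); case: (s =P j) => //; lia.
have lamB : (lam t.+1 - U_(s))%MM = lam t.
  by apply/mnmP => i; rewrite mnmBE !one_rowE mnm1E; case: eqP; lia.
have dl : mdeg (lam t.+1) = (mdeg mu + t.+1)%N by rewrite mdegD mdegMn mdeg1 mul1n.
have := @jbinom_rec (lam t.+1) mu; rewrite dl addKn => /(_ _ _) E.
have {E} E : t.+1%:R * jbinom k (lam t.+1) mu = down_coef k (lam t.+1) s * jbinom k (lam t) mu.
  rewrite E; last first.
  - by apply/mnm_lepP => i; rewrite one_rowE leq_addr.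
  - by lia.
  rewrite (big_pred1 s) ?lamB ?pt' ?mul1r // => i /=.
  by rewrite one_rowE eq_sym; case: eqP; lia.
rewrite big_ord_recr -IH //=; apply: (mulfI (char0 t)); rewrite E.
have -> : down_coef k (lam t.+1) s = row_coef (predC1 s) mu s t.+1.
  have cs : row_content k (lam t.+1) s = row_content k mu s + t.+1%:R.
    by rewrite /row_content one_rowE eqxx mul1n natrD; ring.
  rewrite /down_coef /row_coef cs; congr (_ * _); apply: eq_bigr => l ls.
  rewrite (_ : row_content k (lam t.+1) l = row_content k mu l) //.
  by rewrite /row_content one_rowE eq_sym (negbTE ls) mul0n addn0.
by rewrite [RHS]mulrCA [t.+1%:R * _]mulrC divfK ?char0 // mulrC.
Qed.

End OneRow.

Variables (mu : 'X_{1..n}) (p q : 'I_n).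
Hypotheses (pmu : is_part mu) (pq : (p < q)%N).

Definition two_rows u d := (mu + U_(p) *+ u + U_(q) *+ d)%MM.
Local Notation lam := two_rows.
Local Notation delta := (mu p - mu q)%N.
Local Notation b := (q - p.+1)%N.
Local Notation Y0 := (row_gap k delta b).
Let A l := (l != p) && (l != q).

Lemma two_rowsE u d i : lam u d i = (mu i + (p == i) * u + (q == i) * d)%N.
Proof. by rewrite !mnmDE !mulmnE !mnm1E. Qed.

Let pqF : (p == q) = false.
Proof. by apply/eqP => E; have := pq; rewrite E ltnn. Qed.

Lemma two_rows_dn u d : is_part (lam u d.+1) -> is_part (lam u d).
Proof.
move=> pt; apply/is_partP => i j ij; have /is_partP/(_ i j ij) := pt.
have /is_partP/(_ i j ij) := pmu; rewrite !two_rowsE.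
case: (p =P i) => [pi|_]; case: (q =P i) => [qi|_];
  case: (p =P j) => [pj|_]; case: (q =P j) => [qj|_]; try lia.
by have := pq; rewrite pj qi; lia.
Qed.

(** If d > delta, row q is longer than row p of [mu]; an unmoved row between them would be too
    short. *)
Lemma two_rows_cond u d : is_part (lam u d) ->
  (d <= delta)%N || (b == 0%N) && (d - delta <= u)%N.
Proof.
move=> pt; case: leqP => //= dd.
have pq' := ltnW pq; have mpq : (mu q <= mu p)%N by have /is_partP := pmu; apply.
have h : (mu q + d <= mu p + u)%N.
  have /is_partP/(_ p q pq') := pt; rewrite !two_rowsE !eqxx pqF eq_sym pqF; lia.
apply/andP; split; last by lia.
rewrite subn_eq0 leqNgt; apply/negP => pq1.
have hi : (p.+1 < n)%N by apply: ltn_trans (ltn_ord q).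
have h1 : (Ordinal hi <= q)%N by apply: ltnW.
have h2 : (p <= Ordinal hi)%N by apply: leqnSn.
have /is_partP/(_ _ _ h1) := pt; have /is_partP/(_ _ _ h2) := pmu.
rewrite !two_rowsE eqxx pqF.
have -> : (p == Ordinal hi) = false by apply/eqP => /(congr1 val) /=; lia.
have -> : (q == Ordinal hi) = false by apply/eqP => /(congr1 val) /=; lia.
by lia.
Qed.

(** Removing a box from row p fails only when p and q are adjacent rows of equal length, which is
    where the excluded factor vanishes. *)
Lemma two_rows_up u d : is_part (lam u.+1 d) -> Y0 - d%:R + u.+1%:R != 0 ->
  is_part (lam u d).
Proof.
move=> pt nz; have cond := two_rows_cond pt.
have mpq : (mu q <= mu p)%N by have /is_partP := pmu; apply; apply: ltnW.
apply/is_partP => i j ij; have /is_partP/(_ i j ij) := pt.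
have /is_partP/(_ i j ij) := pmu; rewrite !two_rowsE.
case: (p =P i) => [pi|_]; case: (q =P i) => [qi|_];
  case: (p =P j) => [pj|_]; case: (q =P j) => [qj|_]; try lia.
move=> _; rewrite -pi -qj => h; case: (ltngtP (mu q + d) (mu p + u.+1)) => h'; try lia.
case/orP: cond => [dd|/andP[/eqP b0 _]]; first by lia.
case/negP: nz; rewrite /row_gap b0 mulr0 addr0; apply/eqP.
have : (mu q)%:R + d%:R = (mu p)%:R + u.+1%:R :> F by rewrite -!natrD h'.
by rewrite natrB // => E; rewrite -[LHS](addrK (mu q)%:R) -[X in X - _]addrA; 
  transitivity ((mu p)%:R + u.+1%:R - ((mu q)%:R + d%:R) : F); [ring | rewrite E subrr].
Qed.

Let mpq : (mu q <= mu p)%N.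
Proof. by have /is_partP := pmu; apply; apply: ltnW. Qed.

Lemma two_rows_gap u d : row_content k (lam u d) p - row_content k (lam u d) q =
  Y0 - d%:R + u%:R + k.
Proof.
rewrite row_contentB !two_rowsE !eqxx pqF eq_sym pqF /row_gap !natrB // -natr1 !natrD.
by rewrite !mul0n; ring.
Qed.

Lemma two_rows_gap_neq0 u d : is_part (lam u d) -> Y0 - d%:R + u%:R + k != 0.
Proof.
move=> /two_rows_cond cond; rewrite (_ : _ + k = (delta + u - d)%:R + k * b.+1%:R).
  by apply: generic_neq0 => //; rewrite addnS.
by rewrite /row_gap [(delta + u - d)%:R]natrB; [rewrite natrD -(natr1 b); ring | lia].
Qed.

Lemma down_coef_up u d : is_part (lam u d) ->
  down_coef k (lam u d) p = row_coef A mu p u * ((Y0 - d%:R + u%:R) / (Y0 - d%:R + u%:R + k)).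
Proof.
move=> pt; rewrite /down_coef (bigD1 q) 1?eq_sym ?pqF //= two_rows_gap.
rewrite (_ : _ + k - k = Y0 - d%:R + u%:R); last by ring.
rewrite /row_coef; set P1 := \prod_(l | _) _; set P2 := \prod_(l | _) _.
have -> : P1 = P2.
  apply: eq_bigr => l /andP[lp lq].
  rewrite /row_content !two_rowsE eqxx eq_sym pqF eq_sym (negbTE lp) eq_sym (negbTE lq).
  by rewrite !mul1n !mul0n !addn0 !natrD; congr (_ / _); ring.
rewrite (_ : row_content k (lam u d) p = row_content k mu p + u%:R); first by ring.
by rewrite /row_content two_rowsE eqxx eq_sym pqF mul1n mul0n addn0 natrD; ring.
Qed.

Lemma down_coef_down u d : is_part (lam u d) ->
  down_coef k (lam u d) q =
    row_coef A mu q d * ((Y0 - d%:R + u%:R + k + k) / (Y0 - d%:R + u%:R + k)).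
Proof.
move=> pt; rewrite /down_coef (bigD1 p) ?pqF //=.
rewrite -[row_content _ _ q - row_content _ _ p]opprB two_rows_gap.
rewrite -opprD invrN mulrNN.
rewrite /row_coef; set P1 := \prod_(l | _) _; set P2 := \prod_(l | _) _.
have -> : P1 = P2.
  apply: eq_big => l; first by rewrite andbC.
  case/andP => lq lp.
  rewrite /row_content !two_rowsE eqxx pqF [p == l]eq_sym [q == l]eq_sym.
  by rewrite (negbTE lp) (negbTE lq) !mul1n !mul0n !addn0 !natrD; congr (_ / _); ring.
rewrite (_ : row_content k (lam u d) q = row_content k mu q + d%:R); first by ring.
by rewrite /row_content two_rowsE eqxx pqF mul1n mul0n addn0 natrD; ring.
Qed.

(** Induction on u + d: the products absorb the single-row coefficients of the recursion, and
    [row_leaf_rec] accounts for the rest. *)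
Lemma jbinom_two_rows u d : is_part (lam u d) ->
  jbinom k (lam u d) mu =
    (\prod_(t < u) row_coef A mu p t.+1) * (\prod_(t < d) row_coef A mu q t.+1)
    * (row_weight k delta b u d * row_leaf k delta b u d).
Proof.
have [e] := ubnP (u + d); elim: e u d => // e IH u d le pt.
have [ud0|ud0] := posnP (u + d)%N.
  have [-> ->] : u = 0%N /\ d = 0%N by lia.
  rewrite /two_rows !mulm0n !addm0 jbinom_top // eqxx !big_ord0 !mul1r.
  by rewrite /row_leaf leq0n leaf_sum0 /row_weight min0n !big_ord0 !mulr1.
have dl : mdeg (lam u d) = (mdeg mu + (u + d))%N.
  by rewrite !mdegD !mdegMn !mdeg1 !mul1n addnA.
have Bp u' : (lam u'.+1 d - U_(p))%MM = lam u' d.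
  by apply/mnmP => i; rewrite mnmBE !two_rowsE mnm1E; case: eqP; lia.
have Bq d' : (lam u d'.+1 - U_(q))%MM = lam u d'.
  by apply/mnmP => i; rewrite mnmBE !two_rowsE mnm1E; case: (q =P i); lia.
have E : (u%:R + d%:R) * jbinom k (lam u d) mu =
   (if u is u'.+1 then
      (is_part (lam u' d))%:R * (down_coef k (lam u d) p * jbinom k (lam u' d) mu)
    else 0)
   + (if d is d'.+1 then down_coef k (lam u d) q * jbinom k (lam u d') mu else 0).
  have := @jbinom_rec (lam u d) mu; rewrite dl addKn natrD => -> //; last first.
  - by apply/mnm_lepP => i; rewrite two_rowsE -addnA leq_addr.
  - by lia.
  rewrite big_mkcond (bigD1 p) //= (bigD1 q) 1?eq_sym ?pqF //= big1 ?addr0; last first.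
    move=> i /andP[ip iq]; rewrite two_rowsE eq_sym (negbTE ip) eq_sym (negbTE iq).
    by rewrite !mul0n !addn0 ltnn.
  rewrite !two_rowsE !eqxx pqF [q == p]eq_sym pqF !mul0n !mul1n !addn0; congr (_ + _).
    by case: u {le pt ud0 dl} Bp Bq => [|u'] Bp Bq; 
      rewrite ?addn0 ?ltnn // Bp -{1}[mu p]addn0 ltn_add2l.
  case: d {le ud0 dl} pt Bp Bq => [|d'] pt Bp Bq; rewrite ?addn0 ?ltnn //.
  by rewrite Bq -{1}[mu q]addn0 ltn_add2l (two_rows_dn pt) mul1r.
have nz := two_rows_gap_neq0 pt.
have nud : u%:R + d%:R != 0 :> F by rewrite -natrD -(prednK ud0) char0.
apply: (mulfI nud); rewrite E; apply: (mulIf nz).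
have := row_leaf_rec k_generic ud0 (two_rows_cond pt).
set Y := Y0 - d%:R => /= R.
set X := \prod_(t < u) _; set Z := \prod_(t < d) _.
rewrite [RHS](_ : _ = X * Z * ((u%:R + d%:R) * (Y + u%:R + k) *
  (row_weight k delta b u d * row_leaf k delta b u d))); last by ring.
rewrite R [LHS]mulrDl [RHS]mulrDr {R E}; congr (_ + _).
  rewrite {}/X {}/Z; case: u le pt ud0 dl Bp Bq nz nud => [|u'] le pt ud0 dl Bp Bq nz nud.
    by rewrite mul0r mulr0.
  (* If the smaller diagram is not a partition, then its coefficient is 0 on both sides. *)
  have [Y00|nY] := eqVneq (Y + u'.+1%:R) 0.
    by rewrite down_coef_up // -/Y Y00 !(mul0r, mulr0).
  have pt' := two_rows_up pt nY; rewrite pt' mul1r IH //.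
  rewrite down_coef_up // -/Y big_ord_recr /=.
  set X := \prod_(t < u') _; set Z := \prod_(t < d) _.
  set RW := row_weight _ _ _ _ _ * _; move: (Y + u'.+1%:R) nz => y nz.
  by field.
rewrite {}/X {}/Z; case: d le pt ud0 dl Bp Bq @Y nz nud => [|d'] le pt ud0 dl Bp Bq Y nz nud.
  by rewrite mul0r mulr0.
rewrite IH //; [|by lia|exact: two_rows_dn pt].
rewrite down_coef_down // -/Y big_ord_recr /=.
set X := \prod_(t < u) _; set Z := \prod_(t < d') _.
set RW := row_weight _ _ _ _ _ * _; move: (Y + u%:R) nz => y nz.
by field.
Qed.

End TwoRows.

(** * Stems *)

Section ColumnLengths.
Variable n : nat.
Implicit Types (lam mu nu : 'X_{1..n}) (i l s : 'I_n).

Lemma card_ord_lt (a : nat) : (a <= n)%N -> #|[set l : 'I_n | (l < a)%N]| = a.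
Proof.
by move=> an; rewrite -sum1dep_card -(big_ord_widen n (fun=> 1%N)) // sum1_card card_ord.
Qed.

Lemma colen_gt nu i j : is_part nu -> (i < colen nu j)%N = (j < nu i)%N.
Proof.
move=> /is_partP pn; rewrite /colen; have [h|h] := ltnP j (nu i).
  rewrite -[in leqLHS](card_ord_lt (ltn_ord i)).
  by apply/subset_leq_card/subsetP => l; rewrite !inE => /pn; apply: leq_trans.
apply/negbTE; rewrite -leqNgt -[leqRHS](card_ord_lt (ltnW (ltn_ord i))).
apply/subset_leq_card/subsetP => l; rewrite !inE => jl.
by rewrite ltnNge; apply/negP => /pn; lia.
Qed.

Lemma colen_le nu j : (colen nu j <= n)%N.
Proof. by rewrite /colen; apply: leq_trans (max_card _) _; rewrite card_ord. Qed.

Lemma colen_gt_nth nu (l : nat) j : is_part nu -> (l < colen nu j)%N = (j < nth 0 nu l)%N.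
Proof.
move=> pn; have [h|h] := ltnP l n.
  by have := colen_gt (Ordinal h) j pn; rewrite (mnm_nth 0%N).
rewrite nth_default ?size_tuple // ltn0; apply/negbTE; rewrite -leqNgt.
exact: leq_trans (colen_le _ _) h.
Qed.

Lemma colen_mono lam mu j : (mu <= lam)%MM -> (colen mu j <= colen lam j)%N.
Proof.
move=> /mnm_lepP h; apply/subset_leq_card/subsetP => l; rewrite !inE => jl.
exact: leq_trans jl (h l).
Qed.

Lemma prod_column (F : fieldType) lam mu j (f : nat -> F) :
  is_part lam -> is_part mu ->
  \prod_(colen mu j <= s < colen lam j) f s =
  \prod_(s < n | (mu s <= j < lam s)%N) f s.
Proof.
move=> pl pm; rewrite (big_nat_widen _ _ n _ _ (colen_le _ _)).
rewrite (big_nat_widenl _ 0) // big_mkord; apply: eq_bigl => s.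
by rewrite colen_gt // [(colen _ _ <= s)%N]leqNgt colen_gt // -leqNgt andbC.
Qed.

Lemma prod_diagram (F : fieldType) lam mu (fC fR fJ : box n -> F) :
  (mu <= lam)%MM ->
  (\prod_(s <- boxesC lam mu) fC s) * (\prod_(s <- boxesR lam mu) fR s)
  * (\prod_(s <- boxesJ lam mu) fJ s) =
  \prod_(i < n) \prod_(0 <= j < mu i)
    (if (mu i < lam i)%N then
       if colen mu j == colen lam j then fR (i, j) else fJ (i, j)
     else if colen mu j == colen lam j then 1 else fC (i, j)).
Proof.
move=> sub; rewrite /boxesC /boxesR /boxesJ !big_filter.
rewrite big_mkcond [X in _ * X * _]big_mkcond [X in _ * _ * X]big_mkcond -!big_split /=.
rewrite /diagram big_allpairs_dep big_enum /=; apply: eq_bigr => i _.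
rewrite /index_iota subn0; apply: eq_bigr => j _ /=.
have /mnm_lepP/(_ i) := sub; rewrite leq_eqVlt; have := colen_mono j sub; rewrite leq_eqVlt.
case: (ltngtP (colen mu j) (colen lam j)) => // _ _;
  case: (ltngtP (mu i) (lam i)) => // _ _; by rewrite ?mul1r ?mulr1.
Qed.

End ColumnLengths.

(** * Telescoping of hook ratios *)

Section Hooks.
Variables (F : fieldType) (m : nat) (k : F).
Local Notation n := m.+1.
Implicit Types (lam mu nu : 'X_{1..n}) (i l s : 'I_n).

Hypothesis k_generic : forall a b c d : nat,
  a%:R + k * b%:R = c%:R + k * d%:R -> a = c /\ b = d.

Lemma generic_diff_neq0 (a b c d : nat) : (b <= a)%N -> (d <= c)%N ->
  (b < a)%N || (d < c)%N -> a%:R - b%:R + k * (c%:R - d%:R) != 0.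
Proof. by move=> ba dc h; rewrite -!natrB //; apply: generic_neq0 => //; lia. Qed.

Lemma prod_telescope (a b : nat) (f : nat -> F) : (a <= b)%N ->
  (forall c, (a <= c <= b)%N -> f c != 0) ->
  \prod_(a <= c < b) (f c.+1 / f c) = f b / f a.
Proof.
move=> ab f0; have [ab'|ba] := ltnP a b; last first.
  have E : a = b by apply/eqP; rewrite eqn_leq ab.
  by rewrite big_geq // E divff // f0 // E leqnn.
rewrite (telescope_prodf (f := f)) // => c /andP[ac cb].
by apply: f0; rewrite (ltnW ac) (ltnW cb).
Qed.

Lemma nth_part mu (a b : nat) : is_part mu -> (a <= b)%N -> (nth 0 mu b <= nth 0 mu a)%N.
Proof.
move=> pm ab; rewrite leqNgt; apply/negP; rewrite -colen_gt_nth // => h.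
by have := leq_ltn_trans ab h; rewrite colen_gt_nth // ltnn.
Qed.

Definition hook_low lam i (j : nat) : F :=
  (lam i - j.+1)%:R + k * (colen lam j - i.+1)%:R + k.

Definition hook_up lam i (j : nat) : F :=
  (lam i - j.+1)%:R + k * (colen lam j - i.+1)%:R + 1.

Lemma hook_lowE lam i (j : nat) : is_part lam -> (j < lam i)%N ->
  hook_low lam i j = (lam i)%:R - j.+1%:R + k * ((colen lam j)%:R - i%:R).
Proof.
move=> pl jl; rewrite /hook_low !natrB ?colen_gt // -(natr1 i); ring.
Qed.

Lemma hook_upE lam i (j : nat) : is_part lam -> (j < lam i)%N ->
  hook_up lam i j = (lam i)%:R - j%:R + k * ((colen lam j)%:R - i.+1%:R).
Proof.
move=> pl jl; rewrite /hook_up !natrB ?colen_gt // -(natr1 j); ring.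
Qed.

(** Downward induction on [r], starting from the empty row r = n: the columns between mu_{r+1} and
    mu_r all have length r + 1, so their factors telescope to a single ratio. *)
Lemma column_telescope mu s (X r : nat) : is_part mu -> (mu s < X)%N -> (s <= r <= n)%N ->
  \prod_(0 <= j < nth 0%N mu r)
     ((X%:R - j%:R + k * ((colen mu j)%:R - s.+1%:R)) /
      (X%:R - j.+1%:R + k * ((colen mu j)%:R - s.+1%:R))) =
  (X%:R + k * (n%:R - s%:R)) / (X%:R - (nth 0%N mu r)%:R + k * (r%:R - s%:R)) *
  \prod_(r.+1 <= l < n.+1)
     ((X%:R - (nth 0%N mu l)%:R + k * (l%:R - s.+1%:R)) /
      (X%:R - (nth 0%N mu l)%:R + k * (l%:R - s%:R))).
Proof.
move=> pm sX; have [e] := ubnP (n - r); elim: e r => // e IH r le /andP[sr rn].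
have sN a : (s <= a)%N -> (nth 0 mu a < X)%N.
  by move=> /(nth_part pm) h; apply: leq_ltn_trans h _; rewrite -mnm_nth.
case: (ltngtP r n) rn => // [rn _|-> _]; last first.
  rewrite nth_default ?size_tuple // !big_geq // mulr1 subr0 divff //.
  have := @generic_diff_neq0 X 0 n s; rewrite subr0; apply => //.
    exact: ltnW (ltn_ord s).
  by lia.
have Nr := nth_part pm (leqnSn r).
have sr1 : (s <= r.+1 <= n)%N by rewrite leqW.
rewrite (@big_cat_nat _ _ _ (nth 0%N mu r.+1)) //= IH //; last by lia.
pose h (j : nat) : F := X%:R - j%:R + k * (r%:R - s%:R).
have h0 (j : nat) : (j <= nth 0 mu r)%N -> h j != 0.
  move=> jr; have jX := leq_ltn_trans jr (sN _ sr).
  by apply: generic_diff_neq0 => //; [exact: ltnW | rewrite jX].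
have -> : \prod_(nth 0%N mu r.+1 <= j < nth 0%N mu r)
     ((X%:R - j%:R + k * ((colen mu j)%:R - s.+1%:R)) /
      (X%:R - j.+1%:R + k * ((colen mu j)%:R - s.+1%:R))) = h (nth 0%N mu r.+1) / h (nth 0%N mu r).
  rewrite (@eq_big_nat _ _ _ _ _ _ (fun j => (h j.+1)^-1 / (h j)^-1)); last first.
    move=> j /andP[j1 j2]; rewrite invrK [RHS]mulrC.
    have -> : colen mu j = r.+1.
      apply/eqP; rewrite eqn_leq colen_gt_nth // j2 andbT.
      by rewrite leqNgt colen_gt_nth // -leqNgt.
    by rewrite /h -(natr1 s) -(natr1 r); congr (_ / _); ring.
  rewrite (prod_telescope (f := fun j => (h j)^-1)) //; first by rewrite invrK mulrC.
  by move=> j /andP[_ j2]; rewrite invr_eq0 h0.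
rewrite [in RHS]big_ltn // /h.
have -> : k * (r.+1%:R - s.+1%:R) = k * (r%:R - s%:R) by rewrite -(natr1 s) -(natr1 r); ring.
set P := \prod_(r.+2 <= l < n.+1) _; set D := (_ + k * (r.+1%:R - s%:R))^-1.
by rewrite mulrACA -!mulrA; congr (_ * _); rewrite mulrCA [in RHS]mulrCA; congr (_ * _); ring.
Qed.

Definition shift_ratio mu s (t : nat) l : F :=
  (row_content k mu s + t%:R - row_content k mu l - k) /
  (row_content k mu s + t%:R - row_content k mu l).

Lemma shift_ratioE mu s t l : shift_ratio mu s t l =
  ((mu s + t)%:R - (mu l)%:R + k * (l%:R - s.+1%:R)) /
  ((mu s + t)%:R - (mu l)%:R + k * (l%:R - s%:R)).
Proof.
have E : row_content k mu s + t%:R - row_content k mu l =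
    (mu s + t)%:R - (mu l)%:R + k * (l%:R - s%:R).
  by rewrite addrAC row_contentB natrD; ring.
by rewrite /shift_ratio E -(natr1 s); congr (_ / _); ring.
Qed.

Lemma row_telescope mu s t : is_part mu -> (0 < t)%N ->
  \prod_(0 <= j < mu s)
     (((mu s + t)%:R - j%:R + k * ((colen mu j)%:R - s.+1%:R)) /
      ((mu s + t)%:R - j.+1%:R + k * ((colen mu j)%:R - s.+1%:R))) =
  (row_content k mu s + t%:R) / t%:R * \prod_(l : 'I_n | (s < l)%N) shift_ratio mu s t l.
Proof.
move=> pm t0; have sn := ltn_ord s.
have := @column_telescope mu s (mu s + t) s pm; rewrite -mnm_nth => ->; last 2 first.
- by lia.
- by rewrite leqnn ltnW.
(* The index l = n, an empty row below the diagram, supplies the numerator [row_content] + t. *)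
rewrite big_nat_recr //= nth_default ?size_tuple // subr0.
have -> : \prod_(s.+1 <= l < n)
     (((mu s + t)%:R - (nth 0%N mu l)%:R + k * (l%:R - s.+1%:R)) /
      ((mu s + t)%:R - (nth 0%N mu l)%:R + k * (l%:R - s%:R))) =
    \prod_(l : 'I_n | (s < l)%N) shift_ratio mu s t l.
  rewrite (big_nat_widenl _ 0) // big_mkord; apply: eq_bigr => l _.
  by rewrite shift_ratioE (mnm_nth 0%N mu l).
set P := \prod_(l : 'I_n | _) _.
have nz : (mu s + t)%:R + k * (n%:R - s%:R) != 0.
  have := @generic_diff_neq0 (mu s + t) 0 n s; rewrite subr0; apply => //; first exact: ltnW.
  by rewrite sn orbT.
have t0F : t%:R != 0 :> F by rewrite -(prednK t0) (generic_char0 k_generic).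
have -> : row_content k mu s + t%:R = (mu s + t)%:R + k * (n%:R - s.+1%:R).
  by rewrite /row_content /= subSS natrB -1?ltnS // natrD -(natr1 m) -(natr1 s); ring.
rewrite (_ : (mu s + t)%:R - (mu s)%:R + k * (s%:R - s%:R) = t%:R); last by rewrite natrD; ring.
move: (_ + _ * (n%:R - s%:R)) nz => x nz; move: (_ + _ * _) => y.
by field; rewrite nz t0F.
Qed.

Lemma part_skew lam mu i s : is_part lam -> is_part mu -> lam i = mu i ->
  ((i < s)%N -> (lam s <= mu i)%N) /\ ((s <= i)%N -> (mu i <= mu s)%N).
Proof.
move=> /is_partP pl /is_partP pm E; split=> h; last exact: pm.
by rewrite -E; apply: pl; apply: ltnW.
Qed.

(** Each box of the skew diagram in a column below row [i] lengthens the leg by 1 and contributes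
    the ratio [G j s]; exchanging the products groups these boxes by rows. *)
Lemma fixed_row lam mu i : is_part lam -> is_part mu -> (mu <= lam)%MM -> lam i = mu i ->
  \prod_(0 <= j < mu i) (if colen mu j == colen lam j then 1
                         else hook_low lam i j / hook_low mu i j) =
  \prod_(s : 'I_n | (i < s)%N) \prod_(t < lam s - mu s) shift_ratio mu s t.+1 i.
Proof.
move=> pl pm sub E.
pose f (j c : nat) : F := (mu i)%:R - j.+1%:R + k * (c%:R - i%:R).
pose G (j s : nat) := f j s.+1 / f j s.
transitivity (\prod_(0 <= j < mu i) \prod_(s < n | (mu s <= j < lam s)%N) G j s).
  apply: eq_big_nat => j /andP[_ ji].
  have cj := colen_mono j sub; have ic : (i < colen mu j)%N by rewrite colen_gt.
  have f0 c : (colen mu j <= c <= colen lam j)%N -> f j c != 0.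
    by move=> /andP[h _]; apply: generic_diff_neq0 => //; lia.
  rewrite -(@prod_column n F lam mu j (G j)) // (prod_telescope (f := f j)) //.
  rewrite !hook_lowE ?E // -/(f j (colen lam j)) -/(f j (colen mu j)).
  by case: eqP => // <-; rewrite divff // f0 // leqnn.
rewrite [LHS](exchange_big_dep xpredT) //= [RHS]big_mkcond; apply: eq_bigr => s _.
have [h1 h2] := part_skew s pl pm E; case: ltnP => [is1|si]; last first.
  rewrite big_nat_cond big1 // => j /andP[/andP[_ j1] /andP[j2 _]].
  by have := h2 si; lia.
have {h1 h2} ls := h1 is1.
transitivity (\prod_(mu s <= j < lam s) G j s).
  rewrite [RHS](big_nat_widen _ _ _ _ _ ls) [RHS](big_nat_widenl _ 0) //.
  by apply: eq_bigl => j; rewrite andbC.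
rewrite -{1}[mu s]add0n big_addn big_mkord; apply: eq_bigr => t _.
rewrite /G /f shift_ratioE addnC -addnS.
set a := (mu i)%:R - _; set b := (mu s + t.+1)%:R - _.
have -> : a = - b by rewrite /a /b; ring.
have -> : - b + k * (s.+1%:R - i%:R) = - (b + k * (i%:R - s.+1%:R)) by ring.
have -> : - b + k * (s%:R - i%:R) = - (b + k * (i%:R - s%:R)) by ring.
by rewrite invrN mulrNN.
Qed.

(** What a box of J contributes beyond the ratio of a box of R: the inverse of the lower hook of
    [mu] times an upper hook with the arm in [lam] and the leg in [mu]. *)
Definition join_row lam mu i : F :=
  \prod_(0 <= j < mu i | (colen mu j < colen lam j)%N)
     (((mu i)%:R - j.+1%:R + k * ((colen mu j)%:R - i%:R)) *
      ((lam i)%:R - j%:R + k * ((colen mu j)%:R - i.+1%:R)))^-1.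

Lemma moved_row lam mu i : is_part lam -> is_part mu -> (mu <= lam)%MM ->
  \prod_(0 <= j < mu i)
     (if colen mu j == colen lam j then hook_up lam i j / hook_up mu i j
      else (hook_low mu i j * hook_up mu i j)^-1) =
  (\prod_(t < lam i - mu i) ((row_content k mu i + t.+1%:R) / t.+1%:R *
     \prod_(l : 'I_n | (i < l)%N) shift_ratio mu i t.+1 l)) * join_row lam mu i.
Proof.
move=> pl pm sub; have /mnm_lepP/(_ i) ml := sub.
(* The upper hook of [mu] in column [j] after its row has been lengthened by [t]. *)
pose g (j t : nat) : F := (mu i + t)%:R - j%:R + k * ((colen mu j)%:R - i.+1%:R).
have -> : \prod_(t < lam i - mu i) ((row_content k mu i + t.+1%:R) / t.+1%:R *
     \prod_(l : 'I_n | (i < l)%N) shift_ratio mu i t.+1 l) =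
    \prod_(0 <= j < mu i) (g j (lam i - mu i)%N / g j 0%N).
  transitivity (\prod_(0 <= t < lam i - mu i) \prod_(0 <= j < mu i)
     (((mu i + t.+1)%:R - j%:R + k * ((colen mu j)%:R - i.+1%:R)) /
      ((mu i + t.+1)%:R - j.+1%:R + k * ((colen mu j)%:R - i.+1%:R)))).
    by rewrite big_mkord; apply: eq_bigr => t _; rewrite row_telescope.
  rewrite exchange_big_nat /=; apply: eq_big_nat => j /andP[_ ji].
  rewrite -(prod_telescope (f := g j)) //; last first.
    move=> c _; apply: generic_diff_neq0; [lia | by rewrite colen_gt | lia].
  apply: eq_bigr => t _; rewrite /g addnS -[(mu i + t).+1%:R]natr1 -(natr1 j).
  by congr (_ / _); ring.
rewrite /join_row [X in _ * X]big_mkcond -big_split /=; apply: eq_big_nat => j /andP[_ ji].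
have gl : g j (lam i - mu i)%N = (lam i)%:R - j%:R + k * ((colen mu j)%:R - i.+1%:R).
  by rewrite /g subnKC.
have g0 : g j 0%N = (mu i)%:R - j%:R + k * ((colen mu j)%:R - i.+1%:R).
  by rewrite /g addn0.
have gl0 : g j (lam i - mu i)%N != 0.
  by apply: generic_diff_neq0; [lia | by rewrite colen_gt | lia].
have g00 : g j 0%N != 0.
  by apply: generic_diff_neq0; [lia | by rewrite colen_gt | lia].
rewrite !hook_upE ?(leq_trans ji) // hook_lowE // -g0.
case: eqP => [cE|cN]; first by rewrite -cE ltnn mulr1 gl.
have -> : (colen mu j < colen lam j)%N.
  by rewrite ltn_neqAle colen_mono // andbT; apply/eqP.
rewrite -gl; set L := _ + _.
have L0 : L != 0.
  apply: generic_diff_neq0; first by lia.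
    by rewrite ltnW // colen_gt.
  by rewrite colen_gt // ji orbT.
by field; rewrite L0 gl0 g00.
Qed.

Definition hook_stem lam mu : F :=
  \prod_i \prod_(0 <= j < mu i)
    (if (mu i < lam i)%N then
       if colen mu j == colen lam j then hook_up lam i j / hook_up mu i j
       else (hook_low mu i j * hook_up mu i j)^-1
     else if colen mu j == colen lam j then 1 else hook_low lam i j / hook_low mu i j).

(* For an arbitrary skew diagram. In a fixed row the hooks of each column
   telescope over the boxes of that column; in a moved row they telescope over
   the runs of columns of equal length. *)
Lemma hook_stemE lam mu : is_part lam -> is_part mu -> (mu <= lam)%MM ->
  hook_stem lam mu =
  (\prod_(s : 'I_n | (mu s < lam s)%N) \prod_(t < lam s - mu s)
     (row_coef k (fun l => (l != s) && ((s < l)%N || (lam l == mu l))) mu s t.+1 / t.+1%:R))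
  * \prod_(s : 'I_n | (mu s < lam s)%N) join_row lam mu s.
Proof.
move=> pl pm sub; have /mnm_lepP ml := sub.
pose up s := \prod_(t < lam s - mu s) ((row_content k mu s + t.+1%:R) / t.+1%:R *
     \prod_(l : 'I_n | (s < l)%N) shift_ratio mu s t.+1 l).
pose dn i s := \prod_(t < lam s - mu s) shift_ratio mu s t.+1 i.
have -> : hook_stem lam mu =
   (\prod_(s : 'I_n | (mu s < lam s)%N) (up s * join_row lam mu s)) *
   (\prod_(i : 'I_n | lam i == mu i) \prod_(s : 'I_n | (i < s)%N) dn i s).
  rewrite /hook_stem (bigID (fun i => (mu i < lam i)%N)) /=; congr (_ * _).
    apply: eq_bigr => i mi; rewrite -moved_row //.
    by apply: eq_bigr => j _; rewrite mi.
  apply: eq_big => i; first by rewrite ltnNge negbK eqn_leq ml andbT.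
  rewrite -leqNgt => mi; rewrite -fixed_row //; last by apply/eqP; rewrite eqn_leq mi ml.
  by apply: eq_bigr => j _; rewrite ltnNge mi.
have -> : \prod_(i : 'I_n | lam i == mu i) \prod_(s : 'I_n | (i < s)%N) dn i s =
    \prod_(s : 'I_n | (mu s < lam s)%N) \prod_(i : 'I_n | (lam i == mu i) && (i < s)%N) dn i s.
  rewrite (exchange_big_dep xpredT) //= [RHS]big_mkcond; apply: eq_bigr => s _.
  case: ltnP => // h; rewrite big1 // => i _; rewrite /dn.
  by move: h; rewrite -subn_eq0 => /eqP ->; rewrite big_ord0.
rewrite big_split /= mulrAC -big_split /=; congr (_ * _); apply: eq_bigr => s ms.
rewrite /up /dn exchange_big -big_split /=; apply: eq_bigr => t _.
rewrite /row_coef -/(shift_ratio mu s t.+1 _) mulrAC -!mulrA; congr (_ * _).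
rewrite [RHS]mulrC; congr (_ * _).
(* Rows below [s] come from [moved_row], unmoved rows above [s] from [fixed_row]. *)
rewrite [RHS](bigID (fun l => (s < l)%N)) /= [RHS]mulrC; congr (_ * _); apply: eq_bigl => l.
  by rewrite -val_eqE /=; case: (ltngtP (val s) (val l)) => //= _; rewrite ?andbT ?andbF.
by rewrite -val_eqE /=; case: (ltngtP (val s) (val l)) => //= _; rewrite ?andbT ?andbF.
Qed.

End Hooks.

(** * The boxes of J and the stem when at most two rows move *)

Section MovedRows.
Variable n : nat.
Implicit Types (lam mu : 'X_{1..n}) (i l s p q : 'I_n).

Lemma colen_moved lam mu j : is_part lam -> is_part mu ->
  (colen mu j < colen lam j)%N -> exists2 l, (mu l <= j)%N & (j < lam l)%N.
Proof.
move=> pl pm h; have hn : (colen mu j < n)%N by apply: leq_trans h (colen_le _ _).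
exists (Ordinal hn); last by rewrite -(colen_gt (Ordinal hn) j pl).
by rewrite leqNgt -(colen_gt (Ordinal hn) j pm) ltnn.
Qed.

Lemma moved_colen lam mu i j : is_part lam -> is_part mu -> (mu i <= j < lam i)%N ->
  (colen mu j < colen lam j)%N.
Proof.
move=> pl pm /andP[h1 h2]; apply: (@leq_ltn_trans i); last by rewrite colen_gt.
by rewrite leqNgt colen_gt // -leqNgt.
Qed.

Variables (lam mu : 'X_{1..n}) (p q : 'I_n).
Hypotheses (pl : is_part lam) (pm : is_part mu) (pq : (p < q)%N).
Hypothesis moved : forall i, (mu i < lam i)%N = (i == p) || (i == q).

Lemma upper_part : (mu q <= mu p)%N /\ (lam q <= lam p)%N.
Proof. by split; [have /is_partP := pm | have /is_partP := pl]; apply; apply: ltnW. Qed.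

Lemma lower_row_join j : (j < mu q)%N -> (colen mu j < colen lam j)%N = false.
Proof.
move=> jq; apply/negP => /(colen_moved pl pm)[l h1 h2].
have : (mu l < lam l)%N by apply: leq_ltn_trans h1 h2.
have [h _] := upper_part.
by rewrite moved => /orP[/eqP E|/eqP E]; move: h1; rewrite E; lia.
Qed.

Lemma upper_row_join j : (j < mu p)%N -> (colen mu j < colen lam j)%N = (mu q <= j < lam q)%N.
Proof.
move=> jp; apply/idP/idP => [/(colen_moved pl pm)[l h1 h2]|]; last exact: moved_colen.
have : (mu l < lam l)%N by apply: leq_ltn_trans h1 h2.
by rewrite moved => /orP[/eqP E|/eqP E]; move: h1 h2; rewrite E; lia.
Qed.

Hypothesis sub : (mu <= lam)%MM.

Lemma not_movedE i : i != p -> i != q -> lam i = mu i.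
Proof.
move=> ip iq; apply/eqP; rewrite eq_sym eqn_leq; have /mnm_lepP -> := sub.
by rewrite leqNgt moved negb_or ip iq.
Qed.

(** If row q - 1 is not p, it is unmoved and at least as long as row q of [lam], so the column
    reaches down to it. *)
Lemma upper_row_colen j : (j < mu p)%N -> (mu q <= j < lam q)%N -> colen mu j = q.
Proof.
move=> jp /andP[h1 h2]; apply/eqP; rewrite eqn_leq leqNgt colen_gt // -leqNgt h1 /=.
have qn : (q.-1 < n)%N by apply: leq_ltn_trans (leq_pred _) (ltn_ord q).
have -> : (val q = (Ordinal qn).+1)%N by rewrite /= prednK //; apply: leq_ltn_trans pq.
rewrite colen_gt //; have [<-//|ip] := eqVneq p (Ordinal qn).
rewrite -not_movedE 1?eq_sym //; last first.
  by rewrite -val_eqE /=; have := leq_ltn_trans (leq0n p) pq; lia.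
by apply: leq_trans h2 _; have /is_partP := pl; apply; apply: leq_pred.
Qed.

End MovedRows.

Section TwoRowStem.
Variables (F : fieldType) (m : nat) (k : F).
Local Notation n := m.+1.
Implicit Types (lam mu : 'X_{1..n}) (i l s : 'I_n) (u d t : nat).

Hypothesis k_generic : forall a b c d : nat,
  a%:R + k * b%:R = c%:R + k * d%:R -> a = c /\ b = d.

Lemma hook_stem_neq0 lam mu : hook_stem k lam mu != 0.
Proof.
have lo nu i j : hook_low k nu i j != 0.
  rewrite /hook_low (_ : _ + k = (nu i - j.+1)%:R + k * (colen nu j - i.+1).+1%:R).
    by apply: generic_neq0; rewrite ?addnS.
  by rewrite -[(_ - _).+1%:R]natr1; ring.
have hi nu i j : hook_up k nu i j != 0.
  rewrite /hook_up (_ : _ + 1 = (nu i - j.+1).+1%:R + k * (colen nu j - i.+1)%:R).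
    by apply: generic_neq0.
  by rewrite -[(_ - _).+1%:R]natr1; ring.
apply/prodf_neq0 => i _; rewrite prodf_seq_neq0; apply/allP => j _ /=.
case: ifP => _; case: ifP => _; rewrite ?oner_eq0 // ?invr_eq0 mulf_neq0 // ?invr_eq0 //.
Qed.

Lemma row_coef_eq (A B : pred 'I_n) mu s t : A =1 B -> row_coef k A mu s t = row_coef k B mu s t.
Proof. by move=> AB; rewrite /row_coef; congr (_ * _); apply: eq_bigl. Qed.

(** With one moved row J is empty, and the stem is the very product that gives the binomial. *)
Lemma leaf_one_row mu s t : is_part mu -> is_part (mu + U_(s) *+ t)%MM ->
  jbinom k (mu + U_(s) *+ t)%MM mu = hook_stem k (mu + U_(s) *+ t)%MM mu.
Proof.
move=> pm pl; have lamE := one_rowE mu s t; move: pl lamE.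
set lam := (mu + _)%MM => pl lamE.
have sub : (mu <= lam)%MM by apply/mnm_lepP => i; rewrite lamE leq_addr.
rewrite /lam (jbinom_one_row k_generic) // -/lam (hook_stemE k_generic pl pm sub).
case: t @lam pl lamE sub => [|t] lam pl lamE sub.
  rewrite big_ord0 !big_pred0 ?mulr1 // => i; rewrite lamE muln0 addn0 ltnn //.
have ms i : (mu i < lam i)%N = (i == s).
  by rewrite lamE eq_sym; case: eqP; lia.
rewrite !(big_pred1 s) // [X in _ * X]big1_seq; last first.
  move=> j /andP[h]; rewrite mem_index_iota => /andP[_ js].
  have [l h1 h2] := colen_moved pl pm h.
  have : (mu l < lam l)%N by apply: leq_ltn_trans h1 h2.
  by rewrite ms => /eqP E; move: h1; rewrite E; lia.
have -> : (lam s - mu s = t.+1)%N by rewrite lamE eqxx; lia.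
rewrite mulr1; apply: eq_bigr => e _; congr (_ / _); apply: row_coef_eq => l /=.
have [//|ls] := eqVneq l s; rewrite lamE [s == l]eq_sym (negbTE ls) mul0n addn0 eqxx.
by rewrite orbT.
Qed.

Variables (mu : 'X_{1..n}) (p q : 'I_n).
Hypotheses (pmu : is_part mu) (pq : (p < q)%N).
Local Notation lam := (two_rows mu p q).
Local Notation delta := (mu p - mu q)%N.
Local Notation b := (q - p.+1)%N.
Local Notation Y0 := (row_gap k delta b).
Let A l := (l != p) && (l != q).

Let pqF : (p == q) = false.
Proof. by apply/eqP => E; have := pq; rewrite E ltnn. Qed.

Lemma two_rows_moved u d i : (0 < u)%N -> (0 < d)%N ->
  (mu i < lam u d i)%N = (i == p) || (i == q).
Proof.
move=> u0 d0; rewrite two_rowsE [i == p]eq_sym [i == q]eq_sym.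
by case: (p =P i); case: (q =P i); lia.
Qed.

Lemma two_rows_sub u d : (mu <= lam u d)%MM.
Proof. by apply/mnm_lepP => i; rewrite two_rowsE -addnA leq_addr. Qed.

Lemma two_rows_upper u d : lam u d p = (mu p + u)%N.
Proof. by rewrite two_rowsE eqxx [q == p]eq_sym pqF; lia. Qed.

Lemma two_rows_lower u d : lam u d q = (mu q + d)%N.
Proof. by rewrite two_rowsE eqxx pqF; lia. Qed.

Lemma shift_ratio_upper t : shift_ratio k mu p t q = (Y0 + t%:R) / (Y0 + t%:R + k).
Proof.
have mpq : (mu q <= mu p)%N by have /is_partP := pmu; apply; apply: ltnW.
have E : row_content k mu p + t%:R - row_content k mu q = Y0 + t%:R + k.
  by rewrite addrAC row_contentB /row_gap !natrB // -(natr1 p); ring.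
by rewrite /shift_ratio E; congr (_ / _); ring.
Qed.

Lemma join_row_upper u d : is_part (lam u d) -> (0 < u)%N -> (0 < d)%N ->
  join_row k (lam u d) mu p =
  \prod_(t < minn d delta) ((Y0 - t.+1%:R + k) * (Y0 - t.+1%:R + u%:R + 1))^-1.
Proof.
move=> pl u0 d0; have mv i := @two_rows_moved u d i u0 d0.
have mpq : (mu q <= mu p)%N by have /is_partP := pmu; apply; apply: ltnW.
transitivity (\prod_(mu q <= j < mu q + minn d delta)
   (((mu p)%:R - j.+1%:R + k * (q%:R - p%:R)) *
    ((mu p + u)%:R - j%:R + k * (q%:R - p.+1%:R)))^-1).
  have lep : (mu q + minn d delta <= mu p)%N by lia.
  rewrite /join_row [RHS](big_nat_widen _ _ _ _ _ lep) [RHS](big_nat_widenl _ 0) //.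
  rewrite big_nat_cond [RHS]big_nat_cond; apply: eq_big => [j|j /andP[/andP[_ jp] h]].
    case: (boolP (0 <= j < mu p)%N) => //= jp.
    rewrite (upper_row_join pl pmu pq mv) // two_rows_lower; lia.
  rewrite (upper_row_join pl pmu pq mv) // in h.
  by rewrite (upper_row_colen pl pmu pq mv (two_rows_sub u d)) // two_rows_upper.
rewrite -{1}[mu q]add0n big_addn addKn big_mkord; apply: eq_bigr => t _.
rewrite /row_gap !natrB // addnC !natrD -(natr1 p) -(natr1 t) -addnS natrD -(natr1 t).
by congr (_^-1); ring.
Qed.

(** Row q enters the coefficients of row p because it lies below; row p, above q and moved, does not
    enter those of row q. This explains the asymmetry of [row_weight]. *)
Lemma hook_stem_two_rows u d : is_part (lam u d) -> (0 < u)%N -> (0 < d)%N ->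
  hook_stem k (lam u d) mu =
  (\prod_(t < u) row_coef k A mu p t.+1) * (\prod_(t < d) row_coef k A mu q t.+1)
  * row_weight k delta b u d.
Proof.
move=> pl u0 d0; have mv i := @two_rows_moved u d i u0 d0.
rewrite (hook_stemE k_generic pl pmu (two_rows_sub u d)).
have two (G : 'I_n -> F) : \prod_(s | (mu s < lam u d s)%N) G s = G p * G q.
  rewrite (bigD1 p) ?mv ?eqxx //= (bigD1 q) ?mv ?eqxx ?orbT 1?eq_sym ?pqF //=.
  by rewrite big_pred0 ?mulr1 // => i; rewrite mv; case: eqP; case: eqP.
rewrite !two two_rows_upper two_rows_lower !addKn.
have -> : join_row k (lam u d) mu q = 1.
  rewrite /join_row big1_seq // => j /andP[h]; rewrite mem_index_iota => /andP[_ js].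
  by rewrite (lower_row_join pl pmu pq mv) in h.
rewrite join_row_upper // mulr1.
set J := \prod_(t < minn d delta) _.
have -> : \prod_(t < u)
    (row_coef k (fun l => (l != p) && ((p < l)%N || (lam u d l == mu l))) mu p t.+1 / t.+1%:R)
  = (\prod_(t < u) row_coef k A mu p t.+1)
    * \prod_(t < u) ((Y0 + t.+1%:R) / ((Y0 + t.+1%:R + k) * t.+1%:R)).
  rewrite -big_split; apply: eq_bigr => t _ /=.
  rewrite {1}/row_coef (bigD1 q) ?pq 1?eq_sym ?pqF //= -/(shift_ratio k mu p t.+1 q).
  rewrite shift_ratio_upper /row_coef invfM.
  set P1 := \prod_(l | _) _; set P2 := \prod_(l | _) _.
  have -> : P1 = P2; last by ring.
  apply: eq_bigl => l; rewrite /A; have [->|lp] := eqVneq l p; first by [].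
  have [->|lq] := eqVneq l q; first by rewrite /= ?eqxx ?andbF.
  by rewrite (not_movedE mv (two_rows_sub u d) lp lq) eqxx orbT.
have -> : \prod_(t < d)
    (row_coef k (fun l => (l != q) && ((q < l)%N || (lam u d l == mu l))) mu q t.+1 / t.+1%:R)
  = (\prod_(t < d) row_coef k A mu q t.+1) * \prod_(t < d) t.+1%:R^-1.
  rewrite -big_split; apply: eq_bigr => t _ /=; congr (_ / _).
  apply: row_coef_eq => l; rewrite /A; have [->|lp] := eqVneq l p.
    have /negbTE -> : lam u d p != mu p by rewrite two_rows_upper; lia.
    by rewrite [(q < p)%N]ltnNge (ltnW pq) andbF.
  have [->|lq] := eqVneq l q; first by [].
  by rewrite (not_movedE mv (two_rows_sub u d) lp lq) eqxx orbT.
by rewrite /row_weight -/J; ring.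
Qed.

Lemma leaf_two_rows u d : is_part (lam u d) -> (0 < u)%N -> (0 < d)%N ->
  jbinom k (lam u d) mu / hook_stem k (lam u d) mu = row_leaf k delta b u d.
Proof.
move=> pl u0 d0.
have -> : jbinom k (lam u d) mu = hook_stem k (lam u d) mu * row_leaf k delta b u d.
  by rewrite hook_stem_two_rows // jbinom_two_rows // mulrA.
by rewrite mulrAC divff ?mul1r // hook_stem_neq0.
Qed.

End TwoRowStem.

(** * The 4-tuple in terms of row lengths, and conclusion *)

Section Tuples.
Variable n : nat.
Implicit Types (lam mu nu : 'X_{1..n}) (i s p q : 'I_n).

Lemma mem_diagram nu i j : ((i, j) \in diagram nu) = (j < nu i)%N.
Proof.
apply/allpairsPdep/idP => [[a [c [_ + [-> ->]]]]|h]; first by rewrite mem_iota.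
by exists i, j; rewrite mem_enum mem_iota.
Qed.

Lemma mem_skewS lam mu i j : ((i, j) \in skewS lam mu) = (mu i <= j < lam i)%N.
Proof. by rewrite mem_filter mem_diagram. Qed.

Lemma mem_skew_rows lam mu i : (i \in skew_rows lam mu) = (mu i < lam i)%N.
Proof. by rewrite mem_filter mem_enum andbT. Qed.

Lemma skew_rows_lt lam mu p q : skew_rows lam mu = [:: p; q] -> (p < q)%N.
Proof.
move=> E; have : sorted (relpre val ltn) (skew_rows lam mu).
  apply: sorted_filter; first by move=> x y z; apply: ltn_trans.
  by rewrite -sorted_map val_enum_ord iota_ltn_sorted.
by rewrite E /= andbT.
Qed.

Lemma count_interval (a b N : nat) : (b <= N)%N ->
  count (fun j => (a <= j < b)%N) (iota 0 N) = (b - a)%N.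
Proof.
move=> bN; rewrite -sum1_count -{1}[N]subn0.
rewrite (eq_bigl (fun j => (j < b)%N && (a <= j)%N)) => [|j]; last by rewrite andbC.
rewrite -(big_nat_widenl _ 0 _ (fun j => (j < b)%N)) // -(big_nat_widen _ _ _ xpredT) //.
by rewrite sum_nat_const_nat muln1.
Qed.

Section TwoRows.
Variables (lam mu : 'X_{1..n}) (p q : 'I_n).
Hypotheses (pl : is_part lam) (pm : is_part mu) (sub : (mu <= lam)%MM).
Hypothesis rows : skew_rows lam mu = [:: p; q].

Let pq := skew_rows_lt rows.
Let moved i : (mu i < lam i)%N = (i == p) || (i == q).
Proof. by rewrite -mem_skew_rows rows !inE. Qed.

Lemma tuple_mE : tuple_m lam mu = (lam q - mu p)%N.
Proof.
have [h1 h2] := upper_part pl pm pq.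
rewrite /tuple_m rows -(@count_interval _ _ (mdeg lam)); last first.
  by rewrite mdegE (bigD1 q) //= leq_addr.
by apply: eq_count => j /=; rewrite !mem_skewS; lia.
Qed.

Lemma mem_boxesJ i j : ((i, j) \in boxesJ lam mu) =
  (i == p) && (j < mu p)%N && (mu q <= j < lam q)%N.
Proof.
rewrite mem_filter mem_diagram /= moved; have [->|ip] /= := eqVneq i p.
  by case: (ltnP j (mu p)) => jp; rewrite ?andbF ?andbT //= (upper_row_join pl pm pq moved).
have [->|//] := eqVneq i q; case: (ltnP j (mu q)) => jq; rewrite ?andbF //.
by rewrite (lower_row_join pl pm pq moved).
Qed.

Lemma tuple_y_gap : (lam q <= mu p)%N ->
  tuple_y lam mu = (mu p - lam q)%:R + r * (q - p.+1)%:R.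
Proof.
move=> gap; have mq : (mu q < lam q)%N by rewrite moved eqxx orbT.
have lq0 : (0 < lam q)%N by apply: leq_ltn_trans mq.
(* The rightmost box of J, in row p above the last box of row q. *)
pose x0 : box n := (p, (lam q).-1).
have x0J : x0 \in boxesJ lam mu by rewrite mem_boxesJ eqxx /=; lia.
have all0 : all (fun s : box n => (s.2 <= x0.2)%N) (boxesJ lam mu).
  by apply/allP => -[i j]; rewrite mem_boxesJ /=; lia.
rewrite /tuple_y tuple_mE (_ : (lam q - mu p)%N = 0%N); last by lia.
rewrite eqxx; case E : [seq _ <- _ | _] => [|x s].
  have : x0 \in [seq x <- boxesJ lam mu | all (fun s : box n => (s.2 <= x.2)%N) (boxesJ lam mu)].
    by rewrite mem_filter all0 x0J.
  by rewrite E in_nil.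
have : x \in [seq x <- boxesJ lam mu | all (fun s : box n => (s.2 <= x.2)%N) (boxesJ lam mu)].
  by rewrite E mem_head.
case: x {E} => i j; rewrite mem_filter mem_boxesJ => /andP[/allP/(_ _ x0J) /= h].
case/andP=> /andP[/eqP -> jp] jq; have -> : j = (lam q).-1 by lia.
rewrite /arm /leg /= (upper_row_colen pl pm pq moved sub) ?prednK //; lia.
Qed.

End TwoRows.
End Tuples.

Lemma leafLE u d m y : leafL u d m y = leaf_sum r (d - m) m y (y + u%:R + r).
Proof. by []. Qed.

Lemma stemE n (lam mu : 'X_{1..n.+1}) : (mu <= lam)%MM -> stem lam mu = hook_stem r lam mu.
Proof.
exact: (@prod_diagram n.+1 Falpha lam mu (fun s => c_low lam s / c_low mu s)
  (fun s => c_up lam s / c_up mu s) (fun s => (c_low mu s * c_up mu s)^-1)).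
Qed.

Lemma leaf_hookE n (lam mu : 'X_{1..n.+1}) : is_part lam -> is_part mu -> (mu <= lam)%MM ->
  leaf lam mu = jbinom r lam mu / hook_stem r lam mu.
Proof. by move=> pl pm sub; rewrite /leaf jack_binomialE // stemE. Qed.

Lemma row_leaf_gap (F : fieldType) (k : F) (a b c u d : nat) :
  (d <= a)%N -> c = (a - d)%N ->
  row_leaf k a b u d = leaf_sum k (d - 0) 0 (c%:R + k * b%:R) (c%:R + k * b%:R + u%:R + k).
Proof.
by move=> da ->; rewrite /row_leaf da subn0 natrB // /row_gap [_ + k * _ - _]addrAC.
Qed.

Lemma row_leaf_overlap (F : fieldType) (k : F) (a b c u d : nat) :
  (a < d)%N -> c = (d - a)%N ->
  row_leaf k a b u d = leaf_sum k (d - c) c 0 (0 + u%:R + k).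
Proof. by move=> ad ->; rewrite /row_leaf leqNgt ad add0r subKn // ltnW. Qed.

Theorem theorem0p2 (M : nat) (hM : (0 < M)%N) (lam mu : 'X_{1..M})
    (hlam : is_part lam) (hmu : is_part mu) (hsub : (mu <= lam)%MM)
    (hrows : (size (skew_rows lam mu) <= 2)%N) :
  leaf lam mu
  = leafL (tuple_u lam mu) (tuple_d lam mu) (tuple_m lam mu) (tuple_y lam mu).
Proof.
case: M hM lam mu hlam hmu hsub hrows => [//|n] _ lam mu pl pm sub.
have /mnm_lepP ml := sub.
(* With at most one moved row the right side has d = 0, hence equals 1 as well. *)
have one s t : lam = (mu + U_(s) *+ t)%MM -> leaf lam mu = 1.
  move=> lamE; rewrite leaf_hookE // lamE (leaf_one_row r_generic) -?lamE //.
  by rewrite divff // (hook_stem_neq0 r_generic).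
case E : (skew_rows lam mu) => [|p [|q [|//]]] _.
- rewrite leafLE /tuple_d /tuple_m E leaf_sum0.
  apply: (one ord0 0%N); apply/mnmP => i; rewrite one_rowE muln0 addn0.
  have : i \notin skew_rows lam mu by rewrite E.
  by rewrite mem_skew_rows -leqNgt; have := ml i; lia.
- rewrite leafLE /tuple_d /tuple_m E leaf_sum0.
  apply: (one p (lam p - mu p)%N); apply/mnmP => i; rewrite one_rowE.
  have [<-|ip] := eqVneq p i; first by have := ml p; lia.
  have : i \notin skew_rows lam mu by rewrite E inE eq_sym.
  by rewrite mem_skew_rows -leqNgt; have := ml i; lia.
have pq := skew_rows_lt E.
have moved i : (mu i < lam i)%N = (i == p) || (i == q).
  by rewrite -mem_skew_rows E !inE.
have [mpq lpq] := upper_part pl pm pq.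
have [mp mq] : (mu p < lam p)%N /\ (mu q < lam q)%N by rewrite !moved !eqxx orbT.
have lamE : lam = two_rows mu p q (lam p - mu p) (lam q - mu q).
  apply/mnmP => i; rewrite two_rowsE.
  have [<-|ip] := eqVneq p i.
    have -> : (q == p) = false by apply/eqP => h; have := pq; rewrite h ltnn.
    by lia.
  have [<-|iq] := eqVneq q i; first by lia.
  by rewrite (not_movedE moved sub) 1?eq_sym //; lia.
have u0 : (0 < lam p - mu p)%N by lia.
have d0 : (0 < lam q - mu q)%N by lia.
have pl' := pl; rewrite lamE in pl'.
have := leaf_two_rows r_generic pm pq pl' u0 d0; rewrite -lamE => L.
rewrite leaf_hookE // L leafLE /tuple_u /tuple_d E (tuple_mE pl pm sub E).
(* Equality belongs to the gap case: the rows then touch without sharing a column, so m = 0. *)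
have [gap|over] := leqP (lam q) (mu p).
  rewrite (tuple_y_gap pl pm sub E gap) (_ : (lam q - mu p)%N = 0%N); last by lia.
  by apply: row_leaf_gap; lia.
rewrite /tuple_y (tuple_mE pl pm sub E) (_ : (_ == 0%N) = false); last by lia.
by apply: row_leaf_overlap; lia.
Qed.
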